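(* Let the probability measure $\mathbf P$ on cookie environments satisfy Assumption (A) (written out in the context), with $S_0$ distributed according to an arbitrary probability distribution $\phi$ on $\mathcal S$, and let $\delta=\sum_{s\in\mathcal S}\pi(s)\sum_{i=1}^{M}(2s(i)-1)$. Let $(X_n)_{n\ge 0}$ be the excited random walk with averaged law $P_0$. Then: if $\delta\in[-1,1]$, the walk is recurrent, i.e. $P_0(X_n=0 \text{ for infinitely many } n)=1$; if $\delta>1$, the walk is right transient, i.e. $P_0(X_n\to+\infty)=1$; if $\delta<-1$, the walk is left transient, i.e. $P_0(X_n\to-\infty)=1$.
   Context: Notation: $\mathbb N=\{1,2,\dots\}$. Excited random walk. A cookie environment is an element $\omega=(\omega(x,i))_{x\in\mathbb Z,i\in\mathbb N}\in[0,1]^{\mathbb Z\times\mathbb N}$. For $x_0\in\mathbb Z$, $P^\omega_{x_0}$ is the law of the integer-valued process $(X_n)_{n\ge0}$ with $X_0=x_0$ and, given $X_0,\dots,X_n$, $X_{n+1}=X_n+1$ with probability $\omega(X_n,I_n)$ and $X_{n+1}=X_n-1$ with probability $1-\omega(X_n,I_n)$, where $I_n=|\{0\le m\le n: X_m=X_n\}|$. Assumption (A). Let $M\in\mathbb N$ and let $\mathcal S^*_M$ be the set of sequences $s=(s(i))_{i\in\mathbb N}$ with $s(i)\in(0,1)$ for $i\le M$ and $s(i)=1/2$ for $i>M$. Let $\mathcal S\subset\mathcal S^*_M$ be countable (finite or infinite), and let $\mathcal K$ be a transition matrix on $\mathcal S$ that is irreducible, aperiodic and positive recurrent, with stationary distribution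 $\pi$, and uniformly ergodic: $\lim_{n\to\infty}\sup_{s\in\mathcal S}\|\mathcal K^n(s,\cdot)-\pi\|_{TV}=0$. Assume the reversed matrix $\widetilde{\mathcal K}(r,r')=\mathcal K(r',r)\pi(r')/\pi(r)$ is also uniformly ergodic (it has the same stationary distribution $\pi$). The process $(S_k)_{k\in\mathbb Z}$ with values in $\mathcal S$ is such that $S_0$ has distribution $\phi$ and, given $S_0$, $(S_k)_{k\ge0}$ and $(R_k)_{k\ge0}$, $R_k=S_{-k}$, are conditionally independent Markov chains started from $S_0$ with transition matrices $\mathcal K$ and $\widetilde{\mathcal K}$ respectively. The random environment is $\omega(k,i)=S_k(i)$, $k\in\mathbb Z$, $i\in\mathbb N$, and $\mathbf P$ denotes its law. Averaged measure: $P_x(\cdot)=\int P_x^\omega(\cdot)\,\mathbf P(d\omega)$. *)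

(* Defs.v *)
From HB Require Import structures.
From mathcomp Require Import all_boot all_order all_algebra.
From mathcomp Require Import all_classical all_reals all_analysis.

Set Implicit Arguments.
Unset Strict Implicit.
Unset Printing Implicit Defensive.

Import Order.TTheory GRing.Theory Num.Theory.
Import numFieldNormedType.Exports.

Local Open Scope classical_set_scope.
Local Open Scope ring_scope.

(** * Transition matrices on a discrete state space *)

Section transition_matrices.
Context {R : realType} {T : choiceType}.
Implicit Types (p q pi : T -> R) (K : T -> T -> R).

(* Sum of a family of reals; meaningful for absolutely summable families. *)
Definition real_sum (f : T -> R) : R :=
  fine (\esum_(x in setT) ((EFin \o f)^\+ x)%E)
  - fine (\esum_(x in setT) ((EFin \o f)^\- x)%E).

Definition is_distribution p : Prop :=
  (forall x, 0 <= p x) /\ (\esum_(x in setT) (p x)%:E = 1)%E.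

Definition transition_matrix K : Prop := forall x, is_distribution (K x).

Fixpoint kpow K (n : nat) : T -> T -> R :=
  if n is n'.+1 then
    fun x y => fine (\esum_(z in setT) (K x z * kpow K n' z y)%:E)
  else fun x y => (x == y)%:R.

Definition irreducible_matrix K : Prop :=
  forall x y, exists n, 0 < kpow K n x y.

Definition aperiodic_matrix K : Prop :=
  forall x (d : nat),
    (forall n, (0 < n)%N -> 0 < kpow K n x x -> (d %| n)%N) -> d = 1%N.

(* [first_passage K n x y] is the probability that the chain started at [x]
   visits [y] at time [n.+1] and at no time in [1, n]. *)
Fixpoint first_passage K (n : nat) : T -> T -> R :=
  if n is n'.+1 then
    fun x y => fine
      (\esum_(z in [set z | z <> y]) (K x z * first_passage K n' z y)%:E)
  else K.

(* Return to [x] is almost sure, with finite mean return time. *)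
Definition positive_recurrent K : Prop :=
  forall x,
    (\esum_(n in [set: nat]) (first_passage K n x x)%:E = 1)%E /\
    (\esum_(n in [set: nat]) (n.+1%:R * first_passage K n x x)%:E < +oo)%E.

Definition stationary K pi : Prop :=
  is_distribution pi /\
  forall y, (\esum_(x in setT) (pi x * K x y)%:E = (pi y)%:E)%E.

Definition tv_dist p q : \bar R :=
  ereal_sup [set (`| \esum_(x in A) (p x)%:E - \esum_(x in A) (q x)%:E |)%E
            | A in [set: set T]].

Definition uniformly_ergodic K pi : Prop :=
  (ereal_sup [set tv_dist (kpow K n x) pi | x in [set: T]]) @[n --> \oo]
    --> 0%E.

Definition reversed_matrix K pi : T -> T -> R :=
  fun r r' => K r' r * pi r' / pi r.

End transition_matrices.

(** * Cookie environments *)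

(* Cookies are numbered from 0 : [s i] is the (i+1)-st cookie of the stack. *)
Definition cookie_stack (R : realType) : Type := nat -> R.

Definition Sstar (R : realType) (M : nat) : set (cookie_stack R) :=
  [set s | (forall i, (i < M)%N -> 0 < s i < 1) /\
           (forall i, (M <= i)%N -> s i = 2^-1)].

(* Events that depend on a single cookie, at a site in [D]. *)
Definition cookie_cylinders (R : realType) (D : set int) :
    set (set (int -> cookie_stack R)) :=
  [set A | exists x i (B : set (measurableTypeR R)),
    [/\ D x, measurable B & A = [set w | B (w x i)]]].

(* Real-valued environments with the product sigma-algebra; the constraint
   that the values are in [0, 1] is [cookie_env]. *)
Definition env (R : realType) :=
  g_sigma_algebraType (@cookie_cylinders R setT).

Definition cookie_env (R : realType) (w : env R) : Prop :=
  forall x i, 0 <= w x i <= 1.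

(* The sigma-algebra generated by the stacks at the sites in [D]. *)
Definition sigma_sites (R : realType) (D : set int) : set (set (env R)) :=
  <<s @cookie_cylinders R D >>.

(* The Markov property, for a process taking its values in [S] almost surely. *)
Definition markov_chain (R : realType) d (Om : measurableType d)
    (P : probability Om R) (U : Type) (S : set U) (K : S -> S -> R)
    (Y : nat -> Om -> U) : Prop :=
  forall n (s : nat -> S),
    (P [set o | forall k, (k <= n.+1)%N -> Y k o = val (s k)] =
     P [set o | forall k, (k <= n)%N -> Y k o = val (s k)]
       * (K (s n) (s n.+1))%:E)%E.

(* The environment is the coordinate process under its law [P]: the stack
   [S_k] is [w k].  As [phi] is a distribution on [S] and the rows of [K] and of
   its reversal are distributions on [S], all the stacks are in [S] a.s. *)
Record assumptionA (R : realType) (M : nat) (S : set (cookie_stack R))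
    (K : S -> S -> R) (pi phi : S -> R) (P : probability (env R) R) : Prop :=
  AssumptionA {
    A_Sstar : S `<=` @Sstar R M;
    A_countable : countable S;
    A_matrix : transition_matrix K;
    A_irreducible : irreducible_matrix K;
    A_aperiodic : aperiodic_matrix K;
    A_positive_recurrent : positive_recurrent K;
    A_stationary : stationary K pi;
    A_uniformly_ergodic : uniformly_ergodic K pi;
    A_reversed_uniformly_ergodic :
      uniformly_ergodic (reversed_matrix K pi) pi;
    A_initial_distribution : is_distribution phi;
    A_initial : forall s : S, P [set w | w 0 = val s] = (phi s)%:E;
    A_forward : markov_chain P K (fun k (w : env R) => w k%:Z);
    A_backward :
      markov_chain P (reversed_matrix K pi)
        (fun k (w : env R) => w (- k%:Z));
    (* conditional independence, given [S_0], of the two half-environments *)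
    A_cond_indep : forall (s : S) (E F : set (env R)),
      @sigma_sites R [set x | 0 <= x] E ->
      @sigma_sites R [set x | x <= 0] F ->
      let S0 := [set w : env R | w 0 = val s] in
      (P (S0 `&` (E `&` F)) * P S0 = P (S0 `&` E) * P (S0 `&` F))%E
  }.

Definition drift (R : realType) (M : nat) (S : set (cookie_stack R))
    (pi : S -> R) : R :=
  real_sum (fun s : S => pi s * \sum_(i < M) (2 * (val s) i - 1)).

(** * Excited random walk *)

HB.instance Definition _ := isPointed.Build int 0.

Definition path_cylinders : set (set (nat -> int)) :=
  [set A | exists n z, A = [set X | X n = z]].

Definition walk_path := g_sigma_algebraType path_cylinders.

(* Number of visits to [x n] up to time [n], time [n] included. *)
Definition visits (x : nat -> int) (n : nat) : nat :=
  #|[pred m : 'I_n.+1 | x m == x n]|.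

(* The next cookie used at time [n] is the [visits x n]-th one of the stack at
   [x n], hence the predecessor with the numbering from 0. *)
Definition quenched_law (R : realType) (x0 : int) (w : env R)
    (mu : set walk_path -> \bar R) : Prop :=
  mu [set X | X 0%N = x0] = 1%E /\
  forall n (x : nat -> int),
    let past := [set X : walk_path | forall m, (m <= n)%N -> X m = x m] in
    let p := w (x n) (visits x n).-1 in
    (mu (past `&` [set X | X n.+1 = (x n + 1)%R]) = mu past * p%:E)%E /\
    (mu (past `&` [set X | X n.+1 = (x n - 1)%R]) = mu past * (1 - p)%:E)%E.

Definition quenched_kernel (R : realType) (x0 : int)
    (Q : R.-pker (env R) ~> walk_path) : Prop :=
  forall w, cookie_env w -> quenched_law x0 w (Q w).

Definition averaged_law (R : realType) (P : probability (env R) R)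
    (Q : R.-pker (env R) ~> walk_path) (B : set walk_path) : \bar R :=
  (\int[P]_w Q w B)%E.

Definition returns_infinitely_often : set walk_path :=
  [set X | infinite_set [set n | X n = 0]].

Definition tends_to_pinfty : set walk_path :=
  [set X | forall z : int, \forall n \near \oo, z <= X n].

Definition tends_to_ninfty : set walk_path :=
  [set X | forall z : int, \forall n \near \oo, X n <= z].

(* Main.v *)
(* Let [z] be the number of steps of the walk from [k] to [k - 1] before a
   stopping time with [X < k].  If [k > 0], the number of steps from [k] to
   [k + 1] before it is the number of successes before the [z]-th failure among
   the trials made with the stack at [k], and each of them is matched by a step
   from [k + 1] to [k].  So the down-crossings of [1, 2, ...] form a branching
   process in the Markovian environment [S_1, S_2, ...], and the walk comes back
   from the right half-line when this process dies out.  Beyond the first [M]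
   cookies the trials are fair, so that given the stack the mean of the next
   generation is [z] plus the drift of the stack.  Uniform ergodicity gives a
   bounded solution of the Poisson equation for this drift; it turns explicit
   functions of [z] into Lyapunov functions: a decaying one, close to
   [z `^ (- eps)], if the mean drift [delta] exceeds 1 (survival has probability
   close to 1 from large [z]), and an unbounded one, close to [ln z], if [delta]
   is at most 1 (extinction).  The comparison of the walk with the branching
   process is Ville's inequality along the paths of the walk, averaged over the
   environment.  Reflection, which replaces [K] by its reversal and [delta] by
   [- delta], treats the left half-line.  Almost surely the neighbours of a site
   visited infinitely often are visited infinitely often, so that a walk which
   does not visit 0 infinitely often tends to plus or minus infinity. *)
Require Import Defs.
From HB Require Import structures.
From mathcomp Require Import all_boot all_order all_algebra finmap.
From mathcomp Require Import all_classical all_reals all_analysis.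
From mathcomp Require Import measurable_realfun ring lra zify.

Set Implicit Arguments.
Unset Strict Implicit.
Unset Printing Implicit Defensive.

Import Order.TTheory GRing.Theory Num.Theory.
Import numFieldNormedType.Exports.

Local Open Scope classical_set_scope.
Local Open Scope ring_scope.

(** * Averages over discrete distributions *)

Section weighted_sums.
Context {R : realType}.
Local Open Scope ereal_scope.

(** The threshold 1 comes from the variance. A generation following [z] individuals has variance
    about [2 z], so for a smooth test function [F] the mean drift contributes [delta * F'(z)] and
    the fluctuations contribute [z * F''(z)]. For [z ^ (- eps)] the two balance at
    [delta = 1 + eps], for [ln z] at [delta = 1]; the critical case is therefore decided by a term
    of lower order, and every error must stay explicit. This is why the estimates are made trial by
    trial, with test functions that are ratios of Gamma functions and have exact differences. The
    set of stacks may be infinite, with cookies arbitrarily close to 1, so the probability of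
    immediate extinction has no uniform lower bound. Uniform ergodicity repairs this: it gives a
    finite set of stacks that is occupied with probability at least 1/2 after a fixed number of
    steps, from any start. For [delta > 1] the almost sure statement comes from letting [z] grow:
    infinitely many returns to 0 entail [z] returns from the right for every [z], and the
    probability of these tends to 0. *)

Lemma esum_swap (T1 T2 : choiceType) (a : T1 -> T2 -> \bar R) :
  (forall i j, 0 <= a i j) ->
  \esum_(i in [set: T1]) \esum_(j in [set: T2]) a i j =
  \esum_(j in [set: T2]) \esum_(i in [set: T1]) a i j.
Proof.
move=> a0; rewrite !esum_esum//.
rewrite (reindex_esum ([set: T2] `*`` (fun=> [set: T1])) _
  (fun k => (k.2, k.1)))//.
split=> // [[x y] [x' y'] _ _ [-> ->]//|[x y] _].
by exists (y, x).
Qed.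

Lemma esum_mull (T : choiceType) (c : R) (f : T -> \bar R) :
  (0 <= c)%R -> (forall x, 0 <= f x) ->
  \esum_(x in [set: T]) (c%:E * f x) = c%:E * \esum_(x in [set: T]) f x.
Proof.
have leM (d : R) (g : T -> \bar R) : (0 <= d)%R -> (forall x, 0 <= g x) ->
    \esum_(x in [set: T]) (d%:E * g x) <= d%:E * \esum_(x in [set: T]) g x.
  move=> d0 g0; apply: ge_ereal_sup => _ [X [finX _] <-].
  rewrite -ge0_mule_fsumr//.
  by apply: lee_wpmul2l; rewrite ?lee_fin// esum_ge//; exists X.
move=> c0 f0; apply/eqP; rewrite eq_le leM//=.
have [->|cn0] := eqVneq c 0%R.
  by rewrite mul0e esum_ge0// => x _; rewrite mul0e.
have fE x : f x = (c^-1)%:E * (c%:E * f x).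
  by rewrite muleA -EFinM mulVf// mul1e.
have h := leM c^-1%R (fun x => c%:E * f x).
have {h}h : \esum_(x in [set: T]) f x <=
    c^-1%:E * \esum_(x in [set: T]) (c%:E * f x).
  rewrite (eq_esum (fun x _ => fE x)); apply: h; first by rewrite invr_ge0.
  by move=> x; rewrite mule_ge0 ?lee_fin.
apply: le_trans (lee_wpmul2l _ h) _; first by rewrite lee_fin.
by rewrite muleA -EFinM divff// mul1e.
Qed.

Lemma term_le_esum (T : choiceType) (f : T -> \bar R) x :
  (forall x, 0 <= f x) -> f x <= \esum_(x in [set: T]) f x.
Proof.
move=> f0; apply: esum_ge; exists [set x]; first by split.
by rewrite fsbig_set1.
Qed.

(** Real weights and an extended real integrand, both meant to be nonnegative: signed functions are
    shifted by a constant before they are averaged. *)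
Definition avg (T : choiceType) (p : T -> R) (f : T -> \bar R) : \bar R :=
  \esum_(x in [set: T]) ((p x)%:E * f x).

Section avg_theory.
Context (T : choiceType).
Variable p : T -> R.
Hypothesis p0 : forall x, (0 <= p x)%R.
Implicit Types f g : T -> \bar R.

Let pe0 x : 0 <= (p x)%:E. Proof. by rewrite lee_fin. Qed.

Lemma avg_ge0 f : (forall x, 0 <= f x) -> 0 <= avg p f.
Proof. by move=> f0; apply: esum_ge0 => x _; exact: mule_ge0. Qed.

Lemma le_avg f g : (forall x, f x <= g x) -> avg p f <= avg p g.
Proof. by move=> fg; apply: le_esum => x _; exact: lee_wpmul2l. Qed.

Lemma eq_avg f g : f =1 g -> avg p f = avg p g.
Proof. by move=> fg; apply: eq_esum => x _; rewrite fg. Qed.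

Lemma avgD f g : (forall x, 0 <= f x) -> (forall x, 0 <= g x) ->
  avg p (fun x => f x + g x) = avg p f + avg p g.
Proof.
move=> f0 g0; rewrite /avg -esumD => [|x _|x _]; try exact: mule_ge0.
by apply: eq_esum => x _; rewrite ge0_muleDr.
Qed.

Lemma avgZ (c : R) f : (0 <= c)%R -> (forall x, 0 <= f x) ->
  avg p (fun x => c%:E * f x) = c%:E * avg p f.
Proof.
move=> c0 f0; rewrite /avg -esum_mull => [||x]; rewrite ?mule_ge0//.
by apply: eq_esum => x _; rewrite muleCA.
Qed.

Lemma avgc (c : R) : (0 <= c)%R -> \esum_(x in setT) (p x)%:E = 1 ->
  avg p (fun=> c%:E) = c%:E.
Proof.
move=> c0 p1; rewrite /avg; under eq_esum do rewrite muleC.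
by rewrite esum_mull// p1 mule1.
Qed.

Lemma avg_le_cst (c : R) f : (0 <= c)%R -> \esum_(x in setT) (p x)%:E = 1 ->
  (forall x, f x <= c%:E) -> avg p f <= c%:E.
Proof. by move=> c0 p1 fc; rewrite -(avgc c0 p1); exact: le_avg. Qed.

Lemma term_le_avg f x : (forall x, 0 <= f x) -> (p x)%:E * f x <= avg p f.
Proof.
by move=> f0; apply: (@term_le_esum _ (fun x => _)) => y; rewrite mule_ge0.
Qed.

Lemma avg_esum (T' : choiceType) (f : T -> T' -> \bar R) :
  (forall x y, 0 <= f x y) ->
  avg p (fun x => \esum_(y in [set: T']) f x y) =
  \esum_(y in [set: T']) avg p (f ^~ y).
Proof.
move=> f0; rewrite /avg -esum_swap => [|x y]; last exact: mule_ge0.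
by apply: eq_esum => x _; rewrite esum_mull.
Qed.

(** Monotone convergence: on a finite subfamily the limit commutes with the sum. It is what makes
    the extinction probability harmonic. *)
Lemma avg_sup (f : nat -> T -> \bar R) :
  (forall n x, 0 <= f n x) ->
  (forall x, {homo f ^~ x : m n / (m <= n)%N >-> m <= n}) ->
  avg p (fun x => ereal_sup (range (f ^~ x))) =
  ereal_sup (range (fun n => avg p (f n))).
Proof.
move=> f0 fnd; apply/eqP; rewrite eq_le; apply/andP; split; last first.
  apply: ge_ereal_sup => _ [n _ <-]; apply: le_avg => x.
  by apply: ereal_sup_ubound; exists n.
apply: ge_ereal_sup => _ [X [finX _] <-].
have cvgf x : f n x @[n --> \oo] --> ereal_sup (range (f ^~ x)).
  exact: ereal_nondecreasing_cvgn.
have cvgX : \sum_(x \in X) ((p x)%:E * f n x) @[n --> \oo] -->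
    \sum_(x \in X) ((p x)%:E * ereal_sup (range (f ^~ x))).
  rewrite fsbig_finite//; under eq_cvg do rewrite fsbig_finite//.
  apply: cvg_nnesum => x _.
    by apply: nearW => n; rewrite mule_ge0.
  exact: cvgeZl.
rewrite -(cvg_lim _ cvgX)//; apply: lime_le; first by apply/cvg_ex; eexists; exact: cvgX.
apply: nearW => n; apply: le_trans (ereal_sup_ubound _); last by exists n.
by apply: esum_ge; exists X.
Qed.

End avg_theory.

Lemma avg_swap (T T' : choiceType) (p : T -> R) (q : T' -> R)
    (f : T -> T' -> \bar R) :
  (forall x, (0 <= p x)%R) -> (forall x, (0 <= q x)%R) ->
  (forall x y, 0 <= f x y) ->
  avg p (fun x => avg q (f x)) = avg q (fun y => avg p (f ^~ y)).
Proof.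
move=> p0 q0 f0; rewrite avg_esum => [|//|x y]; last by rewrite mule_ge0 ?lee_fin.
by apply: eq_esum => y _; rewrite avgZ.
Qed.

End weighted_sums.

(** * Successes before failures in independent trials *)

Section successes_before_failures.
Context {R : realType}.
Implicit Types c : nat -> R.

(* [success_law c d i y] is the probability that exactly [y] successes precede
   the [d]-th failure in independent trials with success probabilities
   [c i, c i.+1, ...]. *)
Fixpoint success_law c (d : nat) : nat -> nat -> R :=
  if d is d'.+1 then
    fix aux (i y : nat) {struct y} : R :=
      if y is y'.+1 then
        c i * aux i.+1 y' + (1 - c i) * success_law c d' i.+1 y'.+1
      else (1 - c i) * success_law c d' i.+1 0%N
  else fun _ y => (y == 0%N)%:R.

Lemma success_law0 c i y : success_law c 0 i y = (y == 0%N)%:R.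
Proof. by []. Qed.

Lemma success_lawS0 c d i :
  success_law c d.+1 i 0 = (1 - c i) * success_law c d i.+1 0.
Proof. by []. Qed.

Lemma success_lawSS c d i y :
  success_law c d.+1 i y.+1 =
  c i * success_law c d.+1 i.+1 y + (1 - c i) * success_law c d i.+1 y.+1.
Proof. by []. Qed.

(** Follows the nested fixpoint: a success lowers [y], a failure lowers [d], so the recursion is
    lexicographic in [(d, y)] while the trial index [i] grows. *)
Lemma success_law_ind (Q : nat -> nat -> nat -> Prop) :
  (forall i y, Q 0%N i y) ->
  (forall d i, Q d i.+1 0%N -> Q d.+1 i 0%N) ->
  (forall d i y, Q d.+1 i.+1 y -> Q d i.+1 y.+1 -> Q d.+1 i y.+1) ->
  forall d i y, Q d i y.
Proof.
move=> Q0 QS0 QSS; elim=> [|d IHd] i y; first exact: Q0.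
by elim: y i => [|y IHy] i; [exact: QS0|exact: QSS].
Qed.

Lemma success_law_ge0 c : (forall i, 0 <= c i <= 1) ->
  forall d i y, 0 <= success_law c d i y.
Proof.
move=> c01; apply: success_law_ind => [i y|d i IH|d i y IH1 IH2].
- by rewrite ler0n.
- by rewrite success_lawS0 mulr_ge0// subr_ge0; have /andP[] := c01 i.
- rewrite success_lawSS; have /andP[c0 c1] := c01 i.
  by rewrite addr_ge0// mulr_ge0// subr_ge0.
Qed.

Local Open Scope ereal_scope.

Lemma esum_natS (f : nat -> \bar R) : (forall n, 0 <= f n) ->
  \esum_(n in [set: nat]) f n = f 0%N + \esum_(n in [set: nat]) f n.+1.
Proof.
move=> f0; rewrite -!nneseries_esumT// nneseries_recl//.
congr (_ + _); rewrite -(@nneseries_addn R f 1)//.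
by apply: eq_eseriesr => i _; rewrite addn1.
Qed.

Section fixed_stack.
Variable c : nat -> R.
Hypothesis c01 : forall i, (0 <= c i <= 1)%R.

Let q0 d i y : (0 <= success_law c d i y)%R.
Proof. exact: success_law_ge0. Qed.

Let c0 i : (0 <= c i)%R. Proof. by have /andP[] := c01 i. Qed.
Let c1 i : (0 <= 1 - c i)%R.
Proof. by rewrite subr_ge0; have /andP[] := c01 i. Qed.

Lemma avg_success0 i (f : nat -> \bar R) : (forall y, 0 <= f y) ->
  avg (success_law c 0 i) f = f 0%N.
Proof.
move=> f0; rewrite /avg esum_natS => [|y]; last by rewrite mule_ge0 ?lee_fin ?q0.
rewrite success_law0 eqxx mul1e esum1 ?adde0// => y _.
by rewrite success_law0 mul0e.
Qed.

Lemma avg_successS d i (f : nat -> \bar R) : (forall y, 0 <= f y) ->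
  avg (success_law c d.+1 i) f =
  (c i)%:E * avg (success_law c d.+1 i.+1) (fun y => f y.+1) +
  (1 - c i)%:E * avg (success_law c d i.+1) f.
Proof.
move=> f0; rewrite /avg.
have g0 d' i' y : 0 <= (success_law c d' i' y)%:E * f y.
  by rewrite mule_ge0 ?lee_fin ?q0.
rewrite esum_natS// [in X in _ = _ + _ * X]esum_natS//.
rewrite ge0_muleDr ?esum_ge0// -!esum_mull//; last first.
  by move=> y; rewrite mule_ge0 ?lee_fin ?q0.
rewrite addeCA -esumD => [|y _|y _]; rewrite ?mule_ge0 ?lee_fin ?q0//.
congr (_ + _); first by rewrite success_lawS0 EFinM muleA.
apply: eq_esum => y _; rewrite success_lawSS EFinD ge0_muleDl; last 2 first.
- by rewrite lee_fin mulr_ge0 ?q0.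
- by rewrite lee_fin mulr_ge0 ?q0.
by rewrite !EFinM !muleA.
Qed.

(** Optional stopping: [V i d r] is a nonnegative supermartingale in the next trial [i], the
    failures [d] still required and the successes [r] so far. The set [D] of trial indices, closed
    under successor, allows the hypotheses to be restricted to the fair trials. *)
Lemma avg_success_super (D : nat -> Prop) (V : nat -> nat -> nat -> R)
    (g : nat -> \bar R) :
  (forall y, 0 <= g y) ->
  (forall i, D i -> D i.+1) ->
  (forall i d r, D i -> (0 <= V i d r)%R) ->
  (forall i r, D i -> g r <= (V i 0%N r)%:E) ->
  (forall i d r, D i ->
    (c i * V i.+1 d.+1 r.+1 + (1 - c i) * V i.+1 d r <= V i d.+1 r)%R) ->
  forall i d r, D i ->
    avg (success_law c d i) (fun y => g (r + y)%N) <= (V i d r)%:E.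
Proof.
move=> g0 DS V0 Vg VS.
(* The number of trials is unbounded; cutting [g] off at [N] further successes makes an induction on
   [N] and [d] possible. A finite subsum of the average sees finitely many [y], so the bound passes
   to the full sum. *)
pose tr N (y : nat) := ((y < N)%N%:R : R)%:E.
have trg N y r : 0 <= tr N y * g (r + y)%N by rewrite mule_ge0 ?lee_fin ?ler0n.
have claim N : forall i d r, D i ->
    avg (success_law c d i) (fun y => tr N y * g (r + y)%N) <= (V i d r)%:E.
  elim: N => [|N IHN] i d r Di.
    rewrite /avg esum1 ?lee_fin ?V0// => y _.
    by rewrite /tr ltn0 mul0e mule0.
  elim: d i r Di => [|d IHd] i r Di.
    by rewrite avg_success0// /tr mul1e addn0 Vg.
  rewrite avg_successS//; apply: (@le_trans _ _
    (c i * V i.+1 d.+1 r.+1 + (1 - c i) * V i.+1 d r)%:E); last first.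
    by rewrite lee_fin; exact: VS.
  rewrite [leRHS]EFinD !EFinM; apply: leeD; last first.
    by apply: lee_wpmul2l; rewrite ?lee_fin//; exact/IHd/DS.
  apply: lee_wpmul2l; first by rewrite lee_fin.
  apply: le_trans (IHN i.+1 d.+1 r.+1 (DS _ Di)).
  by apply: le_avg => // y; rewrite /tr ltnS addSnnS.
move=> i d r Di; apply: ge_ereal_sup => _ [X [finX _] <-].
have [N XN] : exists N, forall y, X y -> (y < N)%N.
  exists (\max_(y <- fset_set X) y).+1 => y Xy; rewrite ltnS.
  have yX : y \in (fset_set X : seq nat) by rewrite in_fset_set// inE.
  exact: (@leq_bigmax_seq _ _ xpredT (fun y => y) y yX isT).
apply: le_trans (claim N i d r Di); apply: esum_ge; exists X => //.
rewrite le_eqVlt; apply/orP; left; apply/eqP; apply: eq_fsbigr => y.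
by rewrite inE => /XN yN; rewrite /tr yN mul1e.
Qed.

Lemma avg_success_le1 d i : avg (success_law c d i) (fun=> 1) <= 1.
Proof.
apply: (@avg_success_super (fun=> True) (fun _ _ _ => 1%R) (fun=> 1) _ _ _ _ _ i d 0%N)
  => //= i' d' _ _.
by rewrite !mulr1 addrC subrK.
Qed.

(** * Trials that are fair from index [M] on *)

Section fair_tail.
Variable M : nat.
Hypothesis cM : forall i, (M <= i)%N -> c i = 2^-1%R.

Lemma success_law_tail d i j y : (M <= i)%N -> (M <= j)%N ->
  success_law c d i y = success_law c d j y.
Proof.
elim: d i j y => [//|d IHd] i j y; elim: y i j => [|y IHy] i j Mi Mj.
  rewrite !success_lawS0 !cM//.
  by congr (_ * _)%R; apply: IHd; exact: leqW.
rewrite !success_lawSS !cM//; congr (_ * _ + _ * _)%R.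
  by apply: IHy; exact: leqW.
by apply: IHd; exact: leqW.
Qed.

(** The [d]-th failure occurs almost surely. Beyond [M] the mass does not depend on the starting
    trial, so conditioning on one trial reads [m = m / 2 + 1 / 2], and the mass, being finite, is 1.
    Earlier trials follow by descending from [maxn i' M]. *)
Lemma avg_success_cst1 d i : avg (success_law c d i) (fun=> 1) = 1.
Proof.
have [m mE] : exists m : nat -> nat -> R,
    forall d i, avg (success_law c d i) (fun=> 1) = (m d i)%:E.
  exists (fun d i => fine (avg (success_law c d i) (fun=> 1))) => d' i'.
  rewrite fineK// ge0_fin_numE; last by apply: avg_ge0 => // y; exact: q0.
  by rewrite (le_lt_trans (avg_success_le1 _ _))// ltry.
have mS d' i' : m d'.+1 i' = (c i' * m d'.+1 i'.+1 + (1 - c i') * m d' i'.+1)%R.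
  by apply: EFin_inj; rewrite -mE avg_successS// !mE.
suff h d' i' : m d' i' = 1%R by rewrite mE h.
elim: d' i' => [|d' IHd] i'; first by apply: EFin_inj; rewrite -mE avg_success0.
have hM j : (M <= j)%N -> m d'.+1 j = 1%R.
  move=> Mj; have : m d'.+1 j = m d'.+1 j.+1.
    apply: EFin_inj; rewrite -!mE; apply: eq_esum => y _.
    by rewrite (success_law_tail _ _ Mj (leqW Mj)).
  have := mS d' j; rewrite IHd cM// => -> ; lra.
have [k ->] : exists k, i' = (maxn i' M - k)%N.
  by exists (maxn i' M - i')%N; lia.
elim: k => [|k IHk]; first by rewrite subn0 hM// leq_maxr.
have [kM|kM] := leqP (maxn i' M) k; last first.
  by rewrite mS IHd -subSn// subSS IHk; ring.
by move: IHk; rewrite (eqP (_ : maxn i' M - k == 0)%N) ?subn_eq0//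
  (eqP (_ : maxn i' M - k.+1 == 0)%N) ?subn_eq0// leqW.
Qed.

(** With fair trials [r + d] is a martingale; each of the [M - i] remaining biased trials raises its
    mean by at most 1, which [V] pays in advance. *)
Lemma avg_success_id d : 
  avg (success_law c d 0) (fun y => y%:R%:E) <= (d + M)%N%:R%:E.
Proof.
pose g (y : nat) : \bar R := y%:R%:E.
pose V (i d r : nat) : R := (r + d + (M - i))%N%:R%R.
have h := @avg_success_super (fun=> True) V g _ _ _ _ _ 0%N d 0%N I.
apply: le_trans (h _ _ _ _ _) _ => {h} //; last by rewrite /V subn0.
- by move=> y; rewrite lee_fin.
- by move=> i r _; rewrite lee_fin ler_nat addn0 leq_addr.
move=> i d' r _; rewrite /V; have [iM|Mi] := ltnP i M; last first.
  have [-> ->] : (M - i = 0 /\ M - i.+1 = 0)%N by lia.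
  rewrite cM// !addn0 !natrD -(natr1 r) -(natr1 d'); lra.
have := c01 i; rewrite -(subnSK iM) !natrD -(natr1 r) -(natr1 d').
rewrite -(natr1 (M - i.+1)) => ?.
have : (0 <= (M - i.+1)%:R :> R)%R by [].
have : (0 <= r%:R :> R)%R by [].
have : (0 <= d'%:R :> R)%R by [].
nra.
Qed.

(* [n] stands for successes so far plus failures still required: under fair
   trials it performs a simple random walk. *)
Lemma avg_success_fair (W : nat -> nat -> R) (g : nat -> \bar R) :
  (forall y, 0 <= g y) ->
  (forall n m, (m <= n)%N -> (0 <= W n m)%R) ->
  (forall n, g n <= (W n 0%N)%:E) ->
  (forall n m, (m <= n)%N -> (W n.+2 m.+1 + W n m <= 2 * W n.+1 m.+1)%R) ->
  forall d r, avg (success_law c d M) (fun y => g (r + y)%N) <= (W (r + d)%N d)%:E.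
Proof.
move=> g0 W0 Wg WS d r.
apply: (@avg_success_super (fun i => (M <= i)%N) (fun _ d r => W (r + d)%N d) g)
  => //.
- by move=> i /leqW.
- by move=> i d' r' _; exact/W0/leq_addl.
- by move=> i r' _; rewrite addn0.
- move=> i d' r' Mi; rewrite cM// !addSn !addnS.
  have := WS (r' + d')%N d' (leq_addl _ _); lra.
Qed.

(* The conditional expectation of [A + B * n] given the first [i] trials, [k]
   of which failed. *)
Lemma avg_success_cookies (z : nat) (A B : R) (g : nat -> \bar R) :
  (M <= z)%N -> (forall y, 0 <= g y) ->
  (forall k, (k <= M)%N ->
    avg (success_law c (z - k) M) (fun y => g (M - k + y)%N) <=
    (A + (M%:R - k%:R *+ 2) * B)%:E) ->
  avg (success_law c z 0) g <= (A + (\sum_(i < M) (2 * c i - 1)) * B)%:E.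
Proof.
move=> Mz g0 gM.
(* Descending induction on the trial index [M - j]. Since [M <= z], the [z]-th failure cannot
   precede one of the first [M] trials, so [z - k] is positive whenever such a trial is made. *)
suff claim j : (j <= M)%N -> forall k, (k <= M - j)%N ->
    avg (success_law c (z - k) (M - j)) (fun y => g (M - j - k + y)%N) <=
    (A + ((M - j)%:R - k%:R *+ 2 + \sum_(M - j <= i < M) (2 * c i - 1)) * B)%:E.
  have := claim M (leqnn _) 0%N; rewrite subnn !subn0 leqnn => /(_ isT).
  by rewrite mul0rn subrr add0r big_mkord.
elim: j => [|j IHj] jM k kM.
  rewrite subn0 big_geq// addr0; apply: gM.
  by rewrite subn0 in kM.
have zk : (z - k = (z - k.+1).+1)%N by lia.
rewrite zk avg_successS// -zk.
have Mj : ((M - j.+1).+1 = M - j)%N by lia.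
have h1 := IHj (ltnW jM) k; have h2 := IHj (ltnW jM) k.+1.
rewrite [in leRHS]big_ltn; last by lia.
set s := (\sum_(_ <= i < M) _)%R.
rewrite Mj in s *; rewrite -/s in h1 h2.
apply: (@le_trans _ _ ((c (M - j.+1) * (A + ((M - j)%:R - k%:R *+ 2 + s) * B)
  + (1 - c (M - j.+1)) * (A + ((M - j)%:R - k.+1%:R *+ 2 + s) * B))%:E)).
  rewrite [leRHS]EFinD !EFinM; apply: leeD; apply: lee_wpmul2l;
    rewrite ?lee_fin//.
    have kj : (k <= M - j)%N by lia.
    rewrite (eq_avg _ (_ : _ =1 (fun y => g (M - j - k + y)%N))); first exact: h1.
    by move=> y; congr g; lia.
  have kj : (k < M - j)%N by lia.
  rewrite (eq_avg _ (_ : _ =1 (fun y => g (M - j - k.+1 + y)%N))); first exact: h2.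
  by move=> y; congr g; lia.
rewrite lee_fin -Mj -(natr1 k) -(natr1 (M - j.+1)) le_eqVlt; apply/orP; left; apply/eqP; ring.
Qed.

End fair_tail.
End fixed_stack.
End successes_before_failures.

(** * Discrete power functions *)

Section falling_family.
Context {R : realType}.
Variables al b : R.
Hypothesis al0 : 0 <= al.
Hypothesis b_ge : al + 4 <= b.

Fixpoint falling0 (n : nat) : R :=
  if n is n'.+1 then falling0 n' * (n'%:R + b) / (n'%:R + b + al) else 1.

(* Up to a factor, [Gamma (n + b) / Gamma (n + b + al + j)]: a discrete
   counterpart of [n `^ (- (al + j))] with exact differences. *)
Definition falling : nat -> nat -> R :=
  locked (fun j n => falling0 n / \prod_(i < j) (n%:R + b + al + i%:R)).

Let fallingE j n :
  falling j n = falling0 n / \prod_(i < j) (n%:R + b + al + i%:R).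
Proof. by rewrite /falling -lock. Qed.

Let X0 n : 0 < n%:R + b.
Proof. by have : (0 <= n%:R :> R) by []; move: al0 b_ge; lra. Qed.

Let Y0 n i : 0 < n%:R + b + al + i%:R.
Proof.
have := X0 n; have : (0 <= i%:R :> R) by []; move: al0; lra.
Qed.

Let P0 n j : 0 < \prod_(i < j) (n%:R + b + al + i%:R).
Proof. by apply: prodr_gt0 => i _. Qed.

Lemma falling_gt0 j n : 0 < falling j n.
Proof.
rewrite fallingE divr_gt0//; elim: n => [|n IHn] //=.
by rewrite divr_gt0 ?mulr_gt0//; have := Y0 n 0; rewrite addr0.
Qed.

Let F0 j n : 0 <= falling j n. Proof. by rewrite ltW ?falling_gt0. Qed.

(** With [falling_next], this expresses the values of order [j] at [n] and at [n.+1] through the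
    same value of order [j.+1], up to linear factors; subtracting the two gives the exact
    differences below. *)
Lemma falling_col j n :
  falling j n = falling j.+1 n * (n%:R + b + al + j%:R).
Proof.
rewrite !fallingE big_ord_recr/= invfM -!mulrA mulVf ?mulr1//.
by rewrite gt_eqF.
Qed.

Lemma falling_next j n : falling j n.+1 = falling j.+1 n * (n%:R + b).
Proof.
rewrite !fallingE big_ord_recl/= addr0.
have -> : \prod_(i < j) (n.+1%:R + b + al + i%:R) =
    \prod_(i < j) (n%:R + b + al + (bump 0 i)%:R) :> R.
  by apply: eq_bigr => i _; rewrite /bump/= add1n -!natr1; ring.
rewrite invfM; ring.
Qed.

Lemma falling_diff j n :
  falling j n.+1 = falling j n - (al + j%:R) * falling j.+1 n.
Proof. rewrite falling_next (falling_col j n); ring. Qed.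

Lemma falling_diff2 j n :
  falling j n.+2 + falling j n - 2 * falling j n.+1 =
  (al + j%:R) * (al + j%:R + 1) * falling j.+2 n.
Proof. rewrite !falling_diff -(natr1 j); ring. Qed.

Lemma falling_decr j n m : (n <= m)%N -> falling j m <= falling j n.
Proof.
move=> /subnK <-; elim: (m - n)%N => [|k IHk]; first by rewrite add0n.
apply: le_trans IHk; rewrite addSn falling_diff lerBlDr lerDl.
by apply: mulr_ge0; rewrite ?F0 ?addr_ge0.
Qed.

(** The ratio of consecutive values is [1 + (al + j) / (n + b)], at most 2 because [b] is at least
    [al + 4]. *)
Lemma falling_double j n : (j <= 4)%N -> falling j n <= 2 * falling j n.+1.
Proof.
move=> j4; rewrite falling_next (falling_col j n).
have := falling_gt0 j.+1 n; have : j%:R <= 4 :> R by rewrite (ler_nat _ _ 4).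
have : (0 <= n%:R :> R) by [].
move: al0 b_ge; nra.
Qed.

Lemma falling_near M j n z : (j <= 4)%N -> (z <= n + M)%N ->
  falling j n <= 2 ^+ M * falling j z.
Proof.
move=> j4; elim: M n => [|M IHM] n zn.
  by rewrite mul1r; apply: falling_decr; rewrite addn0 in zn.
apply: le_trans (falling_double n j4) _; rewrite exprS -mulrA ler_pM2l//.
by apply: IHM; rewrite addSnnS.
Qed.

(** First-order expansion in a window of width [M]. To the right of [z] monotonicity is enough; to
    the left, each of at most [M] unit steps costs a multiple of [falling j.+1], which
    [falling_near] brings back to [z]. *)
Lemma falling_upper M j n z : (j <= 3)%N -> (z <= n + M)%N ->
  falling j n <= falling j z + (al + j%:R) * (M%:R * 2 ^+ M) * falling j.+1 z.
Proof.
move=> j3 zn; have [zln|nz] := leqP z n.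
  apply: le_trans (falling_decr j zln) _; rewrite lerDl.
  by apply: mulr_ge0; rewrite ?F0// !mulr_ge0 ?addr_ge0.
suff claim k : (k <= M)%N -> falling j (z - k) <= falling j z +
    (al + j%:R) * (k%:R * 2 ^+ M) * falling j.+1 z.
  rewrite (_ : n = z - (z - n))%N; last by lia.
  apply: le_trans (claim _ _) _; first by lia.
  rewrite lerD2l ler_wpM2r ?ler_wpM2l ?addr_ge0 ?F0//.
  by rewrite ler_wpM2r// ler_nat; lia.
elim: k => [|k IHk] kM; first by rewrite subn0 mul0r mulr0 mul0r addr0.
have [zk|kz] := leqP z k.
  have e : (z - k.+1 = z - k)%N by lia.
  rewrite e; apply: le_trans (IHk (ltnW kM)) _.
  rewrite lerD2l ler_wpM2r ?ler_wpM2l ?addr_ge0 ?F0//.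
  by rewrite ler_wpM2r// ler_nat.
have e : (z - k = (z - k.+1).+1)%N by lia.
have := IHk (ltnW kM); rewrite e falling_diff.
have := @falling_near M j.+1 (z - k.+1) z j3 ltac:(lia).
have : 0 <= al + j%:R by rewrite addr_ge0.
rewrite -(natr1 k); nra.
Qed.

Lemma falling_lower M j n z : (n <= z + M)%N ->
  falling j z - (al + j%:R) * M%:R * falling j.+1 z <= falling j n.
Proof.
move=> nz; apply: (@le_trans _ _ (falling j (z + M))); last exact: falling_decr.
elim: M {nz} => [|M IHM]; first by rewrite addn0 mulr0 mul0r subr0.
rewrite addnS falling_diff.
have := @falling_decr j.+1 _ _ (leq_addr M z).
have : 0 <= al + j%:R by rewrite addr_ge0.
move: IHM; rewrite -(natr1 M); nra.
Qed.

Lemma falling_mass j z : z%:R * falling j.+1 z <= falling j z.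
Proof.
rewrite (falling_col j z) mulrC ler_pM2l ?falling_gt0//.
have : 0 <= j%:R :> R by []. move: al0 b_ge; lra.
Qed.

(** A large [z] absorbs any constant at the price of one order; this is how the error terms are
    beaten beyond a threshold. *)
Lemma falling_small j z (C : R) : C <= z%:R ->
  C * falling j.+1 z <= falling j z.
Proof.
move=> Cz; apply: le_trans (falling_mass j z).
by rewrite ler_wpM2r// ltW// falling_gt0.
Qed.

(* The corrector [m * c * falling j.+2] dominates the convexity of
   [falling j] along the walk [(n, m)]. *)
Lemma falling_super j c n m : (m <= n)%N -> 0 <= c ->
  (al + j%:R) * (al + j%:R + 1) * b + c * (al + j%:R + 2) * (al + j%:R + 3)
    <= c * b ->
  (falling j n.+2 + m.+1%:R * c * falling j.+2 n.+2) +
  (falling j n + m%:R * c * falling j.+2 n) <=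
  2 * (falling j n.+1 + m.+1%:R * c * falling j.+2 n.+1).
Proof.
move=> mn c0 cb.
have d1 := falling_diff2 j n; have d2 := falling_diff2 j.+2 n.
have [k1 [k2 k3]] : [/\ falling j.+2 n =
  falling j.+4 n * (n%:R + b + al + (j%:R + 3)) * (n%:R + b + al + (j%:R + 2)),
   0 < falling j.+4 n & m.+1%:R <= n%:R + 1 :> R].
  rewrite natr1 ler_nat; split=> //; last exact: falling_gt0.
  by rewrite (falling_col j.+2) (falling_col j.+3) -!(natr1 j.+2) -(natr1 j.+1) -(natr1 j);
    congr (_ * _ * _); ring.
set g4 := falling j.+4 n in d2 k1 k2 *.
set g2 := falling j.+2 n in d1 d2 k1 *.
set J : R := j%:R in cb d1 d2 k1 *.
have J0 : 0 <= J by rewrite /J.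
have n0 : 0 <= n%:R :> R by [].
set N : R := n%:R in k1 k3 n0.
have jE : j.+2%:R = J + 2 by rewrite -(natr1 j.+1) -(natr1 j) -/J; ring.
rewrite jE in d2.
have m1 : m.+1%:R = m%:R + 1 :> R by rewrite natr1.
have m0 : 0 <= m%:R :> R by [].
set mm : R := m%:R in m1 m0 *.
rewrite m1 in k3 *.
(* A failure removes one unit [c * g2] of the corrector. It has to pay for the second difference of
   [falling j] and for the convexity of the corrector itself; as [m.+1 <= n.+1], the latter costs
   only a fraction of order [1 / b]. *)
have main : (al + J) * (al + J + 1) * g2 +
    (mm + 1) * c * ((al + (J + 2)) * (al + (J + 2) + 1) * g4) <= c * g2.
  have Y2 : mm + 1 <= N + b + al + (J + 2) by move: al0 b_ge; lra.
  have bpos : 0 < b by move: al0 b_ge; lra.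
  have Y3 : b <= N + b + al + (J + 3) by move: al0; lra.
  have g2b : (mm + 1) * g4 * b <= g2.
    have m10 : 0 <= mm + 1 by lra.
    have := ler_wpM2l (ltW k2) (ler_pM m10 (ltW bpos) Y2 Y3).
    rewrite k1; lra.
  rewrite -(ler_pM2r bpos).
  have g2p : 0 < g2 by rewrite /g2 falling_gt0.
  have c23 : 0 <= c * ((al + (J + 2)) * (al + (J + 2) + 1)).
    by rewrite !mulr_ge0// ?addr_ge0.
  have := ler_wpM2l c23 g2b.
  have := ler_wpM2r (ltW g2p) cb.
  lra.
have := congr1 (fun x => (mm + 1) * c * x) d2.
move: d1 main; lra.
Qed.

Lemma falling00 : falling 0 0 = 1.
Proof. by rewrite !fallingE big_ord0 /= divr1. Qed.

End falling_family.

Section near_linear.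
Context {R : realType}.

(** Slopes are bounded above to the right of [z] and below to the left, where increments are
    subtracted; each of at most [M] steps then adds an error [e]. *)
Lemma near_linear (f : nat -> R) (M z n : nat) (D e : R) :
  0 <= e -> (n <= z + M)%N -> (z <= n + M)%N ->
  (forall k, (z <= k)%N -> (k < z + M)%N -> f k.+1 - f k <= D + e) ->
  (forall k, (k < z)%N -> (z <= k + M)%N -> D - e <= f k.+1 - f k) ->
  f n <= f z + (n%:R - z%:R) * D + M%:R * e.
Proof.
move=> e0 nz zn fu fl.
have claim : exists2 l : nat, (l <= M)%N &
    f n <= f z + (n%:R - z%:R) * D + l%:R * e.
  have [zln|nltz] := leqP z n.
    exists (n - z)%N; first by lia.
    move: nz zn; rewrite -(subnKC zln); move: (n - z)%N => k.
    rewrite addKn leq_add2l => kM _.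
    have -> : (z + k)%:R - z%:R = k%:R :> R by rewrite natrD addrAC subrr add0r.
    elim: k kM => [|k IHk] kM; first by rewrite addn0 !mul0r !addr0.
    have := IHk (ltnW kM); have := fu (z + k)%N (leq_addr _ _).
    rewrite ltn_add2l addnS => /(_ kM); rewrite -(natr1 k); lra.
  exists (z - n)%N; first by lia.
  have [k kz nE] : exists2 k, (k <= z)%N & n = (z - k)%N.
    by exists (z - n)%N; lia.
  have kM : (k <= M)%N by lia.
  rewrite nE subKn//.
  have -> : (z - k)%:R - z%:R = - k%:R :> R.
    by rewrite natrB// addrAC subrr add0r.
  move=> {nz zn nltz nE}.
  elim: k kz kM => [|k IHk] kz kM; first by rewrite subn0; lra.
  have := IHk (ltnW kz) (ltnW kM).
  have := fl (z - k.+1)%N ltac:(lia) ltac:(lia).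
  rewrite (_ : (z - k.+1).+1 = z - k)%N; last by lia.
  rewrite -(natr1 k); lra.
case: claim => l lM fn; apply: le_trans fn _.
by rewrite lerD2l ler_wpM2r// ler_nat.
Qed.

End near_linear.

(** Since [avg] is additive on nonnegative functions, the affine function with the absolute values
    of [B] and [D] as coefficients is added on both sides and cancelled at the end. *)
Lemma avg_affine {R : realType} (T : choiceType) (p : T -> R) (u : T -> R)
    (B D U : R) :
  (forall x, 0 <= p x) -> (\esum_(x in setT) (p x)%:E = 1)%E ->
  (forall x, 0 <= u x) -> avg p (EFin \o u) = U%:E ->
  (forall x, 0 <= B + D * u x) ->
  avg p (fun x => (B + D * u x)%:E) = (B + D * U)%:E.
Proof.
move=> p0 p1 u0 uU Bu0.
have affine0 B' D' : 0 <= B' -> 0 <= D' ->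
    avg p (fun x => (B' + D' * u x)%:E) = (B' + D' * U)%:E.
  move=> B'0 D'0; rewrite EFinD EFinM -(avgc p0 B'0 p1) -uU -avgZ//.
  rewrite -avgD//; last by move=> x; rewrite lee_fin mulr_ge0.
have /(congr1 (fun x => x - (`|B| + `|D| * U)%:E)%E) :
    (avg p (fun x => (B + D * u x)%:E) + (`|B| + `|D| * U)%:E =
     ((B + `|B|) + (D + `|D|) * U)%:E)%E.
  rewrite -affine0// -affine0; last 2 first.
  - by have := ler_norm (- B); rewrite normrN; lra.
  - by have := ler_norm (- D); rewrite normrN; lra.
  have Bu'0 x : (0 <= (`|B| + `|D| * u x)%:E)%E.
    by rewrite lee_fin addr_ge0 ?mulr_ge0.
  rewrite -(avgD p0 _ Bu'0)//.
  by apply: eq_avg => x; rewrite -EFinD; congr (_%:E); ring.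
rewrite addeK// => ->; rewrite -EFinB; congr (_%:E); ring.
Qed.

(** Joins the biased and the fair phase. If [k] of the first [M] trials fail, then [M - k] successes
    have been seen and [z - k] failures are still due, so that the potential [W] of the fair phase
    is entered at [n = z + M - 2 k] and [m = z - k]. *)
Lemma success_law_bound {R : realType} (c : nat -> R) (M z : nat) (A B : R)
    (g : nat -> R) (W : nat -> nat -> R) :
  (forall i, 0 <= c i <= 1) -> (forall i, (M <= i)%N -> c i = 2^-1) ->
  (M <= z)%N -> (forall n, 0 <= g n) ->
  (forall n m, (m <= n)%N -> 0 <= W n m) -> (forall n, g n <= W n 0%N) ->
  (forall n m, (m <= n)%N -> W n.+2 m.+1 + W n m <= 2 * W n.+1 m.+1) ->
  (forall k n, (k <= M)%N -> (n + k.*2 = z + M)%N ->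
    W n (z - k)%N <= A + (n%:R - z%:R) * B) ->
  (avg (success_law c z 0) (EFin \o g) <=
    (A + (\sum_(i < M) (2 * c i - 1)) * B)%:E)%E.
Proof.
move=> c01 cM Mz g0 W0 gW WS WAB.
apply: avg_success_cookies => // k kM.
have gE y : (0 <= (EFin \o g) y)%E by rewrite lee_fin.
have gWE n : ((EFin \o g) n <= (W n 0%N)%:E)%E by rewrite lee_fin.
apply: le_trans (avg_success_fair c01 cM gE W0 gWE WS (z - k) (M - k)) _.
rewrite lee_fin; apply: le_trans (WAB k _ kM _) _; first by lia.
rewrite lerD2l natrD !natrB//; last exact: leq_trans Mz.
by rewrite le_eqVlt; apply/orP; left; apply/eqP; ring.
Qed.

(** * Divergence of harmonic sums and decay of [falling 0] *)

Section harmonic_growth.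
Context {R : realType}.

Lemma harmonic_sum_unbounded (b C : R) : 1 <= b ->
  exists N, forall n, (N <= n)%N -> C <= \sum_(i < n) (i%:R + b)^-1.
Proof.
move=> b1; have b0 : 0 < b by lra.
have dvg : (series (@harmonic R)) n @[n --> \oo] --> +oo.
  apply: nondecreasing_dvgn_lt; last exact: dvg_harmonic.
  by apply: nondecreasing_series => n _ _; rewrite ltW// harmonic_gt0.
move/cvgryPge : dvg => /(_ (C * b)) [N _ NP].
exists N => n Nn; have := NP n Nn.
rewrite /= /series/= big_mkord -ler_pdivlMr// mulr_suml => h.
apply: le_trans h _; apply: ler_sum => i _.
rewrite /harmonic/= -invfM lef_pV2 ?posrE ?mulr_gt0// ?ltr_wpDl//.
rewrite -natr1; have : 0 <= i%:R :> R by []. nra.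
Qed.

(** Consecutive values have ratio [1 / (1 + al / (n + b))], and a product of factors [1 + x_i] with
    [x_i >= 0] is at least 1 plus the sum of the [x_i], here a harmonic sum. *)
Lemma falling0_vanishes (al b e : R) : 0 < al -> al + 4 <= b -> 0 < e ->
  exists N, forall n, (N <= n)%N -> falling al b 0 n <= e.
Proof.
move=> al0 b4 e0.
have b1 : 1 <= b by lra.
have [N NP] := harmonic_sum_unbounded ((e^-1 - 1) / al) b1.
exists N => n /NP; rewrite ler_pdivrMr// => eS.
have F0 := falling_gt0 (ltW al0) b4.
have : falling al b 0 n * (1 + al * \sum_(i < n) (i%:R + b)^-1) <= 1.
  elim: n {eS} => [|n IHn].
    by rewrite big_ord0 mulr0 addr0 falling00 mulr1.
  rewrite big_ord_recr/=; apply: le_trans IHn.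
  rewrite falling_next (falling_col (ltW al0) b4 0 n).
  set s := \sum_(i < n) _; have s0 : 0 <= s.
    by apply: sumr_ge0 => i _; rewrite invr_ge0 addr_ge0// ltW//; lra.
  have n0 : 0 <= n%:R :> R by [].
  have := F0 1%N n; move: (falling al b 1 n) => q q0.
  rewrite -!mulrA ler_pM2l//.
  have X0 : n%:R + b != 0 by rewrite gt_eqF//; lra.
  have -> : (n%:R + b) * (1 + al * (s + (n%:R + b)^-1)) =
      (n%:R + b) * (1 + al * s) + al by field.
  rewrite addr0; have := mulr_ge0 (mulr_ge0 (ltW al0) (ltW al0)) s0; nra.
set s := \sum_(i < n) _ in eS *; move=> Fs.
have es : e^-1 <= 1 + al * s by lra.
rewrite -[leRHS]invrK -[leRHS]div1r ler_pdivlMr ?invr_gt0//.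
by apply: le_trans Fs; rewrite ler_pM2l.
Qed.

End harmonic_growth.

(** * The branching process in a Markovian environment *)

Section branching_operator.
Context {R : realType} (S : choiceType).
Variables (K : S -> S -> R) (c : S -> nat -> R).

(* One step of the branching process in a Markovian environment: the state
   [(z, s)] stands for [z] crossings into a site next to which the stack [s] has
   been used. *)
Definition branching_step (G : nat -> S -> \bar R) (z : nat) (s : S) : \bar R :=
  avg (K s) (fun s' => avg (success_law (c s') z 0) (fun y => G y s')).

Variable M : nat.
Hypothesis K0 : forall s s', 0 <= K s s'.
Hypothesis K1 : forall s, (\esum_(s' in setT) (K s s')%:E = 1)%E.
Hypothesis c01 : forall s i, 0 <= c s i <= 1.
Hypothesis cM : forall s i, (M <= i)%N -> c s i = 2^-1.

Let q0 s d i y : 0 <= success_law (c s) d i y.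
Proof. exact: success_law_ge0. Qed.

Lemma branching_step_ge0 G z s : (forall z s, (0 <= G z s)%E) ->
  (0 <= branching_step G z s)%E.
Proof. by move=> G0; apply: avg_ge0 => // s'; apply: avg_ge0. Qed.

Lemma le_branching_step G G' z s : (forall z s, (G z s <= G' z s)%E) ->
  (branching_step G z s <= branching_step G' z s)%E.
Proof. by move=> GG'; apply: le_avg => // s'; apply: le_avg. Qed.

Lemma branching_stepD G G' z s :
  (forall z s, (0 <= G z s)%E) -> (forall z s, (0 <= G' z s)%E) ->
  branching_step (fun z s => (G z s + G' z s)%E) z s =
  (branching_step G z s + branching_step G' z s)%E.
Proof.
move=> G0 G'0; rewrite -avgD// => [|s'|s']; try exact: avg_ge0.
by apply: eq_avg => s'; rewrite avgD.
Qed.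

Lemma branching_stepZ (a : R) G z s : 0 <= a -> (forall z s, (0 <= G z s)%E) ->
  branching_step (fun z s => (a%:E * G z s)%E) z s =
  (a%:E * branching_step G z s)%E.
Proof.
move=> a0 G0; rewrite -avgZ// => [|s']; last exact: avg_ge0.
by apply: eq_avg => s'; rewrite avgZ.
Qed.

Lemma branching_step_cst (a : R) z s : 0 <= a ->
  branching_step (fun _ _ => a%:E) z s = a%:E.
Proof.
move=> a0; rewrite /branching_step -[RHS](avgc (K0 s) a0 (K1 s)).
apply: eq_avg => s'; rewrite -[a in LHS]mulr1.
under eq_avg do rewrite EFinM.
by rewrite avgZ// (avg_success_cst1 (c01 s') (cM s')) mule1.
Qed.

Lemma branching_step_sup (G : nat -> nat -> S -> \bar R) z s :
  (forall n z s, (0 <= G n z s)%E) ->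
  (forall z s, {homo (fun n => G n z s) : m n / (m <= n)%N >-> (m <= n)%E}) ->
  branching_step (fun z s => ereal_sup (range (fun n => G n z s))) z s =
  ereal_sup (range (fun n => branching_step (G n) z s)).
Proof.
move=> G0 Gnd; rewrite /branching_step -avg_sup//.
- by apply: eq_avg => s'; rewrite avg_sup.
- by move=> n s'; apply: avg_ge0.
- by move=> s' m n mn; apply: le_avg => // y; exact: Gnd.
Qed.

(** * Lyapunov functions corrected by a solution of the Poisson equation *)

Variables (h : S -> R) (H dlt : R).
Hypothesis H0 : 0 <= H.
Hypothesis h0 : forall s, 0 <= h s.
Hypothesis hH : forall s, h s <= H.

Let drift_of s := \sum_(i < M) (2 * c s i - 1).

(** The drift of a stack is bounded below by [- M], so [M] is added on both sides to average a
    nonnegative function. *)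
Hypothesis poisson : forall s,
  avg (K s) (fun s' => (drift_of s' + M%:R + h s')%:E) = (h s + dlt + M%:R)%:E.

Let dr0 s : 0 <= drift_of s + M%:R.
Proof.
rewrite /drift_of sumrB sumr_const card_ord subrK.
by apply: sumr_ge0 => i _; have /andP[] := c01 s i; lra.
Qed.

(* [A + drift * B + h * B] averages to its value for the mean drift [dlt]: this
   is what the corrector [h] is for. *)
Lemma branching_step_bound (F : nat -> S -> R) (z : nat) (s : S) (A B V : R)
    (W : S -> nat -> nat -> R) :
  (M <= z)%N -> (forall n s, 0 <= F n s) ->
  (forall s n m, (m <= n)%N -> 0 <= W s n m) ->
  (forall s n, F n s <= W s n 0%N) ->
  (forall s n m, (m <= n)%N -> W s n.+2 m.+1 + W s n m <= 2 * W s n.+1 m.+1) ->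
  (forall s k n, (k <= M)%N -> (n + k.*2 = z + M)%N ->
    W s n (z - k)%N <= A + h s * B + (n%:R - z%:R) * B) ->
  A + (h s + dlt) * B <= V ->
  (branching_step (fun z s => (F z s)%:E) z s <= V%:E)%E.
Proof.
move=> Mz F0 W0 FW WS WAB AV.
have bnd s' : (avg (success_law (c s') z 0) (fun y => (F y s')%:E) <=
    ((A - M%:R * B) + B * (drift_of s' + M%:R + h s'))%:E)%E.
  have := success_law_bound (c01 s') (@cM s') Mz (F0 ^~ s') (W0 s') (FW s')
    (WS s') (WAB s').
  by rewrite (_ : A + _ + _ * B =
    A - M%:R * B + B * (drift_of s' + M%:R + h s')) // /drift_of; ring.
apply: (@le_trans _ _ (avg (K s) (fun s' =>
    ((A - M%:R * B) + B * (drift_of s' + M%:R + h s'))%:E))).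
  exact: le_avg.
rewrite (avg_affine (K0 s) (K1 s) _ (poisson s)).
- rewrite lee_fin; apply: le_trans AV.
  by rewrite le_eqVlt; apply/orP; left; apply/eqP; ring.
- by move=> s'; rewrite addr_ge0.
- move=> s'; have := bnd s'; rewrite -lee_fin; apply: le_trans.
  by apply: avg_ge0 => // y; rewrite lee_fin.
Qed.

(** Truncation extends superharmonicity to small sizes: below [z0] the truncated function equals 1,
    which bounds every average of it. *)
Lemma branching_step_le_min (F : nat -> S -> R) (l : R) (z0 : nat) :
  0 < l -> (forall z s, 0 <= F z s) ->
  (forall z s, (z0 <= z)%N ->
    (branching_step (fun z s => (F z s)%:E) z s <= (F z s)%:E)%E) ->
  (forall z s, (z < z0)%N -> l <= F z s) ->
  forall z s, (branching_step (fun z s => (Num.min 1 (F z s / l))%:E) z s <=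
    (Num.min 1 (F z s / l))%:E)%E.
Proof.
move=> l0 F0 TF Fl z s.
have T1 : (branching_step (fun z s => (Num.min 1 (F z s / l))%:E) z s <= 1)%E.
  rewrite -(branching_step_cst z s ler01); apply: le_branching_step => z' s'.
  by rewrite lee_fin ge_min lexx.
have [z0z|zz0] := leqP z0 z; last first.
  by rewrite min_l// ler_pdivlMr// mul1r; exact: Fl.
rewrite EFin_min le_min T1/=.
apply: (@le_trans _ _ (l^-1%:E * branching_step (fun z s => (F z s)%:E) z s)%E).
  rewrite -branching_stepZ ?invr_ge0 ?(ltW l0)//.
  apply: le_branching_step => z' s'.
  by rewrite -EFinM lee_fin ge_min mulrC lexx orbT.
rewrite mulrC EFinM; apply: lee_wpmul2l; first by rewrite lee_fin invr_ge0 ltW.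
exact: TF.
Qed.

(** To first order [F] is [falling 0] at the shifted size [z + h s], and by the Poisson equation the
    mean increment of this shifted size is [dlt] whatever the stack. *)
Lemma lyapunov_transient : 1 < dlt ->
  exists G : nat -> S -> R,
  [/\ forall z s, 0 <= G z s, forall s, G 0%N s = 1,
      forall z s, (branching_step (fun z s => (G z s)%:E) z s <= (G z s)%:E)%E &
      forall e, 0 < e -> exists N, forall z s, (N <= z)%N -> G z s <= e].
Proof.
move=> dlt1.
(* The gain [al * dlt] from the drift must exceed [c2], which is [al] times the square of [1 + al]:
   one factor [1 + al] stems from the second difference of [falling 0], the other is the slack
   required by [falling_super]. *)
have [al [al0 al1 ald]] : exists al : R, [/\ 0 < al, al <= 1 &
    (1 + al) * (1 + al) < dlt].
  have [d4|d4] := leP (dlt - 1) 4.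
    exists ((dlt - 1) / 4); split; [lra|lra|nra].
  by exists 1; split; lra.
have aln : 0 <= al := ltW al0.
have [c2 c2E] : exists c2, c2 = al * (al + 1) * (1 + al) by eexists.
(* The term in [H] keeps [F] above half of [falling 0]; the last term provides the condition [bc] of
   [falling_super]. *)
pose b := al + 4 + 2 * al * H + (1 + al) * (al + 2) * (al + 3) / al.
have aH : 0 <= al * H by rewrite mulr_ge0.
have c20 : 0 <= c2 by rewrite c2E !mulr_ge0// addr_ge0.
have b4 : al + 4 <= b.
  have : 0 <= (1 + al) * (al + 2) * (al + 3) / al.
    by rewrite divr_ge0// !mulr_ge0// addr_ge0.
  rewrite /b; lra.
have bH : 2 * (al * H) <= b.
  have : 0 <= (1 + al) * (al + 2) * (al + 3) / al.
    by rewrite divr_ge0// !mulr_ge0// addr_ge0.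
  rewrite /b; lra.
have bc : al * (al + 1) * b + c2 * (al + 2) * (al + 3) <= c2 * b.
  have e : (1 + al) * (al + 2) * (al + 3) = al * ((1 + al) * (al + 2) * (al + 3) / al).
    by rewrite mulrCA mulfV ?mulr1// gt_eqF.
  have : (1 + al) * (al + 2) * (al + 3) <= al * b.
    rewrite e ler_pM2l// /b; lra.
  have : 0 <= al * (al + 1) by rewrite mulr_ge0// addr_ge0.
  rewrite c2E; nra.
clearbody b.
pose q j n := falling al b j n.
have qp j n : 0 < q j n by exact: falling_gt0.
have qn j n : 0 <= q j n by exact: ltW.
pose F z s := q 0%N z - al * h s * q 1%N z.
have q01 n : 2 * (al * H) * q 1%N n <= q 0%N n.
  rewrite /q (falling_col aln b4 0 n) mulrC ler_pM2l//.
  have : 0 <= n%:R :> R by []. lra.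
have hq n s : al * h s * q 1%N n <= al * H * q 1%N n.
  by rewrite ler_wpM2r// ler_wpM2l.
have F2 n s : q 0%N n / 2 <= F n s.
  have := q01 n; have := hq n s; rewrite /F; lra.
have Fq n s : F n s <= q 0%N n.
  by rewrite /F lerBlDr lerDl !mulr_ge0.
have Fn n s : 0 <= F n s.
  by apply: le_trans (F2 n s); rewrite divr_ge0.
have [L LE] : exists L : R, L = M%:R * 2 ^+ M by eexists.
have L0 : 0 <= L by rewrite LE mulr_ge0// exprn_ge0.
have LM : M%:R <= L.
  by rewrite LE ler_peMr// exprn_ege1// ler1n.
(* The errors of order 2: from linearizing [falling 0], from the corrector in [W], and from the term
   with [h]. The factor [L] is the constant of [falling_upper]. *)
pose C := M%:R * (al * (al + 1) * L) + c2 * (al + 2) * L + al * H * (al + 1) * L.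
pose W s n m := F n s + m%:R * c2 * q 2%N n.
have step z s : (M <= z)%N -> C / (al * dlt - c2) <= z%:R ->
    (branching_step (fun z s => (F z s)%:E) z s <= (F z s)%:E)%E.
  move=> Mz Cz.
  have ad : 0 < al * dlt - c2.
    have -> : al * dlt - c2 = al * (dlt - (1 + al) * (1 + al)) by rewrite c2E; ring.
    by rewrite mulr_gt0//; lra.
  have q1z := falling_mass aln b4 1 z; have q2z := falling_mass aln b4 2 z.
  apply: (@branching_step_bound F z s
    (q 0%N z + c2 * q 1%N z + C * q 2%N z) (- al * q 1%N z) _ W) => //.
  - by move=> s' n m mn; apply: addr_ge0 => //; rewrite !mulr_ge0.
  - by move=> s' n; rewrite /W !mul0r addr0.
  - move=> s' n m mn.
    have h1 := falling_super aln b4 mn c20.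
    move: (h1 0%N); rewrite !addr0 => /(_ bc); rewrite -!/(q _ _) => h2.
    (* Being convex, [falling 1] contributes in the favourable direction, because it enters [F] with
       the factor [- al * h s']. *)
    have d2 := falling_diff2 aln b4 1 n; rewrite -!/(q _ _) in d2.
    have : 0 <= al * h s' * ((al + 1%:R) * (al + 1%:R + 1) * q 3%N n).
      by rewrite !mulr_ge0 ?addr_ge0.
    rewrite -d2 /W /F; lra.
  - move=> s' k n kM nk.
    have nz : (n <= z + M)%N by move: kM nk; clear; lia.
    have zn : (z <= n + M)%N by move: kM nk; clear; lia.
    have lo := falling_lower aln b4 1; have up := falling_upper aln b4.
    have e0 : 0 <= al * ((al + 1) * L * q 2%N z).
      by rewrite !mulr_ge0 ?addr_ge0.
    have lin : q 0%N n <= q 0%N z + (n%:R - z%:R) * (- al * q 1%N z) +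
        M%:R * (al * ((al + 1) * L * q 2%N z)).
      apply: near_linear => // i i1 i2.
        rewrite /q (falling_diff aln b4 0) addr0 -!/(q _ _) addrAC subrr add0r.
        have := lo M i z (ltnW i2); rewrite -!/(q _ _) => lo'.
        have : (al + 1) * M%:R * q 2%N z <= (al + 1) * L * q 2%N z.
          by rewrite ler_wpM2r// ler_wpM2l// addr_ge0.
        move: lo' al0; nra.
      rewrite /q (falling_diff aln b4 0) addr0 -!/(q _ _) addrAC subrr add0r.
      have := up M 1%N i z isT i2; rewrite -!/(q _ _) -LE.
      move: al0; nra.
    have lo1 := lo M n z nz; have up2 := up M 2%N n z isT zn.
    rewrite -!/(q _ _) -?LE in lo1 up2 q1z q2z.
    have h1 : (z - k)%:R * c2 * q 2%N n <= c2 * q 1%N z + c2 * (al + 2) * L * q 2%N z.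
      apply: (@le_trans _ _ (z%:R * c2 * (q 2%N z + (al + 2) * L * q 3%N z))).
        apply: ler_pM => //; rewrite ?mulr_ge0//.
        by rewrite ler_wpM2r// ler_nat leq_subr.
      have k0 : 0 <= c2 * ((al + 2) * L) by rewrite !mulr_ge0 ?addr_ge0.
      have := ler_wpM2l c20 q1z; have := ler_wpM2l k0 q2z; lra.
    have h2 : - (al * h s' * q 1%N n) <= - (al * h s' * q 1%N z) +
        al * H * (al + 1) * L * q 2%N z.
      have k0 : 0 <= al * h s' by rewrite mulr_ge0.
      have := ler_wpM2l k0 lo1.
      have k1 : 0 <= (al + 1) * q 2%N z by rewrite mulr_ge0 ?addr_ge0.
      have k2 : al * h s' * M%:R <= al * H * L.
        by apply: ler_pM => //; rewrite ?mulr_ge0// ler_wpM2l.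
      have := ler_wpM2r k1 k2; lra.
    rewrite /W /F /C; move: lin h1 h2; lra.
  - have : C * q 2%N z <= (al * dlt - c2) * q 1%N z.
      have := falling_small aln b4 1 Cz; rewrite -!/(q _ _) => hs.
      have := ler_wpM2l (ltW ad) hs.
      by rewrite mulrA mulrC [_ * (C / _)]mulrC divfK ?gt_eqF// mulrC.
    rewrite /F; lra.
have [z0 [z0M z0C]] : exists z0 : nat, (M <= z0)%N /\
    C / (al * dlt - c2) <= z0.+1%:R.
  exists (maxn M (Num.bound `|C / (al * dlt - c2)|)); split; first exact: leq_maxl.
  apply: le_trans (ler_norm _) _; apply/ltW/(lt_le_trans (archi_boundP _)) => //.
  by rewrite ler_nat; exact/leqW/leq_maxr.
pose l := q 0%N z0.+1 / 2.
have l0 : 0 < l by rewrite divr_gt0.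
exists (fun z s => Num.min 1 (F z s / l)); split.
- by move=> z s; rewrite le_min ler01/= divr_ge0// ltW.
- move=> s; rewrite min_l// ler_pdivlMr// mul1r; apply: le_trans (F2 _ _).
  by rewrite ler_pM2r//; exact: falling_decr.
- apply: (branching_step_le_min (z0 := z0.+1)) => // z s zz0.
    apply: step; first by apply: leq_trans zz0; exact: leqW.
    by apply: le_trans z0C _; rewrite ler_nat.
  by apply: le_trans (F2 _ _); rewrite ler_pM2r//; exact/falling_decr/ltnW.
- move=> e e0; have [N NP] := falling0_vanishes al0 b4 (mulr_gt0 e0 l0).
  exists N => z s Nz; rewrite ge_min ler_pdivrMr//; apply/orP; right.
  exact: le_trans (Fq _ _) (NP _ Nz).
Qed.

(** At [dlt = 1] the logarithm is harmonic only to leading order. The extra term [- a * q 1] drifts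
    by about [- a * q 2], the order of the errors, so a large [a] makes [F] strictly superharmonic.
    The terms with [h] again shift the argument by [h s]. *)
Lemma lyapunov_recurrent : dlt <= 1 ->
  exists F : nat -> S -> R, exists k : nat -> R, exists z0 : nat,
  [/\ forall z s, 0 <= F z s, forall z, 0 < k z,
      forall z s, (z0 <= z)%N ->
        (branching_step (fun z s => (F z s)%:E) z s + (k z)%:E <= (F z s)%:E)%E &
      forall C, exists N, forall z s, (N <= z)%N -> C <= F z s].
Proof.
move=> dlt1.
have aln : 0 <= 0 :> R by [].
(* With [al = 0], [falling 0] is constant and [falling 1] is [1 / (n + b)]. The value 40 is the
   least [b] for which [falling_super] accepts the coefficient 12 at order 2; it also covers the
   coefficient 4 at order 1. *)
have b4 : 0 + 4 <= 40 :> R by lra.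
pose q j n := falling (0 : R) 40 j n.
have qp j n : 0 < q j n by exact: falling_gt0.
have qn j n : 0 <= q j n by exact: ltW.
have qd j n : q j n.+1 = q j n - (0 + j%:R) * q j.+1 n by exact: falling_diff.
have qc j n : q j n = q j.+1 n * (n%:R + 40 + 0 + j%:R) by exact: falling_col.
have qm j n : n%:R * q j.+1 n <= q j n by exact: falling_mass.
have qdec j n m : (n <= m)%N -> q j m <= q j n by exact: falling_decr.
have qle1 j n : q j n <= 1.
  apply: le_trans (qdec j 0%N n (leq0n n)) _.
  elim: j => [|j IHj]; first by rewrite /q falling00.
  apply: le_trans IHj; rewrite [leRHS]qc.
  by rewrite ler_peMr// ?add0r ?addr0; have : 0 <= j%:R :> R by []; lra.
have [L LE] : exists L : R, L = M%:R * 2 ^+ M by eexists.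
have [E EE] : exists E : R, E = 2 ^+ M by eexists.
have L0 : 0 <= L by rewrite LE mulr_ge0// exprn_ge0.
have E0 : 0 <= E by rewrite EE exprn_ge0.
have Mn : 0 <= M%:R :> R by [].
have HL : 0 <= H * L by rewrite mulr_ge0.
have HE : 0 <= H * E by rewrite mulr_ge0.
have [C1 C1E] : exists C1 : R, C1 = 3 * M%:R + H * L + 4 * (H * E) by eexists.
have [C2 C2E] : exists C2 : R, C2 = 8 * M%:R + 2 * (H * L) + 12 * (H * E).
  by eexists.
(* Here 43 is 41 + 1 + 1: 41 from rewriting [z * q 2 z] as [q 1 z - 41 * q 2 z], one for the strict
   decrease [q 2 z], one to absorb the terms of order 3. The constants [C1] and [C2] collect the
   errors of orders 2 and 3. *)
have [a aE] : exists a : R, a = 43 + C1 by eexists.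
have a0 : 0 <= a by lra.
pose f n := \sum_(i < n) q 1%N i.
have fS n : f n.+1 = f n + q 1%N n by rewrite /f big_ord_recr.
have f0 n : 0 <= f n by rewrite sumr_ge0.
(* The constant [1 + 3 * a] outweighs all negative terms of [F] and [W]: for [m <= n] they are at
   least [- a], [- 1] and [- 2 * a]. *)
pose F z s := 1 + 3 * a + f z - a * q 1%N z + h s * (q 1%N z + a * q 2%N z).
(* The concave parts [f] and [- a * q 1] yield a gain, recorded by negative correctors; the convex
   parts, those with [h s], call for positive ones. *)
pose W s n m := F n s - m%:R * q 2%N n - 2 * a * (m%:R * q 3%N n) +
  h s * (4 * (m%:R * q 3%N n) + a * (12 * (m%:R * q 4%N n))).
have hp n s : 0 <= h s * (q 1%N n + a * q 2%N n).
  by rewrite mulr_ge0 ?addr_ge0 ?mulr_ge0.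
have aq j n : a * q j n <= a by rewrite ler_piMr.
have Fn n s : 1 + 2 * a + f n <= F n s.
  by have := hp n s; have := aq 1%N n; rewrite /F; lra.
have Fpos n s : 0 <= F n s by have := Fn n s; have := f0 n; lra.
have qlow j := @falling_lower _ _ _ aln b4 M j.
have qup j := @falling_upper _ _ _ aln b4 M j.
have qnear j := @falling_near _ _ _ aln b4 M j.
have step z s : (M <= z)%N -> a * (84 + C2) <= z%:R ->
    (branching_step (fun z s => (F z s)%:E) z s + (q 2%N z)%:E <=
     (F z s)%:E)%E.
  move=> Mz Cz.
  rewrite -leeBrDr// -EFinB.
  apply: (@branching_step_bound F z s
    (1 + 3 * a + f z - a * q 1%N z - z%:R * q 2%N z - 2 * a * (z%:R * q 3%N z) +
     C1 * q 2%N z + a * C2 * q 3%N z) (q 1%N z + a * q 2%N z) _ W) => //.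
  - move=> s' n m mn; have := Fn n s'; have := f0 n.
    have mj j : m%:R * q j.+1 n <= 1.
      apply: le_trans (qle1 j n); apply: le_trans (qm j n).
      by rewrite ler_wpM2r// ler_nat.
    have : 0 <= h s' * (4 * (m%:R * q 3%N n) + a * (12 * (m%:R * q 4%N n))).
      by rewrite !(mulr_ge0, addr_ge0).
    have := ler_wpM2l a0 (mj 2%N); have := mj 1%N; rewrite /W; lra.
  - by move=> s' n; rewrite /W !mul0r !mulr0 !subr0 !addr0 mulr0 addr0.
  - move=> s' n m mn.
    have s1 : (f n.+2 - m.+1%:R * q 2%N n.+2) + (f n - m%:R * q 2%N n) <=
        2 * (f n.+1 - m.+1%:R * q 2%N n.+1).
      rewrite !fS !qd -(natr1 m).
      have : 0 <= (m%:R + 1) * q 4%N n by rewrite mulr_ge0 ?addr_ge0.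
      lra.
    have s2 : - (q 1%N n.+2 + 2 * (m.+1%:R * q 3%N n.+2)) -
        (q 1%N n + 2 * (m%:R * q 3%N n)) <=
        - (2 * (q 1%N n.+1 + 2 * (m.+1%:R * q 3%N n.+1))).
      rewrite !qd -(natr1 m).
      have : 0 <= (m%:R + 1) * q 5%N n by rewrite mulr_ge0 ?addr_ge0.
      lra.
    have s3 : (q 1%N n.+2 + m.+1%:R * 4 * q 3%N n.+2) +
        (q 1%N n + m%:R * 4 * q 3%N n) <=
        2 * (q 1%N n.+1 + m.+1%:R * 4 * q 3%N n.+1).
      by apply: falling_super => //; lra.
    have s4 : (q 2%N n.+2 + m.+1%:R * 12 * q 4%N n.+2) +
        (q 2%N n + m%:R * 12 * q 4%N n) <=
        2 * (q 2%N n.+1 + m.+1%:R * 12 * q 4%N n.+1).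
      by apply: falling_super => //; lra.
    have ha : 0 <= h s' * a by rewrite mulr_ge0.
    have := ler_wpM2l a0 s2; have := ler_wpM2l (h0 s') s3.
    have := ler_wpM2l ha s4; move: s1; rewrite /W /F; lra.
  - move=> s' k n kM nk.
    have nz : (n <= z + M)%N by move: kM nk; clear; lia.
    have zn : (z <= n + M)%N by move: kM nk; clear; lia.
    have lin : f n - a * q 1%N n <= f z - a * q 1%N z +
        (n%:R - z%:R) * (q 1%N z + a * q 2%N z) + M%:R * 0.
      apply: (@near_linear _ (fun n => f n - a * q 1%N n)) => // i i1 i2.
        have := qdec 1%N _ _ i1; have := ler_wpM2l a0 (qdec 2%N _ _ i1).
        rewrite fS qd; lra.
      have := qdec 1%N _ _ (ltnW i1); have := ler_wpM2l a0 (qdec 2%N _ _ (ltnW i1)).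
      rewrite fS qd; lra.
    have mlow : z%:R - M%:R <= (z - k)%:R :> R.
      by rewrite -natrB// ler_nat leq_sub2l.
    have zM0 : 0 <= z%:R - M%:R :> R by rewrite subr_ge0 ler_nat.
    have mup : (z - k)%:R <= z%:R :> R by rewrite ler_nat leq_subr.
    set m : R := (z - k)%:R in mlow mup *.
    have m0 : 0 <= m by rewrite /m.
    have lower j : m * q j n >= z%:R * q j z - (j%:R + 1) * M%:R * q j z.
      have h1 := ler_wpM2r (qn j n) mlow.
      have h2 := ler_wpM2l zM0 (qlow j n z nz).
      rewrite -!/(q _ _) in h2.
      have h3 : 0 <= (0 + j%:R) * M%:R :> R by rewrite add0r mulr_ge0.
      have h4 := ler_wpM2l h3 (qm j z).
      have h5 : 0 <= M%:R * ((0 + j%:R) * M%:R * q j.+1 z).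
        by rewrite !mulr_ge0// add0r.
      lra.
    have upper j : (j < 4)%N -> m * q j.+1 n <= E * q j z.
      move=> j4; apply: (@le_trans _ _ (z%:R * (E * q j.+1 z))).
        by rewrite EE; apply: ler_pM => //; exact: qnear.
      by have := ler_wpM2l E0 (qm j z); lra.
    have b1 := lower 2%N; have b2 := ler_wpM2l a0 (lower 3%N).
    have b3 := qup 1%N n z isT zn; have b5 := qup 2%N n z isT zn.
    rewrite -LE -!/(q _ _) in b3 b5.
    have b4' := upper 2%N isT; have b6 := upper 3%N isT.
    have b7 : h s' * (q 1%N n + a * q 2%N n) +
        h s' * (4 * (m * q 3%N n) + a * (12 * (m * q 4%N n))) <=
        h s' * (q 1%N z + a * q 2%N z) +
        H * ((L + 4 * E) * q 2%N z + a * (2 * L + 12 * E) * q 3%N z).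
      apply: (@le_trans _ _ (h s' * (q 1%N z + a * q 2%N z) +
          h s' * ((L + 4 * E) * q 2%N z + a * (2 * L + 12 * E) * q 3%N z))).
        rewrite -!mulrDr ler_wpM2l//.
        have := ler_wpM2l a0 b5; have := ler_wpM2l a0 b6; lra.
      rewrite lerD2l ler_wpM2r// addr_ge0// mulr_ge0// ?addr_ge0 ?mulr_ge0//.
      by rewrite addr_ge0 ?mulr_ge0.
    rewrite /W -/m /F C1E C2E; move: lin b1 b2 b7; lra.
  - have e1 := qc 1%N z; have e2 := qc 2%N z.
    have d1 : (dlt - 1) * (q 1%N z + a * q 2%N z) <= 0.
      by rewrite mulr_le0_ge0 ?addr_ge0 ?mulr_ge0// subr_le0.
    have := falling_small aln b4 2 Cz; rewrite -!/(q _ _) => d2.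
    have -> : z%:R * q 2%N z = q 1%N z - 41 * q 2%N z by rewrite e1; ring.
    have -> : z%:R * q 3%N z = q 2%N z - 42 * q 3%N z by rewrite e2; ring.
    rewrite /F; have := qn 2%N z; move: d1 d2; rewrite [in X in _ -> X]aE; nra.
exists F, (q 2%N), (maxn M (Num.bound `|a * (84 + C2)|)); split => //.
- move=> z s; rewrite geq_max => /andP[Mz Cz]; apply: step => //.
  apply: le_trans (ler_norm _) _; apply/ltW/(lt_le_trans (archi_boundP _)) => //.
  by rewrite ler_nat.
- move=> C; have [N NP] := @harmonic_sum_unbounded R 40 C ltac:(lra).
  exists N => z s Nz; apply: le_trans (NP z Nz) _; apply: le_trans (_ : f z <= _).
    apply: ler_sum => i _; have := qc 0%N i.
    have -> : q 0%N i = 1.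
      elim: (i : nat) => [|n IHn]; first by rewrite /q falling00.
      by rewrite qd IHn; ring.
    rewrite !addr0 => e; have i0 : 0 < i%:R + 40 :> R.
      by have : 0 <= i%:R :> R by []; lra.
    by rewrite -(ler_pM2r i0) mulVf ?gt_eqF// -e.
  by have := Fn z s; lra.
Qed.

End branching_operator.

(** * Extinction *)

Lemma finite_set_pos_lower {R : realType} (T : choiceType) (A : set T)
    (f : T -> R) : finite_set A -> (forall x, A x -> 0 < f x) ->
  exists2 e : R, 0 < e & forall x, A x -> e <= f x.
Proof.
move=> /finite_seqP[r ->] {A}; elim: r => [|a r IHr] f0.
  by exists 1.
have [x xr|e e0 er] := IHr; first by apply: f0; rewrite /= inE xr orbT.
exists (Num.min e (f a)).
  by rewrite lt_min e0 f0//= inE eqxx.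
move=> x /=; rewrite inE => /predU1P[->|xr]; first by rewrite ge_min lexx orbT.
by rewrite ge_min er.
Qed.

Section recurrent_extinction.
Context {R : realType} (S : choiceType).
Variables (K : S -> S -> R) (c : S -> nat -> R) (M : nat).
Hypothesis K0 : forall s s', 0 <= K s s'.
Hypothesis K1 : forall s, (\esum_(s' in setT) (K s s')%:E = 1)%E.
Hypothesis c01 : forall s i, 0 <= c s i <= 1.
Hypothesis cM : forall s i, (M <= i)%N -> c s i = 2^-1.
Hypothesis c_lt1 : forall s i, c s i < 1.

Local Open Scope ereal_scope.
Local Notation T := (branching_step K c).

Let qge0 s d i y : (0 <= success_law (c s) d i y)%R.
Proof. exact: success_law_ge0. Qed.

Let T_ge0 G z s : (forall z s, 0 <= G z s) -> 0 <= T G z s.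
Proof. exact: branching_step_ge0. Qed.

Let le_T G G' z s : (forall z s, G z s <= G' z s) -> T G z s <= T G' z s.
Proof. exact: le_branching_step. Qed.

Definition extinct : nat -> S -> \bar R := fun z _ => (z == 0%N)%:R%:E.

Definition extinct_by N := iter N T extinct.

Lemma extinct_by_ge0 N z s : 0 <= extinct_by N z s.
Proof.
elim: N z s => [|N IHN] z s; first by rewrite lee_fin ler0n.
by rewrite /extinct_by iterS; exact: T_ge0.
Qed.

Lemma extinct_by_le1 N z s : extinct_by N z s <= 1.
Proof.
elim: N z s => [|N IHN] z s; first by rewrite lee_fin; case: eqP.
rewrite /extinct_by iterS -(branching_step_cst K0 K1 c01 cM z s ler01).
exact: le_T.
Qed.

(** Size 0 is absorbing, since no success precedes the zeroth failure. *)
Lemma extinct_by0 N s : extinct_by N 0 s = 1.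
Proof.
elim: N s => [|N IHN] s; first by rewrite /extinct_by/= /extinct.
rewrite /extinct_by iterS /branching_step -[RHS](avgc (K0 s) ler01 (K1 s)).
apply: eq_avg => s'; rewrite avg_success0//; first exact: IHN.
by move=> y; exact: extinct_by_ge0.
Qed.

Lemma extinct_by_homo z s :
  {homo (fun N => extinct_by N z s) : m n / (m <= n)%N >-> m <= n}.
Proof.
apply: homo_leq => [//|? ? ?|N]; first exact: le_trans.
elim: N z s => [|N IHN] z s.
  have [->|z0] := eqVneq z 0%N; first by rewrite !extinct_by0.
  rewrite (_ : extinct_by 0 z s = 0) ?extinct_by_ge0//.
  by rewrite /extinct_by/= /extinct (negPf z0).
by rewrite /extinct_by [in leLHS]iterS [in leRHS]iterS; exact: le_T.
Qed.

Definition extinction z s := ereal_sup (range (fun N => extinct_by N z s)).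

Lemma extinct_by_le N z s : extinct_by N z s <= extinction z s.
Proof. by apply: ereal_sup_ubound; exists N. Qed.

Lemma extinction_harmonic z s : T extinction z s = extinction z s.
Proof.
rewrite /extinction branching_step_sup//; last 2 first.
- exact: extinct_by_ge0.
- exact: extinct_by_homo.
apply/eqP; rewrite eq_le; apply/andP; split; apply: ge_ereal_sup => _ [N _ <-].
  by apply: ereal_sup_ubound; exists N.+1; rewrite // /extinct_by iterS.
apply: le_trans (extinct_by_homo z s (leqnSn N)) _.
by apply: ereal_sup_ubound; exists N; rewrite // /extinct_by iterS.
Qed.

Lemma extinction_ge0 z s : 0 <= extinction z s.
Proof. exact: le_trans (extinct_by_ge0 0 z s) (extinct_by_le 0 z s). Qed.

Lemma extinction_le1 z s : extinction z s <= 1.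
Proof. by apply: ge_ereal_sup => _ [N _ <-]; exact: extinct_by_le1. Qed.

Lemma iter_branching_extinct (b : R) n z s : (0 <= b <= 1)%R ->
  iter n T (fun z s => b%:E + (1 - b)%:E * extinct z s) z s =
  b%:E + (1 - b)%:E * extinct_by n z s.
Proof.
move=> /andP[b0 b1]; have b10 : (0 <= 1 - b)%R by rewrite subr_ge0.
elim: n z s => [//|n IHn] z s; rewrite iterS.
transitivity (T (fun z s => b%:E + (1 - b)%:E * extinct_by n z s) z s).
  by apply: eq_avg => s'; apply: eq_avg => y; exact: IHn.
rewrite (branching_stepD K0 c01)//; last first.
  by move=> z' s'; rewrite mule_ge0 ?lee_fin ?extinct_by_ge0.
rewrite (branching_step_cst K0 K1 c01 cM)// (branching_stepZ K0 c01)//.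
by move=> z' s'; exact: extinct_by_ge0.
Qed.

(** Markov property at generation [n]: an extinct population contributes 1, any other at least [b],
    and [extinction] is harmonic. *)
Lemma extinction_iter (b : R) n z s : (0 <= b <= 1)%R ->
  (forall z s, b%:E <= extinction z s) ->
  b%:E + (1 - b)%:E * extinct_by n z s <= extinction z s.
Proof.
move=> b01 bv; rewrite -iter_branching_extinct//.
elim: n z s => [|n IHn] z s /=; last first.
  by rewrite -extinction_harmonic; exact: le_T.
have [->|z0] := eqVneq z 0%N.
  apply: le_trans (extinct_by_le 0 0 s); rewrite extinct_by0 /extinct eqxx mule1.
  by rewrite -EFinD lee_fin addrC subrK.
by rewrite /extinct (negPf z0) mule0 adde0.
Qed.

Variables (B : set S) (n0 : nat).
Hypothesis Bfin : finite_set B.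
Hypothesis Bmix : forall s, (2^-1)%:E <=
  iter n0.+1 (fun f s => avg (K s) f) (fun s => (s \in B)%:R%:E) s.

(** In the last of [n0.+1] generations the stack is in the finite set [B] with probability at least
    1/2. The size before it has mean at most [z0 + n0 * M], hence exceeds [z1] with probability at
    most 1/4. Otherwise the required trials, at most [z1], all fail with probability at least [e];
    this leaves [e / 4]. *)
Lemma extinct_by_lower (z0 : nat) : exists2 e : R, (0 < e <= 1)%R &
  forall z s, (z <= z0)%N -> e%:E <= extinct_by n0.+1 z s.
Proof.
pose z1 := (4 * (z0 + n0 * M)).+1.
have z1_gt0 : (0 < z1%:R :> R)%R by rewrite ltr0n.
have [e e0 eB] : exists2 e : R, (0 < e)%R &
    forall s, B s -> (e <= \prod_(i < z1) (1 - c s i))%R.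
  apply: finite_set_pos_lower => // s _.
  by apply: prodr_gt0 => i _; rewrite subr_gt0.
have en : (0 <= e)%R := ltW e0.
pose kop (f : S -> \bar R) s := avg (K s) f.
pose chi s : \bar R := (s \in B)%:R%:E.
have law0 s d i : success_law (c s) d i 0 = (\prod_(j < d) (1 - c s (i + j)%N))%R.
  elim: d i => [|d IHd] i; first by rewrite big_ord0.
  rewrite success_lawS0 IHd big_ord_recl addn0; congr (_ * _)%R.
  by apply: eq_bigr => j _; rewrite /= addSnnS.
have ez1 : (0 <= e / z1%:R)%R by rewrite divr_ge0// ltW.
have extinct0 z s : 0 <= extinct z s by rewrite lee_fin.
have chi0 s : 0 <= chi s by rewrite lee_fin.
(* Markov's inequality in linear form: once the size exceeds [z1], the added term alone is at least
   [e]. *)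
have chi_le s' z : e%:E * chi s' <=
    avg (success_law (c s') z 0) (fun y => extinct y s') +
    (e / z1%:R * z%:R)%:E.
  have a0 : 0 <= avg (success_law (c s') z 0) (fun y => extinct y s').
    exact: avg_ge0.
  rewrite /chi; case: (boolP (s' \in B)) => [|_]; last first.
    by rewrite mule0 adde_ge0// lee_fin mulr_ge0.
  rewrite inE => Bs; rewrite mule1; have [zz1|z1z] := leqP z z1; last first.
    apply: lee_paddl => //; rewrite lee_fin -mulrA ler_peMr// ?(ltW e0)//.
    by rewrite mulrC ler_pdivlMr// mul1r ler_nat ltnW.
  apply: lee_paddr; first by rewrite lee_fin mulr_ge0.
  have := @term_le_avg R _ _ (qge0 s' z 0%N) (fun y => extinct y s') 0%N
    (fun y => extinct0 y s').
  apply: le_trans; rewrite /extinct eqxx mule1 lee_fin law0.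
  apply: le_trans (eB _ Bs) _.
  rewrite -(subnKC zz1) big_split_ord/= -[leRHS]mulr1 ler_pM//.
  - by apply: prodr_ge0 => i _; rewrite subr_ge0; have /andP[] := c01 s' i.
  - by apply: prodr_ge0 => i _; rewrite subr_ge0; have /andP[] := c01 s' (z + i).
  - by apply: prodr_ile1 => i _; have /andP[] := c01 s' (z + i)%N; lra.
have kop0 n s : 0 <= iter n kop chi s.
  by elim: n s => [|n IHn] s /=; [rewrite lee_fin|exact: avg_ge0].
have kop1 n s : iter n kop chi s <= 1.
  elim: n s => [|n IHn] s /=; first by rewrite lee_fin lern1 leq_b1.
  exact: avg_le_cst.
have cst_avg (r : R) s' z : (0 <= r)%R ->
    avg (success_law (c s') z 0) (fun=> r%:E) = r%:E.
  move=> r0; rewrite -[r in LHS]mulr1; under eq_avg do rewrite EFinM.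
  by rewrite avgZ// (avg_success_cst1 (c01 s') (@cM s')) mule1.
have claim n : forall z s, e%:E * iter n.+1 kop chi s <=
    extinct_by n.+1 z s + (e / z1%:R * (z + n * M)%:R)%:E.
  elim: n => [|n IHn] z s.
    rewrite /= -avgZ//.
    rewrite mul0n addn0 -[X in _ + X](avgc (K0 s) _ (K1 s)); last by rewrite mulr_ge0.
    rewrite -avgD//; first exact: le_avg.
      by move=> s'; exact: avg_ge0.
    by move=> _; rewrite lee_fin mulr_ge0.
  have -> : e%:E * iter n.+2 kop chi s =
      T (fun _ s => e%:E * iter n.+1 kop chi s) z s.
    rewrite iterS {1}/kop -avgZ//.
    apply: eq_avg => s'.
    have /fineK <- : iter n.+1 kop chi s' \is a fin_num.
      by rewrite ge0_fin_numE// (le_lt_trans (kop1 n.+1 s'))// ltry.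
    by rewrite -EFinM cst_avg// mulr_ge0// fine_ge0.
  apply: le_trans (le_T _ _ IHn) _.
  rewrite (branching_stepD K0 c01) => [|z' s'|z' s']; last 2 first.
  - exact: extinct_by_ge0.
  - by rewrite lee_fin mulr_ge0.
  rewrite [in leRHS]/extinct_by [in leRHS]iterS leeD2l//.
  apply: avg_le_cst => //; first by rewrite mulr_ge0.
  move=> s'; under eq_avg do rewrite natrD EFinM EFinD.
  rewrite avgZ//; last by move=> y; rewrite -EFinD lee_fin addr_ge0.
  rewrite avgD//.
  rewrite cst_avg// [leRHS]EFinM; apply: lee_wpmul2l; first by rewrite lee_fin.
  rewrite mulSn addnA natrD EFinD leeD2r//.
  exact: (avg_success_id (c01 s') (@cM s') z).
have [z1E z1p] : (z1%:R = 4 * (z0 + n0 * M)%:R + 1 :> R)%R /\ (0 < e / z1%:R)%R.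
  by split; [rewrite /z1 -(natr1 (4 * (z0 + n0 * M))) natrM|rewrite divr_gt0].
exists (Num.min 1 (e / 4))%R.
  by rewrite lt_min ltr01 divr_gt0//= ge_min lexx.
move=> z s zz0.
have := claim n0 z s; have := Bmix s; rewrite -/kop -/chi => h1 h2.
have : e%:E * (2^-1)%:E <= extinct_by n0.+1 z s + (e / 4)%:E.
  apply: le_trans (lee_wpmul2l _ h1) _; first by rewrite lee_fin ltW.
  apply: le_trans h2 _; rewrite leeD2l// lee_fin.
  have : ((z + n0 * M)%:R <= (z0 + n0 * M)%:R :> R)%R by rewrite ler_nat leq_add2r.
  move=> hz; rewrite mulrAC ler_pdivrMr// z1E; nra.
rewrite -leeBlDr// -EFinM -EFinB; apply: le_trans.
by rewrite lee_fin ge_min; apply/orP; right; lra.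
Qed.

Variables (F : nat -> S -> R) (k : nat -> R) (z0 : nat).
Hypothesis F0 : forall z s, (0 <= F z s)%R.
Hypothesis k0 : forall z, (0 < k z)%R.
Hypothesis TF : forall z s, (z0 <= z)%N ->
  T (fun z s => (F z s)%:E) z s + (k z)%:E <= (F z s)%:E.
Hypothesis Finf : forall C : R, exists N, forall z s, (N <= z)%N -> (C <= F z s)%R.

(** A bound [b] valid everywhere improves to [b + (1 - b) * e], and iteration leads to 1. The
    improvement is direct for [z <= z0]; beyond, it is a minimum principle for [extinction + d * F],
    with [d] arbitrarily small. *)
Lemma extinction1 z s : extinction z s = 1.
Proof.
have [e /andP[e0 e1] eP] := extinct_by_lower z0.
have improve (b : R) : (0 <= b <= 1)%R ->
    (forall z s, b%:E <= extinction z s) ->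
    forall z s, (b + (1 - b) * e)%:E <= extinction z s.
  move=> /[dup] b01 /andP[b0 b1] bv.
  have b10 : (0 <= 1 - b)%R by rewrite subr_ge0.
  set g := (b + (1 - b) * e)%R.
  have g0 : (0 <= g)%R by rewrite addr_ge0// mulr_ge0// ltW.
  have g1 : (g <= 1)%R by rewrite /g; nra.
  have small z' s' : (z' <= z0)%N -> g%:E <= extinction z' s'.
    move=> zz0; apply: le_trans (extinction_iter n0.+1 z' s' b01 bv).
    rewrite /g EFinD EFinM leeD2l//; apply: lee_wpmul2l; first by rewrite lee_fin.
    exact: eP.
  have [v vE] : exists v : nat -> S -> R, forall z s, extinction z s = (v z s)%:E.
    exists (fun z s => fine (extinction z s)) => z' s'; rewrite fineK//.
    rewrite ge0_fin_numE ?extinction_ge0//.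
    by rewrite (le_lt_trans (extinction_le1 _ _))// ltry.
  have v0 z' s' : (0 <= v z' s')%R by rewrite -lee_fin -vE extinction_ge0.
  suff claim (d : R) : (0 < d)%R -> forall z s, (g <= v z s + d * F z s)%R.
    move=> z' s'; rewrite vE lee_fin; apply/ler_addgt0Pr => x x0.
    have F1 : (0 < F z' s' + 1)%R by have := F0 z' s'; lra.
    apply: le_trans (claim (x / (F z' s' + 1))%R _ z' s') _; first exact: divr_gt0.
    rewrite lerD2l mulrAC ler_pdivrMr// ler_pM2l//; lra.
  move=> d0.
  have [N NP] := Finf d^-1%R.
  have [kk kk0 kP] := @finite_set_pos_lower R nat `I_N k (finite_II N) (fun z _ => k0 z).
  pose th n := Num.max 0%R (1 - n%:R * (d * kk))%R.
  have dk : (0 < d * kk)%R by rewrite mulr_gt0.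
  have th0 n : (0 <= th n)%R by rewrite le_max lexx.
  have main n : forall z s, (g <= v z s + d * F z s + th n)%R.
    elim: n => [|n IHn] z' s'.
      have := v0 z' s'; have := mulr_ge0 (ltW d0) (F0 z' s').
      have : (1 <= th 0%N)%R by rewrite /th mul0r subr0 le_max lexx orbT.
      lra.
    have dF : (0 <= d * F z' s')%R := mulr_ge0 (ltW d0) (F0 z' s').
    have [zz0|z0z] := leqP z' z0.
      have := small z' s' zz0; rewrite vE lee_fin; have := th0 n.+1; lra.
    have [Nz|zN] := leqP N z'.
      have := NP z' s' Nz; rewrite -(ler_pM2l d0) mulfV ?gt_eqF// => dF1.
      have := v0 z' s'; have := th0 n.+1; lra.
    suff hS : (g + d * kk <= v z' s' + d * F z' s' + th n)%R.
      have m1 : (1 - n.+1%:R * (d * kk) = 1 - n%:R * (d * kk) - d * kk)%R.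
        by rewrite -(natr1 n); ring.
      have : (1 - n.+1%:R * (d * kk) <= th n.+1)%R by rewrite /th le_max lexx orbT.
      have := IHn z' s'; have := th0 n.+1; rewrite m1.
      have [t0|t0] := leP (1 - n%:R * (d * kk))%R 0%R.
        have -> : th n = 0%R by rewrite /th max_l.
        lra.
      have thn : th n = (1 - n%:R * (d * kk))%R by rewrite /th max_r// ltW.
      move: hS; rewrite thn; lra.
    have := TF s' (ltnW z0z).
    set TFz := T (fun z s => (F z s)%:E) z' s' => TFk.
    have TFz0 : 0 <= TFz by apply: T_ge0 => z1 s1; rewrite lee_fin.
    have [t tE] : exists t : R, TFz = t%:E.
      exists (fine TFz); rewrite fineK// ge0_fin_numE//.
      apply: le_lt_trans (_ : _ <= (F z' s')%:E) (ltry _).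
      by apply: le_trans TFk; rewrite leeDl// lee_fin ltW.
    have kz := kP z' zN.
    move: TFk; rewrite tE -EFinD lee_fin => tk.
    have : g%:E <= T (fun z s => extinction z s + (d%:E * (F z s)%:E + (th n)%:E)) z' s'.
      rewrite -(branching_step_cst K0 K1 c01 cM z' s' g0); apply: le_T => z1 s1.
      by rewrite vE -EFinM -!EFinD lee_fin addrA.
    have dF1 z1 s1 : 0 <= d%:E * (F z1 s1)%:E by rewrite lee_fin mulr_ge0// ltW.
    rewrite (branching_stepD K0 c01) => [|z1 s1|z1 s1]; last 2 first.
    - exact: extinction_ge0.
    - by rewrite -EFinM -EFinD lee_fin addr_ge0// mulr_ge0// ltW.
    rewrite (branching_stepD K0 c01)//; last by move=> *; rewrite lee_fin.
    rewrite (@branching_stepZ _ _ _ _ K0 c01 d (fun z s => (F z s)%:E)) ?(ltW d0)//.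
    rewrite (branching_step_cst K0 K1 c01 cM)// extinction_harmonic vE.
    rewrite -/TFz tE -EFinM -!EFinD lee_fin => h.
    have : (d * t + d * kk <= d * F z' s')%R by move: tk kz d0; nra.
    lra.
  have [n nP] : exists n : nat, th n = 0%R.
    exists (Num.bound `|(d * kk)^-1|%R); rewrite /th max_l// subr_le0.
    rewrite -ler_pdivrMr// div1r; apply: le_trans (ler_norm _) _.
    by rewrite ltW// archi_boundP.
  by move=> z' s'; have := main n z' s'; rewrite nP addr0.
have iterb n : forall z s, (1 - (1 - e) ^+ n)%:E <= extinction z s.
  elim: n => [|n IHn] z' s'; first by rewrite expr0 subrr extinction_ge0.
  have b01 : (0 <= 1 - (1 - e) ^+ n <= 1)%R.
    rewrite subr_ge0 lerBlDr lerDl exprn_ge0 ?exprn_ile1 ?subr_ge0//.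
    by rewrite lerBlDr lerDl ltW.
  apply: le_trans (improve _ b01 IHn z' s'); rewrite lee_fin exprS.
  by rewrite le_eqVlt; apply/orP; left; apply/eqP; ring.
apply/eqP; rewrite eq_le extinction_le1/=.
have : (1 - (1 - e) ^+ n)%:E @[n --> \oo] --> (1 - 0)%:E.
  apply: cvg_EFin; first by apply: nearW.
  apply: cvgB; first exact: cvg_cst.
  by apply: cvg_expr; rewrite ger0_norm ?subr_ge0//; lra.
move=> h; rewrite subr0 in h; rewrite -(cvg_lim _ h)//.
apply: lime_le; first by apply/cvg_ex; eexists; exact: h.
by apply: nearW => n; exact: iterb.
Qed.

End recurrent_extinction.

(** * Uniform ergodicity and the Poisson equation *)

Section averages_of_bounded_functions.
Context {R : realType} (S : choiceType).
Local Open Scope ereal_scope.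

Lemma avg_fin (p : S -> R) (f : S -> R) (b : R) :
  (forall x, (0 <= p x)%R) -> \esum_(x in setT) (p x)%:E = 1 ->
  (forall x, (0 <= f x <= b)%R) ->
  exists2 r : R, avg p (EFin \o f) = r%:E & (0 <= r <= b)%R.
Proof.
move=> p0 p1 fb.
have f0 x : 0 <= (EFin \o f) x by rewrite lee_fin; have /andP[] := fb x.
have a0 := avg_ge0 p0 f0.
have [x0|nx] := pselect (exists x0 : S, True); last first.
  exfalso; suff : \esum_(x in setT) (p x)%:E = 0 by rewrite p1 => /eqP; rewrite onee_eq0.
  by rewrite esum1// => x; case: nx; exists x.
have b0 : (0 <= b)%R by case: x0 => x _; have /andP[] := fb x; exact: le_trans.
have ab : avg p (EFin \o f) <= b%:E.
  by apply: avg_le_cst => // x; rewrite lee_fin; have /andP[] := fb x.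
exists (fine (avg p (EFin \o f))).
  by rewrite fineK// ge0_fin_numE// (le_lt_trans ab)// ltry.
by rewrite fine_ge0//= -lee_fin fineK// ge0_fin_numE// (le_lt_trans ab)// ltry.
Qed.

(** Replacing [f] by [b] on the set [A] where [p] exceeds [q], and by 0 elsewhere, can only increase
    the difference of the averages, which becomes [b] times the difference of the masses of [A]. *)
Lemma tv_avg_le (p q : S -> R) (f : S -> R) (b t : R) :
  is_distribution p -> is_distribution q -> (forall x, (0 <= f x <= b)%R) ->
  tv_dist p q <= t%:E ->
  avg p (EFin \o f) <= avg q (EFin \o f) + (t * b)%:E.
Proof.
move=> [p0 p1] [q0 q1] fb tv.
have [x0|nx] := pselect (exists x0 : S, True); last first.
  exfalso; suff : \esum_(x in setT) (p x)%:E = 0 by rewrite p1 => /eqP; rewrite onee_eq0.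
  by rewrite esum1// => x; case: nx; exists x.
have b0 : (0 <= b)%R by case: x0 => x _; have /andP[] := fb x; exact: le_trans.
pose A := [set x | (q x < p x)%R].
pose chi x : R := ((x \in A)%:R)%R.
have sumA (r : S -> R) : (forall x, (0 <= r x)%R) -> \esum_(x in setT) (r x)%:E = 1 ->
    exists2 a : R, \esum_(x in A) (r x)%:E = a%:E &
      avg r (fun x => (chi x * b)%:E) = (a * b)%:E.
  move=> r0 r1.
  have chi01 x : (0 <= chi x <= 1)%R.
    by rewrite /chi; case: (x \in A); rewrite ?lexx ?ler01.
  have [a aE _] := avg_fin r0 r1 chi01.
  exists a.
    rewrite -aE esum_mkcond; apply: eq_esum => x _.
    by rewrite /= /chi; case: (x \in A); rewrite ?mule1 ?mule0.
  rewrite mulrC EFinM -aE -avgZ//; last by move=> x; rewrite lee_fin.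
  by apply: eq_avg => x; rewrite mulrC EFinM.
have [ap apE apb] := sumA p p0 p1; have [aq aqE aqb] := sumA q q0 q1.
have apq : (ap <= aq + t)%R.
  have : `| ap%:E - aq%:E | <= t%:E.
    by apply: le_trans tv; apply: ereal_sup_ubound; exists A => //; rewrite apE aqE.
  by rewrite -EFinB abse_EFin lee_fin => /(le_trans (ler_norm _)); lra.
have [rp rpE _] := avg_fin p0 p1 fb; have [rq rqE _] := avg_fin q0 q1 fb.
have f0 x : (0 <= f x)%R by have /andP[] := fb x.
have : avg p (EFin \o f) + avg q (fun x => (chi x * b)%:E) <=
    avg q (EFin \o f) + avg p (fun x => (chi x * b)%:E).
  have chib x : 0 <= (chi x * b)%:E by rewrite lee_fin mulr_ge0.
  rewrite /avg -!esumD; try by move=> x _; rewrite -EFinM lee_fin !mulr_ge0.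
  apply: le_esum => x _; rewrite -!EFinM -!EFinD lee_fin.
  have /andP[_ fxb] := fb x; rewrite /chi.
  case: (boolP (x \in A)) => [|/negP]; rewrite inE /A/= => qp.
    by rewrite mul1r; nra.
  have {}qp : (p x <= q x)%R by rewrite leNgt; apply/negP.
  by rewrite mul0r !mulr0 !addr0 ler_wpM2r.
rewrite rpE rqE apb aqb -!EFinD !lee_fin.
have := ler_wpM2r b0 apq; lra.
Qed.

End averages_of_bounded_functions.

Section matrix_powers.
Context {R : realType} (S : choiceType).
Variable K : S -> S -> R.
Hypothesis Kdist : transition_matrix K.
Local Open Scope ereal_scope.

Let K0 s s' : (0 <= K s s')%R. Proof. by have [] := Kdist s. Qed.
Let K1 s : \esum_(s' in setT) (K s s')%:E = 1. Proof. by have [] := Kdist s. Qed.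

Lemma avg_delta x (f : S -> \bar R) : (forall y, 0 <= f y) ->
  avg (fun y => ((x == y)%:R)%R) f = f x.
Proof.
move=> f0; rewrite /avg (esumID [set x])//; last first.
  by move=> y _; rewrite mule_ge0// lee_fin ler0n.
rewrite setTI esum_set1; last by rewrite mule_ge0// lee_fin ler0n.
rewrite eqxx mul1e esum1 ?adde0// => y [_ /= yx].
by case: eqP => [e|]; [case: yx|rewrite mul0e].
Qed.

Lemma kpow_distribution n : transition_matrix (kpow K n).
Proof.
elim: n => [|n IHn] x.
  split=> [y|]; first by rewrite /= ler0n.
  rewrite -[RHS](@avg_delta x (fun=> 1))//.
  by apply: eq_esum => y _; rewrite mule1.
have n0 z y : (0 <= kpow K n z y)%R by have [] := IHn z.
have n1 z : \esum_(y in setT) (kpow K n z y)%:E = 1 by have [] := IHn z.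
have le1 z y : (kpow K n z y)%:E <= 1.
  rewrite -(n1 z); apply: (@term_le_esum _ _ (fun y => (kpow K n z y)%:E)) => y'.
  by rewrite lee_fin.
have fin y : (kpow K n.+1 x y)%:E =
    avg (K x) (fun z => (kpow K n z y)%:E).
  rewrite /= fineK; first by apply: eq_esum => z _; rewrite EFinM.
  rewrite ge0_fin_numE; last first.
    by apply: esum_ge0 => z _; rewrite lee_fin mulr_ge0.
  apply: le_lt_trans (ltry 1).
  rewrite (eq_esum (fun z _ => EFinM _ _)). exact: avg_le_cst.
split=> [y|]; first by rewrite -lee_fin fin; apply: avg_ge0 => // z; rewrite lee_fin.
rewrite (eq_esum (fun y _ => fin y)) -avg_esum//.
rewrite -[RHS](avgc (K0 x) ler01 (K1 x)); apply: eq_avg => z; exact: n1.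
Qed.

Lemma avg_kpow n s (f : S -> R) : (forall y, (0 <= f y)%R) ->
  avg (kpow K n s) (EFin \o f) =
  iter n (fun f s => avg (K s) f) (EFin \o f) s.
Proof.
move=> f0; elim: n s => [|n IHn] s; first by rewrite avg_delta// => y; rewrite lee_fin.
have [n0 n1] : (forall z y, (0 <= kpow K n z y)%R) /\
    (forall z, \esum_(y in setT) (kpow K n z y)%:E = 1).
  by split=> z; have [] := kpow_distribution n z.
have fin y : (kpow K n.+1 s y)%:E = \esum_(z in setT) ((K s z)%:E * (kpow K n z y)%:E).
  rewrite /= fineK; first by apply: eq_esum => z _; rewrite EFinM.
  rewrite ge0_fin_numE; last first.
    by apply: esum_ge0 => z _; rewrite lee_fin mulr_ge0.
  apply: le_lt_trans (ltry 1).
  rewrite (eq_esum (fun z _ => EFinM _ _)); apply: avg_le_cst => // z.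
  rewrite -(n1 z); apply: (@term_le_esum _ _ (fun y => (kpow K n z y)%:E)) => y'.
  by rewrite lee_fin.
rewrite iterS /avg.
transitivity (\esum_(y in setT) \esum_(z in setT)
    ((K s z)%:E * ((kpow K n z y)%:E * (f y)%:E))).
  apply: eq_esum => y _; rewrite fin muleC /= -esum_mull//; last first.
    by move=> z; rewrite mule_ge0 ?lee_fin.
  by apply: eq_esum => z _; rewrite muleC muleA.
rewrite esum_swap; last by move=> y z; rewrite !mule_ge0 ?lee_fin.
apply: eq_esum => z _; rewrite esum_mull//; last by move=> y; rewrite mule_ge0 ?lee_fin.
by rewrite -IHn.
Qed.

End matrix_powers.

(** The second inequality is the one-sided bound for [b - f]. *)
Lemma tv_avg_dist {R : realType} (S : choiceType) (p q : S -> R) (f : S -> R)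
    (b t rp rq : R) :
  is_distribution p -> is_distribution q -> (forall x, 0 <= f x <= b) ->
  (tv_dist p q <= t%:E)%E -> avg p (EFin \o f) = rp%:E ->
  avg q (EFin \o f) = rq%:E -> `|rp - rq| <= t * b.
Proof.
move=> dp dq fb tv rpE rqE.
have gb x : 0 <= b - f x <= b by have /andP[] := fb x; lra.
have compl (r : S -> R) a : is_distribution r -> avg r (EFin \o f) = a%:E ->
    avg r (EFin \o (fun x => b - f x)) = (b - a)%:E.
  move=> [r0 r1] aE; have := @avg_affine _ _ r f b (-1) a r0 r1.
  rewrite mulN1r => <-//.
  - by apply: eq_avg => x; rewrite /= mulN1r.
  - by move=> x; have /andP[] := fb x.
  - by move=> x; have /andP[] := gb x; rewrite mulN1r.
have := tv_avg_le dp dq fb tv; have := tv_avg_le dp dq gb tv.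
rewrite (compl p rp)// (compl q rq)// rpE rqE -!EFinD !lee_fin ler_norml.
lra.
Qed.

Section uniform_ergodicity.
Context {R : realType} (S : choiceType).
Variables (K : S -> S -> R) (pi : S -> R).
Hypothesis Kdist : transition_matrix K.
Hypothesis pi_dist : is_distribution pi.
Hypothesis ue : uniformly_ergodic K pi.

Let K0 s s' : (0 <= K s s')%R. Proof. by have [] := Kdist s. Qed.
Let K1 s : (\esum_(s' in setT) (K s s')%:E = 1)%E.
Proof. by have [] := Kdist s. Qed.

Lemma uniformly_ergodic_tv (e : R) : 0 < e ->
  exists N, forall n s, (N <= n)%N -> (tv_dist (kpow K n s) pi <= e%:E)%E.
Proof.
move=> e0.
have /ue : nbhs (0 : \bar R)%E [set x | (x < e%:E)%E].
  by apply: open_nbhs_nbhs; split; [exact: open_ereal_lt_ereal|rewrite /= lte_fin].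
move=> [N _ NP]; exists N => n s Nn.
apply: le_trans (ltW (NP n Nn)); apply: ereal_sup_ubound.
by exists s.
Qed.

(** A finite set of [pi]-mass above 3/4 keeps mass at least 1/2 under every law within 1/4 of [pi].
    It replaces a uniform bound on the cookies in [extinct_by_lower]. *)
Lemma mixing_set : exists (B : set S) (n0 : nat), finite_set B /\
  forall s, ((2^-1)%:E <=
    iter n0.+1 (fun f s => avg (K s) f) (fun s => (s \in B)%:R%:E) s)%E.
Proof.
have [pi0 pi1] := pi_dist.
have [B [finB _] piB] : exists2 B : set S, fsets setT B &
    ((3 / 4)%:E < \sum_(x \in B) (pi x)%:E)%E.
  have : ((3 / 4)%:E < \esum_(x in setT) (pi x)%:E)%E by rewrite pi1 lte_fin; lra.
  by move=> /ereal_sup_gt[_ [B fB <-] ?]; exists B.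
have [n0 n0P] := @uniformly_ergodic_tv 4^-1 ltac:(by rewrite invr_gt0).
exists B, n0; split=> // s.
pose chi x : R := (x \in B)%:R.
have chi01 x : 0 <= chi x <= 1 by rewrite /chi; case: (x \in B); rewrite ?lexx ?ler01.
have chi0 x : 0 <= chi x by have /andP[] := chi01 x.
have -> : iter n0.+1 (fun f s => avg (K s) f) (fun s => (s \in B)%:R%:E) s =
    avg (kpow K n0.+1 s) (EFin \o chi) by rewrite avg_kpow.
have dk := @kpow_distribution _ _ _ Kdist n0.+1 s.
have [rk rkE _] := avg_fin dk.1 dk.2 chi01.
have [rp rpE _] := avg_fin pi0 pi1 chi01.
have := tv_avg_dist dk pi_dist chi01 (n0P _ s (leqnSn n0)) rkE rpE.
have : 3 / 4 <= rp.
  rewrite -lee_fin -rpE; apply: le_trans (ltW piB) _.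
  apply: esum_ge; exists B; first by split.
  rewrite le_eqVlt; apply/orP; left; apply/eqP; apply: eq_fsbigr => x xB.
  by rewrite /= /chi xB mule1.
rewrite rkE lee_fin ler_norml; lra.
Qed.

Let rop (f : S -> R) s := fine (avg (K s) (EFin \o f)).

(** * The Poisson equation *)

Section poisson_equation.
Variables (g : S -> R) (b c : R).
Hypothesis gb : forall s, 0 <= g s <= b.
Hypothesis gc : avg pi (EFin \o g) = c%:E.

Let rop_bounds (f : S -> R) (lo hi : R) : 0 <= lo ->
  (forall s, lo <= f s <= hi) ->
  (forall s, avg (K s) (EFin \o f) = (rop f s)%:E /\ lo <= rop f s <= hi).
Proof.
move=> lo0 fb s.
have fb' x : 0 <= f x <= hi.
  by have /andP[lof ->] := fb x; rewrite (le_trans lo0 lof).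
have [r rE /andP[r0 rhi]] := avg_fin (K0 s) (K1 s) fb'.
have ropE : rop f s = r by rewrite /rop rE.
rewrite ropE rhi andbT; split => //.
rewrite -lee_fin -rE -(avgc (K0 s) lo0 (K1 s)); apply: le_avg => // x.
by rewrite lee_fin; have /andP[] := fb x.
Qed.

Let gn n := iter n rop g.

Let gn_bounds n s : 0 <= gn n s <= b.
Proof.
elim: n s => [//|n IHn] s.
by have [_ ] := rop_bounds (lexx 0) IHn s.
Qed.

Let rop_gn n s : avg (K s) (EFin \o gn n) = (gn n.+1 s)%:E.
Proof. by have [-> _] := rop_bounds (lexx 0) (gn_bounds n) s. Qed.

Let iter_rop m (f : S -> R) s : (forall s, 0 <= f s <= b) ->
  avg (kpow K m s) (EFin \o f) = (iter m rop f s)%:E.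
Proof.
move=> fb; rewrite avg_kpow//; last by move=> y; have /andP[] := fb y.
have bnd n x : 0 <= iter n rop f x <= b.
  by elim: n x => [//|n IHn] x; have [_ ] := rop_bounds (lexx 0) IHn x.
elim: m s => [//|m IHm] s; rewrite iterS (eq_avg _ IHm).
by have [-> _] := rop_bounds (lexx 0) (bnd m) s.
Qed.

Let gn_cvg (e : R) : 0 < e -> exists N, forall n s, (N <= n)%N ->
  `|gn n s - c| <= e * b.
Proof.
move=> e0; have [N NP] := uniformly_ergodic_tv e0.
exists N => n s Nn.
apply: (tv_avg_dist (kpow_distribution Kdist n s) pi_dist gb (NP n s Nn) _ gc).
exact: iter_rop.
Qed.

Lemma gn_persist n m lo hi s : 0 <= lo -> (forall s, lo <= gn n s <= hi) ->
  lo <= gn (m + n) s <= hi.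
Proof.
move=> lo0 gh; elim: m s => [//|m IHm] s.
by have [_ ] := rop_bounds lo0 IHm s.
Qed.

(** The solution is the sum over [n >= 1] of [K^n g - c], shifted by a constant to be nonnegative.
    The oscillation of [K^n g] is halved every [n0] steps, so the tails are uniformly geometric. *)
Lemma poisson_corrector : exists (h : S -> R) (H : R),
  [/\ 0 <= H, forall s, 0 <= h s, forall s, h s <= H &
      forall s, avg (K s) (fun s' => (g s' + h s')%:E) = (h s + c)%:E].
Proof.
have [x0 _] : exists x0 : S, True.
  apply/not_existsP => nx; have [_] := pi_dist.
  rewrite esum1; first by move/eqP; rewrite eq_sym onee_eq0.
  by move=> x; have := nx x; case.
have b0 : 0 <= b by have /andP[] := gb x0; exact: le_trans.
have [pi0 pi1] := pi_dist.
have [n1 n1P] := @uniformly_ergodic_tv 4^-1 ltac:(by rewrite invr_gt0).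
set n0 := n1.+1.
(* All averages under [kpow K n0] lie within [w / 4] of the one under [pi], hence in an interval of
   length [w / 2]; the maximum with 0 keeps its lower end nonnegative. *)
have contract n lo w : 0 <= lo -> (forall s, lo <= gn n s <= lo + w) ->
    exists2 lo', 0 <= lo' & forall s, lo' <= gn (n0 + n) s <= lo' + w / 2.
  move=> lo0 gw.
  pose ft s := gn n s - lo.
  have ftw s : 0 <= ft s <= w by have := gw s; rewrite /ft; lra.
  have [rp rpE _] := avg_fin pi0 pi1 ftw.
  exists (lo + Num.max 0 (rp - w / 4)) => [|s].
    by rewrite addr_ge0// le_max lexx.
  have dk := @kpow_distribution _ _ _ Kdist n0 s.
  have [rk rkE /andP[rk0 _]] := avg_fin dk.1 dk.2 ftw.
  have := tv_avg_dist dk pi_dist ftw (n1P _ s (leqnSn n1)) rkE rpE.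
  have -> : gn (n0 + n) s = lo + rk.
    apply: EFin_inj; rewrite /gn iterD -iter_rop//; last exact: gn_bounds.
    rewrite -[rk]mul1r -(avg_affine dk.1 dk.2 _ rkE).
    - by apply: eq_avg => x; rewrite /= /ft/=; congr (_%:E); rewrite mul1r addrC subrK.
    - by move=> x; have /andP[] := ftw x.
    - by move=> x; have /andP[] := ftw x; rewrite mul1r; lra.
  rewrite ler_norml; have [m0|m0] := leP 0 (rp - w / 4); lra.
pose tau n : R := 2^-1 ^+ (n %/ n0).
have tau0 n : 0 <= tau n by rewrite exprn_ge0// invr_ge0.
have tau_decr n : tau n.+1 <= tau n.
  by rewrite /tau ler_wiXn2l ?invr_ge0 ?invf_le1 ?ler1n// leq_div2r.
have osc n : exists2 lo, 0 <= lo & forall s, lo <= gn n s <= lo + b * tau n.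
  rewrite (divn_eq n n0) addnC; set r := (n %% n0)%N; set q := (n %/ n0)%N.
  have -> : tau (r + q * n0)%N = 2^-1 ^+ q.
    by rewrite /tau addnC divnMDl// divn_small ?addn0// ltn_mod.
  have [lo lo0 loP] : exists2 lo, 0 <= lo &
      forall s, lo <= gn (q * n0) s <= lo + b * 2^-1 ^+ q.
    elim: q => [|q [lo lo0 IHq]].
      by exists 0 => // s; rewrite add0r expr0 mulr1; exact: gn_bounds.
    have [lo' lo'0 lo'P] := contract _ _ _ lo0 IHq.
    by exists lo' => // s; rewrite mulSn exprSr mulrA; exact: lo'P.
  by exists lo => // s; exact: gn_persist.
have gn_c n s : `|gn n s - c| <= b * tau n.
  have [lo lo0 loP] := osc n.
  have cP (e : R) : 0 < e -> lo <= c + e /\ c <= lo + b * tau n + e.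
    move=> e0; have b1 : 0 < b + 1 by lra.
    have [N NP] := gn_cvg (divr_gt0 e0 b1).
    have := gn_persist N s lo0 loP; have := NP (N + n)%N s (leq_addr _ _).
    have : e / (b + 1) * b <= e.
      by rewrite mulrAC ler_pdivrMr// ler_pM2l//; lra.
    rewrite ler_norml; lra.
  have : lo <= c by apply/ler_addgt0Pr => e /cP[].
  have : c <= lo + b * tau n by apply/ler_addgt0Pr => e /cP[].
  have := loP s; rewrite ler_norml; lra.
(* This is the tail sum of [tau] from [n] on: along each residue class modulo [n0] it is a geometric
   series of ratio 1/2, whence the factor 2. *)
pose U n := \sum_(j < n0) (2 * tau (n + j)%N).
have U0 n : 0 <= U n by apply: sumr_ge0 => j _; rewrite mulr_ge0.
have US n : U n = U n.+1 + tau n.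
  rewrite /U [LHS]big_ord_recl [in RHS]big_ord_recr /= addn0.
  have -> : \sum_(i < n1) 2 * tau (n + bump 0 i)%N = \sum_(i < n1) 2 * tau (n.+1 + i)%N.
    by apply: eq_bigr => i _; rewrite /bump/= add1n addSnnS.
  have -> : tau (n.+1 + n1)%N = tau n / 2.
    by rewrite /tau addSnnS divnDr// divnn addn1 exprSr.
  set s := \sum_(_ < _) _; lra.
have U_small (e : R) : 0 < e -> exists n, b * U n <= e.
  move=> e0; have a0 : 0 < 2 * n0%:R * (b + 1) / e.
    by rewrite divr_gt0// !mulr_gt0//; lra.
  set q := Num.bound (2 * n0%:R * (b + 1) / e).
  exists (q * n0)%N.
  have : U (q * n0)%N <= 2 * n0%:R * 2^-1 ^+ q.
    apply: (@le_trans _ _ (\sum_(j < n0) (2 * 2^-1 ^+ q))).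
      apply: ler_sum => j _; rewrite ler_pM2l// /tau divnMDl// divn_small ?addn0//.
    by rewrite sumr_const card_ord -mulr_natl; lra.
  move=> Uq; have q2 : q%:R <= 2 ^+ q :> R.
    by rewrite -natrX ler_nat ltnW// ltn_expl.
  have qb : 2 * n0%:R * (b + 1) / e < q%:R by rewrite archi_boundP// ltW.
  have p2 : 0 < (2 : R) ^+ q by rewrite exprn_gt0.
  apply: le_trans (ler_wpM2l b0 Uq) _.
  rewrite exprVn mulrA ler_pdivrMr//.
  have : 2 * n0%:R * (b + 1) < 2 ^+ q * e.
    by rewrite -ltr_pdivrMr//; exact: lt_le_trans qb q2.
  have : 0 <= n0%:R :> R by []. nra.
pose Sg n s := \sum_(i < n) gn i.+1 s.
pose lo n s := Sg n s - n%:R * c - b * U n.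
pose hi n s := Sg n s - n%:R * c + b * U n.
have SgS n s : Sg n.+1 s = Sg n s + gn n.+1 s by rewrite /Sg big_ord_recr.
have lohi n s : lo n s <= lo n.+1 s /\ hi n.+1 s <= hi n s.
  have := gn_c n.+1 s; have := ler_wpM2l b0 (tau_decr n).
  have := congr1 (fun x => b * x) (US n).
  rewrite /lo /hi SgS -(natr1 n) ler_norml; lra.
have lo_hi n m s : lo n s <= hi m s.
  have lo_homo : {homo lo^~ s : i j / (i <= j)%N >-> i <= j}.
    by apply: homo_leq => [//|? ? ?|i]; [exact: le_trans|have [] := lohi i s].
  have hi_homo : {homo hi^~ s : i j / (i <= j)%N >-> j <= i}.
    apply: homo_leq => [//|y x z xy yz|i]; last by have [] := lohi i s.
    exact: le_trans yz xy.
  apply: le_trans (lo_homo _ _ (leq_maxl n m)) _.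
  apply: le_trans (hi_homo _ _ (leq_maxr n m)).
  have : 0 <= b * U (maxn n m) by rewrite mulr_ge0.
  rewrite /lo /hi; lra.
(* The sum of the series, obtained as the point caught between the increasing bounds [lo] and the
   decreasing bounds [hi]. *)
pose h s := inf (range (hi ^~ s)).
have hlo n s : lo n s <= h s.
  by apply: lb_le_inf; [exists (hi 0%N s), 0%N|move=> _ [m _ <-]].
have hhi n s : h s <= hi n s.
  apply: ge_inf; last by exists n.
  by exists (lo 0%N s) => _ [m _ <-].
pose C := b * U 0%N.
have C0 : 0 <= C by rewrite mulr_ge0.
have lo0 s : lo 0%N s = - C by rewrite /lo /Sg big_ord0 mul0r subr0 sub0r.
have hi0 s : hi 0%N s = C by rewrite /hi /Sg big_ord0 mul0r subr0 add0r.
exists (fun s => h s + C), (C + C); split=> [|s|s|s].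
- by rewrite addr_ge0.
- by have := hlo 0%N s; rewrite lo0; lra.
- by have := hhi 0%N s; rewrite hi0; lra.
have g0 x : 0 <= g x by have /andP[] := gb x.
have gn0 n x : 0 <= gn n x by have /andP[] := gn_bounds n x.
have c0 : 0 <= c by rewrite -lee_fin -gc; apply: avg_ge0 => // x; rewrite lee_fin.
have Sg0 n x : 0 <= Sg n x by apply: sumr_ge0.
have hC0 x : 0 <= h x + C by have := hlo 0%N x; rewrite lo0; lra.
have avgSg n : avg (K s) (fun x => (g x + Sg n x)%:E) = (Sg n.+1 s)%:E.
  elim: n => [|n IHn].
    rewrite SgS /Sg big_ord0 add0r -(rop_gn 0%N).
    by apply: eq_avg => x; rewrite big_ord0 addr0.
  have e1 x : (0 <= (g x + Sg n x)%:E)%E by rewrite lee_fin addr_ge0.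
  have e2 x : (0 <= (EFin \o gn n.+1) x)%E by rewrite lee_fin.
  rewrite SgS EFinD -IHn -rop_gn -(avgD (K0 s) e1 e2).
  by apply: eq_avg => x; rewrite -EFinD SgS addrA.
have [r rE] : exists r : R, avg (K s) (fun x => (g x + (h x + C))%:E) = r%:E.
  have bd x : 0 <= g x + (h x + C) <= b + (C + C).
    by have /andP[] := gb x; have := hC0 x; have := hhi 0%N x; rewrite hi0; lra.
  by have [r rE _] := avg_fin (K0 s) (K1 s) bd; exists r.
have addc (f : S -> R) a : (forall x, 0 <= f x) -> 0 <= a ->
    avg (K s) (fun x => (f x + a)%:E) = (avg (K s) (EFin \o f) + a%:E)%E.
  move=> f0 a0; rewrite -[X in (_ + X)%E](avgc (K0 s) a0 (K1 s)) -avgD//.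
have gh0 x : 0 <= g x + (h x + C) by rewrite addr_ge0.
have gS0 n x : 0 <= g x + Sg n x by rewrite addr_ge0.
(* Up to [b * U n], [h] is the centred partial sum [Sg n - n * c], and averaging turns [g + Sg n]
   into [Sg n.+1]. The constants on both sides keep the averaged functions nonnegative. *)
have bnd n : r <= h s + C + c + 2 * (b * U n) /\ h s + C + c <= r + 2 * (b * U n).
  have bU : 0 <= b * U n by rewrite mulr_ge0.
  have bU' : b * U n.+1 <= b * U n by rewrite ler_wpM2l// (US n) lerDl.
  have nc : 0 <= n%:R * c by rewrite mulr_ge0.
  split.
    have : (avg (K s) (fun x => (g x + (h x + C) + n%:R * c)%:E) <=
        avg (K s) (fun x => (g x + Sg n x + (C + b * U n))%:E))%E.
      apply: le_avg => // x; rewrite lee_fin; have := hhi n x; rewrite /hi; lra.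
    rewrite !addc// ?addr_ge0// [X in (X + _)%E](_ : _ = r%:E)//.
    rewrite [X in (_ <= X + _)%E](_ : _ = (Sg n.+1 s)%:E); last exact: avgSg.
    rewrite -!EFinD lee_fin; have := hlo n.+1 s; rewrite /lo -(natr1 n); lra.
  have : (avg (K s) (fun x => (g x + Sg n x + C)%:E) <=
      avg (K s) (fun x => (g x + (h x + C) + (n%:R * c + b * U n))%:E))%E.
    apply: le_avg => // x; rewrite lee_fin; have := hlo n x; rewrite /lo; lra.
  rewrite !addc// ?addr_ge0// [X in (_ <= X + _)%E](_ : _ = r%:E)//.
  rewrite [X in (X + _ <= _)%E](_ : _ = (Sg n.+1 s)%:E); last exact: avgSg.
  rewrite -!EFinD lee_fin; have := hhi n.+1 s; rewrite /hi -(natr1 n); lra.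
rewrite rE; congr (_%:E); apply/eqP; rewrite eq_le; apply/andP; split;
  apply/ler_addgt0Pr => e e0.
  have [m mP] := U_small (e / 2) ltac:(lra); have [] := bnd m; lra.
have [m mP] := U_small (e / 2) ltac:(lra); have [] := bnd m; lra.
Qed.

End poisson_equation.

End uniform_ergodicity.

(** * Path events and Ville's inequality *)

Section path_events.
Implicit Types (x X : nat -> int) (n t : nat).

Definition agree n x X := forall m, (m <= n)%N -> X m = x m.

Definition cylinder x n : set walk_path := [set X | agree n x X].

Lemma measurable_coord n (z : int) : measurable [set X : walk_path | X n = z].
Proof. by apply: sub_sigma_algebra; exists n, z. Qed.

Lemma cylinderS x n :
  cylinder x n.+1 = cylinder x n `&` [set X | X n.+1 = x n.+1].
Proof.
apply/seteqP; split=> X /=; first by move=> h; split=> [m mn|]; apply: h => //; exact: leqW.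
by move=> [h e] m; rewrite leq_eqVlt => /predU1P[->//|]; rewrite ltnS; exact: h.
Qed.

Lemma measurable_cylinder x n : measurable (cylinder x n).
Proof.
elim: n => [|n IHn]; last first.
  by rewrite cylinderS; apply: measurableI => //; exact: measurable_coord.
rewrite (_ : cylinder x 0 = [set X : walk_path | X 0%N = x 0%N]).
  exact: measurable_coord.
apply/seteqP; split=> X /=; first by move=> h; apply: h.
by move=> h m; rewrite leqn0 => /eqP ->.
Qed.

Definition finitary n (A : set walk_path) :=
  forall x X, agree n x X -> A x -> A X.

(** Integer prefixes are countable in number, so such an event is a countable union of cylinders. *)
Lemma measurable_finitary n A : finitary n A -> measurable A.
Proof.
move=> finA.
pose F (s : seq int) := if `[< A (nth 0 s) >] then cylinder (nth 0 s) n else set0.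
have -> : A = \bigcup_s F s.
  apply/seteqP; split=> X.
    move=> AX; exists (mkseq X n.+1) => //; rewrite /F.
    have XE : agree n (nth 0 (mkseq X n.+1)) X by move=> m mn; rewrite nth_mkseq.
    case: asboolP => // nA; case: nA; apply: finA AX => m mn.
    by rewrite nth_mkseq.
  move=> [s _]; rewrite /F; case: asboolP => // As Xs.
  exact: finA As.
apply: countable_bigcupT_measurable; first exact: countableP.
move=> s; rewrite /F; case: asboolP => // _; exact: measurable_cylinder.
Qed.

Definition walk_to x n := x 0%N = 0 /\
  forall m, (m < n)%N -> x m.+1 = x m + 1 \/ x m.+1 = x m - 1.

Definition extend x n (z : int) : nat -> int := fun m => if (m <= n)%N then x m else z.

Lemma extend_agree x n z : agree n x (extend x n z).
Proof. by move=> m mn; rewrite /extend mn. Qed.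

Lemma extend_last x n z : extend x n z n.+1 = z.
Proof. by rewrite /extend ltnn. Qed.

Lemma cylinder_extend x n z :
  cylinder (extend x n z) n.+1 = cylinder x n `&` [set X | X n.+1 = z].
Proof.
rewrite cylinderS extend_last; congr (_ `&` _).
by apply/seteqP; split=> X /= h m mn; rewrite h// extend_agree.
Qed.

Lemma walk_to_finitary n : finitary n [set x | walk_to x n].
Proof.
move=> x X xX /= [x0 xS]; split=> [|m mn]; first by rewrite xX.
by rewrite !xX// 1?ltnW//; exact: xS.
Qed.

Lemma walk_to_le x m n : (m <= n)%N -> walk_to x n -> walk_to x m.
Proof. by move=> mn [x0 xS]; split=> // k km; apply: xS; exact: leq_trans mn. Qed.

Lemma walk_to_extend x n z : walk_to x n -> z = x n + 1 \/ z = x n - 1 ->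
  walk_to (extend x n z) n.+1.
Proof.
move=> [x0 xS] zn; split; first by rewrite extend_agree.
move=> m; rewrite ltnS leq_eqVlt => /predU1P[->|mn].
  by rewrite extend_last extend_agree.
by rewrite !extend_agree// 1?ltnW//; exact: xS.
Qed.

End path_events.

Section quenched_walk.
Context {R : realType}.
Variables (w : int -> nat -> R) (mu : probability walk_path R).
Hypothesis w01 : forall k i, 0 <= w k i <= 1.
Hypothesis muQ : quenched_law 0 (w : env R) mu.
Implicit Types (x : nat -> int) (n : nat).

Local Notation cookie x n := (w (x n) (visits x n).-1).

(** The law prescribes the masses of the two nearest-neighbour continuations; as they add up to the
    mass of the cylinder, all other continuations are null. *)
Lemma quenched_split x n (B : set walk_path) : measurable B ->
  (mu (cylinder x n `&` B) <=
   mu (cylinder (extend x n (x n + 1)) n.+1 `&` B) +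
   mu (cylinder (extend x n (x n - 1)) n.+1 `&` B))%E.
Proof.
move=> mB; have [_ /(_ n x)[up dn]] := muQ.
set p := cookie x n in up dn *.
set Cu := cylinder (extend x n (x n + 1)) n.+1.
set Cd := cylinder (extend x n (x n - 1)) n.+1.
have {}up : (mu Cu = mu (cylinder x n) * p%:E)%E by rewrite /Cu cylinder_extend.
have {}dn : (mu Cd = mu (cylinder x n) * (1 - p)%:E)%E by rewrite /Cd cylinder_extend.
have mC := measurable_cylinder x n.
have mCu : measurable Cu by exact: measurable_cylinder.
have mCd : measurable Cd by exact: measurable_cylinder.
have fin A : measurable A -> exists2 a : R, mu A = a%:E & 0 <= a.
  move=> mA; exists (fine (mu A)); last by rewrite fine_ge0.
  by rewrite fineK// fin_num_measure.
have [m mE m0] := fin _ mC.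
have CuCd : Cu `&` Cd = set0.
  rewrite /Cu /Cd !cylinder_extend; apply/seteqP; split=> // X [[_ /= ->] [_ /= e]].
  by move: e; lia.
have sub : Cu `|` Cd `<=` cylinder x n.
  by rewrite /Cu /Cd !cylinder_extend => X [] [].
have restE : mu (cylinder x n `\` (Cu `|` Cd)) = 0%E.
  have muD : (mu (cylinder x n `\` (Cu `|` Cd)) =
      mu (cylinder x n) - mu (cylinder x n `&` (Cu `|` Cd)))%E.
    apply: measureD => //; first exact: measurableU.
    by rewrite -ge0_fin_numE// fin_num_measure.
  have muU : (mu (Cu `|` Cd) = mu Cu + mu Cd)%E by exact: measureU.
  rewrite muD (setIidr sub) muU up dn mE.
  have -> : (m%:E * p%:E + m%:E * (1 - p)%:E = m%:E)%E.
    by rewrite -!EFinM -EFinD; congr (_%:E); ring.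
  by rewrite subee.
have cover : cylinder x n `&` B `<=`
    ((Cu `&` B) `|` (Cd `&` B)) `|` (cylinder x n `\` (Cu `|` Cd)).
  move=> X [CX BX]; have [h|h] := pselect ((Cu `|` Cd) X).
    by left; case: h => h; [left|right].
  by right.
have m1 : measurable (Cu `&` B) by exact: measurableI.
have m2 : measurable (Cd `&` B) by exact: measurableI.
have m3 : measurable (cylinder x n `\` (Cu `|` Cd)).
  by apply: measurableD => //; exact: measurableU.
apply: (@le_trans _ _ (mu (((Cu `&` B) `|` (Cd `&` B)) `|`
    (cylinder x n `\` (Cu `|` Cd))))).
  by apply: le_measure; rewrite ?inE//; [exact: measurableI|
    apply: measurableU => //; exact: measurableU].
have -> : mu (((Cu `&` B) `|` (Cd `&` B)) `|` (cylinder x n `\` (Cu `|` Cd))) =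
    mu ((Cu `&` B) `|` (Cd `&` B)).
  by apply: measureU0 => //; exact: measurableU.
exact: measureU2.
Qed.

Section ville.
Variables (Phi : (nat -> int) -> nat -> \bar R) (A : (nat -> int) -> nat -> Prop).
Hypothesis Phi0 : forall x n, (0 <= Phi x n)%E.
Hypothesis Phi_agree : forall x X n, agree n x X -> Phi X n = Phi x n.
Hypothesis A_agree : forall x X n, agree n x X -> A x n -> A X n.
Hypothesis Phi_super : forall x n, walk_to x n -> A x n ->
  ((cookie x n)%:E * Phi (extend x n (x n + 1)) n.+1 +
   (1 - cookie x n)%:E * Phi (extend x n (x n - 1)) n.+1 <= Phi x n)%E.

Let crosses n r : set walk_path := [set X | exists t, [/\ (n <= t)%N,
  (t <= n + r)%N, (forall t', (n <= t')%N -> (t' < t)%N -> A X t') &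
  (1 <= Phi X t)%E]].

Let crosses_finitary n r : finitary (n + r) (crosses n r).
Proof.
move=> x X xX [t [nt tnr At Pt]]; exists t; split=> //.
  move=> t' nt' t't; apply: A_agree (At t' nt' t't) => m mt'.
  by apply: xX; apply: leq_trans mt' _; apply: leq_trans (ltnW t't) tnr.
rewrite (@Phi_agree x)// => m mt; apply: xX; exact: leq_trans tnr.
Qed.

(** Induction on the horizon [r]. If [Phi] has reached 1 the bound is trivial; if [A] fails no
    crossing can follow; otherwise the cylinder is split at the next step. *)
Lemma ville_cylinder r n x : walk_to x n ->
  (mu (cylinder x n `&` crosses n r) <= Phi x n * mu (cylinder x n))%E.
Proof.
elim: r n x => [|r IHr] n x wx.
all: have mcr r' n' : measurable (crosses n' r')
  by apply: measurable_finitary; exact: crosses_finitary.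
all: have mC := measurable_cylinder x n.
all: have [P1|P1] := leP 1%E (Phi x n).
1,3: apply: (@le_trans _ _ (mu (cylinder x n))); last by rewrite lee_pemull.
1,2: by apply: le_measure; rewrite ?inE//; exact: measurableI.
  rewrite (_ : _ `&` _ = set0) ?measure0 ?mule_ge0//.
  apply/seteqP; split=> // X [CX [t [nt tn _ Pt]]].
  have tn' : t = n by lia.
  by move: Pt; rewrite tn' (Phi_agree CX) leNgt P1.
have [Ax|nAx] := pselect (A x n); last first.
  rewrite (_ : _ `&` _ = set0) ?measure0 ?mule_ge0//.
  apply/seteqP; split=> // X [CX [t [nt tn At Pt]]].
  have [tn'|tn'] := eqVneq t n.
    by move: Pt; rewrite tn' (Phi_agree CX) leNgt P1.
  case: nAx; apply: (@A_agree X); last by apply: At => //; lia.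
  by move=> m mn; rewrite CX.
have shift z : cylinder (extend x n z) n.+1 `&` crosses n r.+1 `<=`
    cylinder (extend x n z) n.+1 `&` crosses n.+1 r.
  move=> X [CX [t [nt tn At Pt]]]; split=> //; exists t; split=> //.
  - have [tn'|tn'] := eqVneq t n; last by lia.
    have CXn : agree n x X by move: CX; rewrite cylinder_extend => -[].
    by move: Pt; rewrite tn' (Phi_agree CXn) leNgt P1.
  - by lia.
  - by move=> t' nt'; apply: At; exact: ltnW.
apply: le_trans (quenched_split x n (mcr r.+1 n)) _.
have [_ /(_ n x)[up dn]] := muQ.
rewrite -/(cylinder x n) -!cylinder_extend in up dn.
apply: (@le_trans _ _ (((cookie x n)%:E * Phi (extend x n (x n + 1)) n.+1 +
   (1 - cookie x n)%:E * Phi (extend x n (x n - 1)) n.+1) *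
   mu (cylinder x n)))%E; last by apply: lee_wpmul2r => //; exact: Phi_super.
have /andP[p0 p1] := w01 (x n) (visits x n).-1.
rewrite ge0_muleDl ?mule_ge0 ?lee_fin ?subr_ge0//.
apply: leeD.
  apply: (@le_trans _ _
    (mu (cylinder (extend x n (x n + 1)) n.+1 `&` crosses n.+1 r))).
    apply: le_measure; rewrite ?inE//; apply: measurableI => //;
      exact: measurable_cylinder.
  apply: le_trans (IHr _ _ (walk_to_extend wx (or_introl erefl))) _.
  by rewrite up [X in (_ * X <= _)%E]muleC muleA [X in (X * _ <= _)%E]muleC.
apply: (@le_trans _ _
  (mu (cylinder (extend x n (x n - 1)) n.+1 `&` crosses n.+1 r))).
  apply: le_measure; rewrite ?inE//; apply: measurableI => //;
    exact: measurable_cylinder.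
apply: le_trans (IHr _ _ (walk_to_extend wx (or_intror erefl))) _.
by rewrite dn [X in (_ * X <= _)%E]muleC muleA [X in (X * _ <= _)%E]muleC.
Qed.

End ville.
End quenched_walk.

Section quenched_walk_events.
Context {R : realType}.
Variables (w : int -> nat -> R) (mu : probability walk_path R).
Hypothesis w01 : forall k i, 0 <= w k i <= 1.
Hypothesis muQ : quenched_law 0 (w : env R) mu.
Implicit Types (x X : nat -> int) (n : nat) (k : int).

Local Notation cookie x n := (w (x n) (visits x n).-1).

Lemma quenched_start (B : set walk_path) : measurable B ->
  mu B = mu (cylinder (fun=> 0) 0 `&` B).
Proof.
move=> mB; have mC := measurable_cylinder (fun=> 0) 0.
have C1 : mu (cylinder (fun=> 0) 0) = 1%E.
  rewrite -[RHS](muQ.1); congr (mu _); apply/seteqP; split=> X /=.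
    by move=> h; exact: h.
  by move=> h m; rewrite leqn0 => /eqP ->.
have C0 : mu (~` cylinder (fun=> 0) 0) = 0%E.
  have : (mu (~` cylinder (fun=> 0%R) 0) = 1 - mu (cylinder (fun=> 0%R) 0))%E.
    exact: probability_setC.
  by rewrite C1 subee.
have B0 : mu (B `\` cylinder (fun=> 0) 0) = 0%E.
  apply/eqP; rewrite eq_le measure_ge0 andbT -C0.
  apply: le_measure; rewrite ?inE//; first exact: measurableD.
  exact: measurableC.
rewrite setIC -[RHS]add0e -B0; exact: measureDI.
Qed.

Definition is_walk : set walk_path := [set X | forall n, walk_to X n].

Lemma measurable_is_walk : measurable is_walk.
Proof.
rewrite (_ : is_walk = \bigcap_n [set X | walk_to X n]).
  apply: bigcapT_measurable => n; apply: (@measurable_finitary n).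
  exact: walk_to_finitary.
by apply/seteqP; split=> X /= h n; [move=> _|]; apply: h.
Qed.

Lemma quenched_is_walk : mu (~` is_walk) = 0%E.
Proof.
pose bad r : set walk_path := [set X | ~ walk_to X r].
have mbad r : measurable (bad r).
  apply: (@measurable_finitary r) => x X xX /= nx wX; apply: nx.
  by apply: walk_to_finitary wX => m mr; rewrite xX.
have cyl0 r n x : walk_to x n -> mu (cylinder x n `&` bad (n + r)%N) = 0%E.
  elim: r n x => [|r IHr] n x wx.
    rewrite (_ : _ `&` _ = set0) ?measure0//; apply/seteqP; split=> // X [CX].
    by rewrite addn0 /bad/=; case; exact: walk_to_finitary wx.
  apply/eqP; rewrite eq_le measure_ge0 andbT.
  apply: le_trans (quenched_split muQ x n (mbad (n + r.+1)%N)) _.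
  rewrite -addSnnS IHr ?IHr ?adde0//; apply: walk_to_extend => //;
    by [left|right].
have -> : ~` is_walk = \bigcup_r bad r.
  apply/seteqP; split=> X /=; first by move=> /existsNP[r rX]; exists r.
  by move=> [r _ rX] h; apply: rX; exact: h.
apply: measure_negligible; first exact: bigcupT_measurable.
apply: negligible_bigcup => r; apply/negligibleP => //.
have h : mu (bad r) = 0%E.
  by rewrite quenched_start// -[r]add0n; apply: cyl0; split.
exact: h.
Qed.

Section ville.
Variables (Phi : (nat -> int) -> nat -> \bar R) (A : (nat -> int) -> nat -> Prop).
Hypothesis Phi0 : forall x n, (0 <= Phi x n)%E.
Hypothesis Phi_agree : forall x X n, agree n x X -> Phi X n = Phi x n.
Hypothesis A_agree : forall x X n, agree n x X -> A x n -> A X n.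
Hypothesis Phi_super : forall x n, walk_to x n -> A x n ->
  ((cookie x n)%:E * Phi (extend x n (x n + 1)) n.+1 +
   (1 - cookie x n)%:E * Phi (extend x n (x n - 1)) n.+1 <= Phi x n)%E.

(* Ville's maximal inequality for nonnegative supermartingales, in which [Phi]
   need only be a supermartingale while [A] holds. *)
Lemma ville (B : set walk_path) : measurable B ->
  (forall X, B X -> is_walk X -> exists2 t, (1 <= Phi X t)%E &
    forall t', (t' < t)%N -> A X t') ->
  (mu B <= Phi (fun=> 0%R) 0%N)%E.
Proof.
move=> mB BP.
pose crosses r : set walk_path := [set X | exists t, [/\ (0 <= t)%N,
  (t <= 0 + r)%N, (forall t', (0 <= t')%N -> (t' < t)%N -> A X t') &
  (1 <= Phi X t)%E]].
have mcr r : measurable (crosses r).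
  apply: (@measurable_finitary r) => x X xX [t [_ tr At Pt]]; exists t; split=> //.
    move=> t' _ t't; apply: A_agree (At t' isT t't) => m mt'.
    by apply: xX; lia.
  by rewrite (@Phi_agree x)// => m mt; apply: xX; lia.
have w0 : walk_to (fun=> 0) 0 by split.
have bound r : (mu (crosses r) <= Phi (fun=> 0%R) 0%N)%E.
  rewrite quenched_start//.
  apply: le_trans (ville_cylinder w01 muQ Phi0 Phi_agree A_agree Phi_super r w0) _.
  rewrite -[leRHS]mule1; apply: lee_wpmul2l => //.
  by apply: probability_le1; exact: measurable_cylinder.
have mUcr : measurable (\bigcup_r crosses r) by exact: bigcupT_measurable.
apply: (@le_trans _ _ (mu ((\bigcup_r crosses r) `|` ~` is_walk))).
  apply: le_measure; rewrite ?inE//.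
    by apply: measurableU => //; apply: measurableC; exact: measurable_is_walk.
  move=> X BX; have [wX|] := pselect (is_walk X); last by right.
  have [t Pt At] := BP X BX wX; left; exists t => //; exists t; split=> //.
  by move=> t' _; exact: At.
have -> : mu ((\bigcup_r crosses r) `|` ~` is_walk) = mu (\bigcup_r crosses r).
  apply: measureU0 => //; last exact: quenched_is_walk.
  by apply: measurableC; exact: measurable_is_walk.
have cv : mu (crosses r) @[r --> \oo] --> mu (\bigcup_r crosses r).
  apply: nondecreasing_cvg_mu => // m n mn; apply/subsetPset => X [t [_ tm At Pt]].
  by exists t; split=> //; lia.
rewrite -(cvg_lim _ cv)//; apply: lime_le; first by apply/cvg_ex; eexists; exact: cv.
exact: nearW.
Qed.

End ville.

End quenched_walk_events.

(** * Visits and steps of a walk *)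

Section counts.
Implicit Types (x X : nat -> int) (k s z : int) (n : nat).

Definition visit_count x k n : nat := \sum_(m < n) (x m == k).

Definition step_count x k s n : nat :=
  \sum_(m < n) ((x m == k) && (x m.+1 == k + s)%R).

Lemma visit_countS x k n : visit_count x k n.+1 = (visit_count x k n + (x n == k))%N.
Proof. by rewrite /visit_count big_ord_recr. Qed.

Lemma step_countS x k s n : step_count x k s n.+1 =
  (step_count x k s n + ((x n == k) && (x n.+1 == k + s)%R))%N.
Proof. by rewrite /step_count big_ord_recr. Qed.

Lemma visitsE x n : (visits x n).-1 = visit_count x (x n) n.
Proof.
rewrite /visits -sum1_card big_mkcond/= big_ord_recr/= !inE eqxx addn1/=.
by apply: eq_bigr => i _; rewrite inE/=; case: eqP.
Qed.

Lemma visit_count_agree x X k n : agree n x X -> visit_count X k n = visit_count x k n.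
Proof. by move=> xX; apply: eq_bigr => m _; rewrite xX// ltnW. Qed.

Lemma step_count_agree x X k s n :
  agree n x X -> step_count X k s n = step_count x k s n.
Proof. by move=> xX; apply: eq_bigr => m _; rewrite !xX// ltnW. Qed.

Lemma visit_count_extend x k n z :
  visit_count (extend x n z) k n.+1 = (visit_count x k n + (x n == k))%N.
Proof.
by rewrite visit_countS extend_agree// (visit_count_agree k (@extend_agree x n z)).
Qed.

Lemma step_count_extend x k s n z : step_count (extend x n z) k s n.+1 =
  (step_count x k s n + ((x n == k) && (z == k + s)%R))%N.
Proof.
rewrite step_countS extend_agree// extend_last.
by rewrite (step_count_agree k s (@extend_agree x n z)).
Qed.

Lemma step_count_le x k s m n : (m <= n)%N -> (step_count x k s m <= step_count x k s n)%N.
Proof.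
move=> /subnK <-; elim: (n - m)%N => [//|d IHd].
by rewrite addSn step_countS; apply: leq_trans IHd (leq_addr _ _).
Qed.

(** Crossings of the edge between [k] and [k + 1] alternate, beginning with one to the right because
    the walk starts at 0. *)
Lemma flow x n k : walk_to x n -> 0 <= k ->
  step_count x k 1 n = (step_count x (k + 1)%R (-1)%R n + (k + 1 <= x n)%R)%N.
Proof.
move=> wx k0; elim: n wx => [|n IHn] wx.
  by rewrite /step_count !big_ord0 wx.1; case: leP => //; lia.
rewrite !step_countS IHn; last exact: walk_to_le wx.
have [|] := wx.2 n (ltnSn n) => ->; rewrite addrK; lia.
Qed.

Lemma measurable_exists_time (Pr : (nat -> int) -> nat -> Prop) :
  (forall x X n, agree n x X -> Pr x n -> Pr X n) ->
  measurable ([set X : walk_path | exists t, Pr X t]).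
Proof.
move=> Pra; rewrite (_ : [set _ | _] = \bigcup_t [set X | Pr X t]).
  by apply: bigcupT_measurable => t; apply: (@measurable_finitary t) => x X; exact: Pra.
by apply/seteqP; split=> X [t]; exists t.
Qed.

End counts.

(** * Infinitely many visits to a site force infinitely many steps to either side *)

Section infinitely_many_steps.
Context {R : realType}.
Variables (w : int -> nat -> R) (mu : probability walk_path R) (M : nat).
Hypothesis w01 : forall k i, 0 <= w k i <= 1.
Hypothesis wM : forall k i, (M <= i)%N -> w k i = 2^-1.
Hypothesis muQ : quenched_law 0 (w : env R) mu.

(** Exponential supermartingale with a factor 4/3 for each visit after the first [M] and 1/2 for
    each step [s]. A fair cookie gives [4 / 3 * (1 / 2 * 1 / 2 + 1 / 2) = 1]; during the first [M]
    visits the value cannot increase. *)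
Lemma many_visits_few_steps (k s : int) (rho v : nat) : s = 1 \/ s = -1 ->
  (mu [set X | exists t, (v + M <= visit_count X k t)%N /\
                        (step_count X k s t <= rho)%N] <=
   (2 ^+ rho * (3 / 4) ^+ v)%:E)%E.
Proof.
move=> s1.
pose Phi (x : nat -> int) n : \bar R := ((2 ^+ rho * (3 / 4) ^+ v) *
  ((4 / 3) ^+ (visit_count x k n - M) * 2^-1 ^+ step_count x k s n))%:E.
have C0 : 0 <= 2 ^+ rho * (3 / 4) ^+ v :> R by rewrite mulr_ge0// exprn_ge0.
have -> : (2 ^+ rho * (3 / 4) ^+ v)%:E = Phi (fun=> 0) 0%N.
  by rewrite /Phi /visit_count /step_count !big_ord0 sub0n !expr0 !mulr1.
apply: (ville w01 muQ (Phi := Phi) (A := fun _ _ => True)).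
- by move=> x n; rewrite lee_fin mulr_ge0// mulr_ge0// exprn_ge0.
- by move=> x X n xX; rewrite /Phi (visit_count_agree k xX) (step_count_agree k s xX).
- by [].
- move=> x n _ _; rewrite visitsE /Phi !visit_count_extend !step_count_extend.
  rewrite -!EFinM -EFinD lee_fin.
  set C := 2 ^+ rho * _ in C0 *.
  suff mainC (a1 b1 a2 b2 a0 b0 p : R) :
      p * (a1 * b1) + (1 - p) * (a2 * b2) <= a0 * b0 ->
      p * (C * (a1 * b1)) + (1 - p) * (C * (a2 * b2)) <= C * (a0 * b0).
    apply: mainC; move: C0 => _.
    have [xk|xk] := eqVneq (x n) k; last first.
      by rewrite /= !addn0 -mulrDl addrC subrK mul1r.
    have /andP[p0 p1] := w01 k (visit_count x k n).
    rewrite xk; set p := w k _ in p0 p1 *; set i := visit_count x k n in p p0 p1 *.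
    set j := step_count x k s n.
    have q0 : 0 <= (4 / 3 : R) ^+ (i - M) by rewrite exprn_ge0.
    have h0 : 0 <= (2^-1 : R) ^+ j by rewrite exprn_ge0// invr_ge0.
    have main : (4 / 3 : R) ^+ (i + 1 - M) * (p * 2^-1 + (1 - p)) <= (4 / 3) ^+ (i - M) /\
        (4 / 3 : R) ^+ (i + 1 - M) * (p + (1 - p) * 2^-1) <= (4 / 3) ^+ (i - M).
      have [Mi|iM] := leqP M i.
        have pE : p = 2^-1 by exact: wM.
        by rewrite pE addnC -addnBA// add1n exprS; split; lra.
      have [-> ->] : (i + 1 - M = 0 /\ i - M = 0)%N by lia.
      by rewrite expr0; split; lra.
    have [m1 m2] := (ler_wpM2r h0 main.1, ler_wpM2r h0 main.2).
    case: s1 => sE.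
      have -> : (k + 1 == k + s) = true by rewrite sE eqxx.
      have -> : (k - 1 == k + s) = false by rewrite sE; lia.
      by rewrite /= !addn0 (addn1 j) exprS; move: m1; lra.
    have -> : (k - 1 == k + s) = true by rewrite sE eqxx.
    have -> : (k + 1 == k + s) = false by rewrite sE; lia.
    by rewrite /= !addn0 (addn1 j) exprS; move: m2; lra.
  by move=> h; have := ler_wpM2l C0 h; lra.
- apply: measurable_exists_time => x X n xX.
  by rewrite (visit_count_agree k xX) (step_count_agree k s xX).
- move=> X [t [vt st]] _; exists t => //; rewrite lee_fin.
  have vE : (4 / 3 : R) ^+ v <= (4 / 3) ^+ (visit_count X k t - M).
    by apply: ler_weXn2l; [lra|lia].
  have sE : (2^-1 : R) ^+ rho <= 2^-1 ^+ step_count X k s t.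
    by apply: ler_wiXn2l => //; lra.
  have e1 : 2 ^+ rho * 2^-1 ^+ rho = 1 :> R by rewrite -exprMn mulfV ?expr1n.
  have e2 : (3 / 4) ^+ v * (4 / 3) ^+ v = 1 :> R.
    by rewrite -exprMn (_ : 3 / 4 * (4 / 3) = 1) ?expr1n//; lra.
  have : 1 = (2 ^+ rho * (3 / 4) ^+ v) * ((4 / 3) ^+ v * 2^-1 ^+ rho) :> R.
    by rewrite mulrA -(mulrA (2 ^+ rho)) e2 mulr1 e1.
  move=> {1}->; rewrite ler_wpM2l// ler_pM// ?exprn_ge0//.
Qed.

Lemma infinitely_many_steps (k s : int) (rho : nat) : s = 1 \/ s = -1 ->
  mu.-negligible [set X | (forall v, exists t, (v <= visit_count X k t)%N) /\
    forall t, (step_count X k s t <= rho)%N].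
Proof.
move=> s1.
pose B v : set walk_path := [set X | exists t, (v + M <= visit_count X k t)%N /\
                        (step_count X k s t <= rho)%N].
have mB v : measurable (B v).
  apply: measurable_exists_time => x X n xX.
  by rewrite (visit_count_agree k xX) (step_count_agree k s xX).
have mBB : measurable (\bigcap_v B v) by exact: bigcapT_measurable.
apply: (@negligibleS _ _ _ _ (\bigcap_v B v)).
  move=> X [Xv Xs] v _; have [t vt] := Xv (v + M)%N.
  by exists t; split.
apply/negligibleP => //; apply/eqP; rewrite eq_le measure_ge0 andbT.
have cv : (2 ^+ rho * (3 / 4) ^+ v : R)%:E @[v --> \oo] --> (2 ^+ rho * 0 : R)%:E.
  apply: cvg_EFin; first exact: nearW.
  apply: cvgMr; apply: cvg_expr; rewrite ger0_norm; lra.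
rewrite mulr0 in cv; rewrite -[leRHS](cvg_lim _ cv)//.
apply: lime_ge; first by apply/cvg_ex; eexists; exact: cv.
apply: nearW => v; apply: le_trans (many_visits_few_steps k rho v s1).
by apply: le_measure; rewrite ?inE; [exact: mBB|exact: (mB v)|move=> X; exact].
Qed.

End infinitely_many_steps.

(** * Crossing chains *)

Section crossing_chain.
Context {R : realType}.
Local Open Scope ereal_scope.

(* At site [j], [V j] cookies have been used, with [U j] steps to the right and
   [D j] steps to the left.  [crossing_chain c V U D g len k z] is the expectation
   of [g] at the number of right steps from the last of the sites
   [k, ..., k + len - 1], if [z] left steps are made from site [k] and the walk
   returns each time from the right of each of these sites. *)
Fixpoint crossing_chain (c : nat -> nat -> R) (V U D : nat -> nat)
    (g : nat -> \bar R) (len k z : nat) : \bar R :=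
  if len is l.+1 then
    avg (success_law (c k) (z - D k) (V k))
      (fun y => crossing_chain c V U D g l k.+1 (U k + y))
  else g z.

Variables (c : nat -> nat -> R).
Hypothesis c01 : forall k i, (0 <= c k i <= 1)%R.

Let qge0 k d i y : (0 <= success_law (c k) d i y)%R.
Proof. exact: success_law_ge0. Qed.

Lemma crossing_chain_ge0 V U D g len k z : (forall y, 0 <= g y) ->
  0 <= crossing_chain c V U D g len k z.
Proof.
by move=> g0; elim: len k z => [//|l IHl] k z /=; apply: avg_ge0.
Qed.

Lemma eq_crossing_chain V U D V' U' D' g len k z :
  (forall j, (k <= j)%N -> (j < k + len)%N ->
    [/\ V j = V' j, U j = U' j & D j = D' j]) ->
  crossing_chain c V U D g len k z = crossing_chain c V' U' D' g len k z.
Proof.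
elim: len k z => [//|l IHl] k z e /=.
have [-> -> ->] := e k (leqnn k) ltac:(lia).
apply: eq_avg => y; apply: IHl => j kj jl; apply: e; lia.
Qed.

(** By [D j.+1 < U j] a left step from [j.+1] is still due, for every [j] from [k] to [y - 1]. So
    the trial made at [y] is one of those still averaged over, and resolving it is [avg_successS] at
    that site. *)
Lemma crossing_chain_step V U D g len k y z : (forall y, 0 <= g y) ->
  (k <= y)%N -> (y < k + len)%N -> (D k < z)%N ->
  (forall j, (k <= j)%N -> (j < y)%N -> (D j.+1 < U j)%N) ->
  crossing_chain c V U D g len k z =
  (c y (V y))%:E * crossing_chain c (fun j => V j + (j == y))%N
    (fun j => U j + (j == y))%N D g len k z +
  (1 - c y (V y))%:E * crossing_chain c (fun j => V j + (j == y))%N U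
    (fun j => D j + (j == y))%N g len k z.
Proof.
move=> g0; elim: len k z => [|l IHl] k z ky yl Dz DU /=; first by lia.
have [yk|yk] := eqVneq y k.
  have zD : (z - D k = (z - (D k).+1).+1)%N by lia.
  rewrite {1}zD avg_successS//; last by move=> t; exact: crossing_chain_ge0.
  rewrite yk !addn1 -zD; congr (_ * _ + _ * _).
    apply: eq_avg => t; rewrite addnS addSn; apply: eq_crossing_chain => j kj _.
    by rewrite (_ : (j == k) = false) ?addn0//; lia.
  apply: eq_avg => t; apply: eq_crossing_chain => j kj _.
  by rewrite (_ : (j == k) = false) ?addn0//; lia.
rewrite !addn0.
have /andP[p0 p1] := c01 y (V y).
have p10 : (0 <= 1 - c y (V y))%R by rewrite subr_ge0.
rewrite -!avgZ//; try by move=> t; exact: crossing_chain_ge0.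
rewrite -avgD//; try by move=> t; rewrite mule_ge0 ?lee_fin//;
  exact: crossing_chain_ge0.
apply: eq_avg => t; apply: IHl; try lia.
- by apply: leq_trans (DU k _ _) (leq_addr _ _) => //; lia.
- by move=> j kj jy; apply: DU; lia.
Qed.

Lemma crossing_chain_done V U D g len k : (forall y, 0 <= g y) ->
  (forall j, (k <= j)%N -> (j < k + len)%N -> U j = D j.+1) ->
  crossing_chain c V U D g len.+1 k (D k) = g (U (k + len)%N).
Proof.
move=> g0; elim: len k => [|l IHl] k UD.
  by rewrite /= subnn avg_success0// addn0 addn0.
rewrite [LHS]/= subnn (avg_success0 (c01 k)); last first.
  by move=> y; exact: (@crossing_chain_ge0 _ _ _ _ l.+1).
transitivity (crossing_chain c V U D g l.+1 k.+1 (U k)); first by rewrite addn0.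
rewrite UD//; last by lia.
rewrite (_ : k + l.+1 = k.+1 + l)%N; last by lia.
by apply: IHl => j kj jl; apply: UD; lia.
Qed.

(** A right step already made from the last site remains, whatever the pending trials give, and
    their laws have mass 1. *)
Lemma crossing_chain_pos V U D g len k z M :
  (forall j i, (M <= i)%N -> c j i = 2^-1%R) ->
  (forall y, 0 <= g y) -> (forall y, (0 < y)%N -> 1 <= g y) ->
  (0 < U (k + len)%N)%N -> 1 <= crossing_chain c V U D g len.+1 k z.
Proof.
move=> cM g0 g1; elim: len k z => [|l IHl] k z Uk.
  rewrite /= -[leLHS](avg_success_cst1 (c01 k) (@cM k) (z - D k) (V k)).
  apply: le_avg => // y; apply: g1; rewrite addn0 in Uk; exact: ltn_addr.
rewrite [leRHS]/= -[leLHS](avg_success_cst1 (c01 k) (@cM k) (z - D k) (V k)).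
by apply: le_avg => // y; apply: IHl; rewrite addSnnS.
Qed.

End crossing_chain.

(** * Crossing chains as martingales along the walk *)

Section crossing_events.
Context {R : realType}.
Variables (w : int -> nat -> R) (mu : probability walk_path R) (M : nat).
Hypothesis w01 : forall k i, 0 <= w k i <= 1.
Hypothesis wM : forall k i, (M <= i)%N -> w k i = 2^-1.
Hypothesis muQ : quenched_law 0 (w : env R) mu.
Implicit Types (x X : nat -> int) (n N z : nat).

Let c (j : nat) := w j%:Z.
Let c01 k i : 0 <= c k i <= 1. Proof. exact: w01. Qed.

Variables (g : nat -> \bar R) (N z : nat).
Hypothesis g0 : forall y, (0 <= g y)%E.

Let Phi x n := crossing_chain c (fun j => visit_count x j n)
  (fun j => step_count x j 1 n) (fun j => step_count x j (-1) n) g N.+1 1 z.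

(** Ville's inequality for [Phi], the expectation of [g] at the right steps from site [N.+1] given
    the walk so far. Until the [z]-th left step from 1 it is a martingale: a step made outside the
    sites 1 to [N.+1] leaves it unchanged, a step made inside resolves one trial. *)
Lemma crossing_event (B : set walk_path) : measurable B ->
  (forall X, B X -> is_walk X -> exists2 t, (1 <= Phi X t)%E &
    forall t', (t' < t)%N -> (step_count X 1 (-1) t' < z)%N) ->
  (mu B <= crossing_chain c (fun=> 0%N) (fun=> 0%N) (fun=> 0%N) g N.+1 1 z)%E.
Proof.
move=> mB BP.
have -> : crossing_chain c (fun=> 0%N) (fun=> 0%N) (fun=> 0%N) g N.+1 1 z =
    Phi (fun=> 0) 0%N.
  apply: eq_crossing_chain => j _ _.
  by rewrite /visit_count /step_count !big_ord0.
apply: (ville w01 muQ (Phi := Phi)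
  (A := fun x n => (step_count x 1 (-1) n < z)%N)) => //.
- by move=> x n; exact: crossing_chain_ge0.
- move=> x X n xX; apply: eq_crossing_chain => j _ _.
  by rewrite (visit_count_agree _ xX) !(step_count_agree _ _ xX).
- by move=> x X n xX; rewrite (step_count_agree _ _ xX).
move=> x n wx Az; rewrite visitsE.
set p := w (x n) _.
have p01 : 0 <= p <= 1 by exact: w01.
have [xin|xout] := boolP ((1 <= x n) && (x n <= N.+1%:Z)); last first.
  have e s : Phi (extend x n (x n + s)) n.+1 = Phi x n.
    apply: eq_crossing_chain => j j1 jN.
    rewrite visit_count_extend !step_count_extend.
    have -> : (x n == j%:Z) = false.
      by apply/negbTE; apply: contra xout => /eqP ->; lia.
    by rewrite !addn0.
  rewrite !e -ge0_muleDl ?lee_fin ?subr_ge0; last 2 first.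
  - by case/andP: p01.
  - by case/andP: p01.
  by rewrite -EFinD addrC subrK mul1e.
have [y xy] : exists y : nat, x n = y%:Z.
  by exists `|x n|%N; lia.
have yin : (1 <= y)%N && (y < 1 + N.+1)%N by lia.
have /andP[y1 yN] := yin.
rewrite le_eqVlt; apply/orP; left; apply/eqP; apply/esym.
have -> : p = c y (visit_count x y n) by rewrite /p xy.
rewrite /Phi (crossing_chain_step c01 _ g0 y1 yN)//.
- congr (_ * _ + _ * _)%E; apply: eq_crossing_chain => j _ _;
    rewrite visit_count_extend !step_count_extend xy.
  + have -> : (y%:Z == j%:Z) = (j == y) by lia.
    have [->|jy] := eqVneq j y.
      by rewrite eqxx /= (_ : (y%:Z + 1 == y%:Z - 1) = false) ?addn0//; lia.
    by rewrite !addn0.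
  + have -> : (y%:Z == j%:Z) = (j == y) by lia.
    have [->|jy] := eqVneq j y.
      by rewrite eqxx /= (_ : (y%:Z - 1 == y%:Z + 1) = false) ?addn0//; lia.
    by rewrite !addn0.
- move=> j j1 jy; rewrite (flow wx)//.
  have -> : (j%:Z + 1 <= x n) by rewrite xy; lia.
  by rewrite addn1 ltnS (_ : j%:Z + 1 = j.+1%:Z)//; lia.
Qed.

End crossing_events.

(** * Averaging crossing chains over the environment *)

Section countable_partition.
Context {R : realType} d (Om : measurableType d).
Variable P : {measure set Om -> \bar R}.
Local Open Scope ereal_scope.

Lemma countable_code (T : choiceType) : countable [set: T] ->
  exists code : T -> nat, injective code.
Proof.
move=> /countable_injP[code inj]; exists code => x y xy.
by apply: inj xy; rewrite inE.
Qed.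

Lemma countable_bigcup_measurable (T : choiceType) (A : T -> set Om) :
  countable [set: T] -> (forall t, measurable (A t)) -> measurable (\bigcup_t A t).
Proof. by move=> cT mA; exact: countable_bigcupT_measurable. Qed.

Lemma integral_countable_bigcup (T : choiceType) (A : T -> set Om)
    (f : Om -> \bar R) : countable [set: T] -> (forall t, measurable (A t)) ->
  trivIset setT A -> measurable_fun setT f -> (forall o, 0 <= f o) ->
  \int[P]_(o in \bigcup_t A t) f o = \esum_(t in setT) \int[P]_(o in A t) f o.
Proof.
move=> cT mA tA mf f0.
have [code cinj] := countable_code cT.
pose F i : set Om := \bigcup_(t in [set t | code t = i]) A t.
have FE t : F (code t) = A t.
  apply/seteqP; split=> o; first by move=> [t' /cinj ->].
  by move=> Ao; exists t.
have F0 i : (forall t, code t <> i) -> F i = set0.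
  by move=> ni; apply/seteqP; split=> // o [t /ni].
have mF i : measurable (F i).
  have [[t <-]|/forallNP ni] := pselect (exists t, code t = i).
    by rewrite FE; exact: mA.
  by rewrite (F0 i ni); exact: measurable0.
have -> : \bigcup_t A t = \bigcup_i F i.
  apply/seteqP; split=> o.
    by move=> [t _ At]; exists (code t) => //; rewrite FE.
  by move=> [i _ [t _ At]]; exists t.
rewrite ge0_integral_bigcup//; last 2 first.
- exact: measurable_funTS.
- apply/trivIsetP => i j _ _ ij; apply/seteqP; split=> // o [[t ti At] [t' tj At']].
  have tt' : t = t' by apply: (tA t t') => //; exists o.
  by move: ij; rewrite -ti -tj tt' eqxx.
rewrite nneseries_esumT; last by move=> i; exact: integral_ge0.
rewrite (esumID (range code)); last by move=> i _; exact: integral_ge0.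
rewrite setTI [X in _ + X]esum1 ?adde0; last first.
  move=> i [_ /= ni]; rewrite F0 ?integral_set0// => t ti.
  by apply: ni; exists t.
rewrite esum_image; first by apply: eq_esum => t _; rewrite FE.
by move=> x y _ _; exact: cinj.
Qed.

End countable_partition.

Section crossing_chain_theory.
Context {R : realType}.
Local Open Scope ereal_scope.
Variable c : nat -> nat -> R.
Hypothesis c01 : forall k i, (0 <= c k i <= 1)%R.
Variables V U D : nat -> nat.

Let qge0 k d i y : (0 <= success_law (c k) d i y)%R.
Proof. exact: success_law_ge0. Qed.

Lemma crossing_chain_rcons g len k z :
  crossing_chain c V U D g len.+1 k z =
  crossing_chain c V U D (fun z => avg (success_law (c (k + len)%N)
    (z - D (k + len)%N) (V (k + len)%N)) (fun y => g (U (k + len) + y)%N)) len k z.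
Proof.
elim: len k z => [|l IHl] k z; first by rewrite /= addn0.
rewrite [LHS]/= [RHS]/=; apply: eq_avg => y.
by rewrite -/(crossing_chain c V U D g l.+1 k.+1 (U k + y)) IHl addSnnS.
Qed.

Lemma avg_crossing_chain (T : choiceType) (p : T -> R) (g : T -> nat -> \bar R) len k z :
  (forall t, (0 <= p t)%R) -> (forall t y, 0 <= g t y) ->
  avg p (fun t => crossing_chain c V U D (g t) len k z) =
  crossing_chain c V U D (fun y => avg p (g ^~ y)) len k z.
Proof.
move=> p0 g0; elim: len k z => [//|l IHl] k z /=.
rewrite avg_swap//; last by move=> t y; exact: crossing_chain_ge0.
by apply: eq_avg => y; exact: IHl.
Qed.

End crossing_chain_theory.

Lemma eq_crossing_chain_stacks {R : realType} (c c' : nat -> nat -> R) V U D g len k z :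
  (forall j, (k <= j)%N -> (j < k + len)%N -> c j = c' j) ->
  crossing_chain c V U D g len k z = crossing_chain c' V U D g len k z.
Proof.
elim: len k z => [//|l IHl] k z e /=.
have -> : c k = c' k by apply: e; lia.
by apply: eq_avg => y; apply: IHl => j kj jl; apply: e; lia.
Qed.

(** * From quenched crossing chains to the branching process *)

Section averaged_chain.
Context {R : realType} d (Om : measurableType d) (P : probability Om R).
Context (T : Type) (S : choiceType) (v : S -> T).
Variables (K : S -> S -> R) (Y : nat -> Om -> T) (c : S -> nat -> R).
Hypothesis v_inj : injective v.
Hypothesis Kdist : transition_matrix K.
Hypothesis cS : countable [set: S].
Hypothesis mY : forall k (s : S), measurable [set o | Y k o = v s].
Hypothesis markov : forall n (s : nat -> S),
  (P [set o | forall k, (k <= n.+1)%N -> Y k o = v (s k)] =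
   P [set o | forall k, (k <= n)%N -> Y k o = v (s k)] * (K (s n) (s n.+1))%:E)%E.
Hypothesis c01 : forall s i, 0 <= c s i <= 1.

Let K0 s s' : 0 <= K s s'. Proof. by have [] := Kdist s. Qed.
Let K1 s : (\esum_(s' in setT) (K s s')%:E = 1)%E.
Proof. by have [] := Kdist s. Qed.

Local Notation step := (branching_step K c).

Definition env_cylinder (s : nat -> S) n : set Om :=
  [set o | forall k, (k <= n)%N -> Y k o = v (s k)].

Lemma measurable_env_cylinder s n : measurable (env_cylinder s n).
Proof.
have -> : env_cylinder s n = \bigcap_(k in `I_n.+1) [set o | Y k o = v (s k)].
  by apply/seteqP; split=> o h k; apply: h.
by apply: bigcap_measurable => //; exists 0%N.
Qed.

Let next (s : nat -> S) n (s' : S) : nat -> S := fun k => if (k <= n)%N then s k else s'.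

Let next_cylinder s n s' : env_cylinder (next s n s') n.+1 =
  env_cylinder s n `&` [set o | Y n.+1 o = v s'].
Proof.
apply/seteqP; split=> o /=.
  move=> h; split; last by have := h n.+1 (leqnn _); rewrite /next ltnn.
  by move=> k kn; have := h k (leqW kn); rewrite /next kn.
move=> [h e] k; rewrite leq_eqVlt => /predU1P[->|]; first by rewrite /next ltnn.
by rewrite ltnS => kn; rewrite /next kn; exact: h.
Qed.

Let prob_next s n s' : P (env_cylinder (next s n s') n.+1) =
  (P (env_cylinder s n) * (K (s n) s')%:E)%E.
Proof.
have := markov n (next s n s').
rewrite -/(env_cylinder (next s n s') n.+1) -/(env_cylinder (next s n s') n).
rewrite /next leqnn ltnn => ->; congr (_ * _)%E; congr (P _).
by apply/seteqP; split=> o h k kn; have := h k kn; rewrite /next kn.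
Qed.

Let split_cylinder (f : Om -> \bar R) s n : measurable_fun setT f ->
  (forall o, 0 <= f o)%E ->
  (\int[P]_(o in env_cylinder s n) f o =
   \esum_(s' in [set: S]) \int[P]_(o in env_cylinder (next s n s') n.+1) f o)%E.
Proof.
move=> mf f0.
pose C s' := env_cylinder (next s n s') n.+1.
have mC s' : measurable (C s') by exact: measurable_env_cylinder.
have tC : trivIset setT C.
  move=> s1 s2 ? ? [x []]; rewrite /C !next_cylinder => -[? /= e1] [? /= e2].
  by apply: v_inj; exact: etrans (esym e1) e2.
have sub : \bigcup_s' C s' `<=` env_cylinder s n.
  by move=> o [s' _]; rewrite /C next_cylinder => -[].
have mU : measurable (\bigcup_s' C s') by exact: countable_bigcup_measurable.
have mcyl := measurable_env_cylinder s n.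
have PU : P (\bigcup_s' C s') = P (env_cylinder s n).
  have eP A : measurable A -> P A = (\int[P]_(o in A) (cst 1 o))%E.
    by move=> mA; rewrite integral_cst// mul1e.
  rewrite eP// integral_countable_bigcup//.
  transitivity (\esum_(s' in [set: S]) (P (env_cylinder s n) * (K (s n) s')%:E))%E.
    by apply: eq_esum => s' _; rewrite -eP// /C prob_next.
  have /fineK <- : P (env_cylinder s n) \is a fin_num by exact: fin_num_measure.
  rewrite esum_mull ?fine_ge0//; last by move=> s'; rewrite lee_fin.
    by rewrite K1 mule1.
have restE : P (env_cylinder s n `\` \bigcup_s' C s') = 0%E.
  have -> : (P (env_cylinder s n `\` \bigcup_s' C s') =
      P (env_cylinder s n) - P (env_cylinder s n `&` \bigcup_s' C s'))%E.
    apply: measureD => //.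
    by rewrite -ge0_fin_numE// fin_num_measure.
  by rewrite (setIidr sub) PU subee// fin_num_measure.
rewrite -(integral_countable_bigcup P cS mC tC mf f0).
have mrest : measurable (env_cylinder s n `\` \bigcup_s' C s').
  exact: measurableD.
have f0' o : env_cylinder s n o -> (0 <= f o)%E by [].
rewrite (ge0_negligible_integral mrest mcyl (measurable_funTS mf) f0' restE).
by rewrite setDD (setIidr sub).
Qed.

(** Stacks are summed out from the last site to the first: given the stacks up to site [k], the next
    one is averaged by [K], and the last link of the chain becomes one application of
    [branching_step]. Site 0 only provides the initial state, the chain running over the sites 1 to
    [N]. *)
Lemma integral_le_branching (f : Om -> \bar R) (g : nat -> \bar R) N z :
  measurable_fun setT f -> (forall o, 0 <= f o)%E -> (forall y, 0 <= g y)%E ->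
  (forall s o, env_cylinder s N o -> (f o <= crossing_chain (fun j => c (s j))
    (fun=> 0%N) (fun=> 0%N) (fun=> 0%N) g N 1 z)%E) ->
  forall s0, (\int[P]_(o in [set o | Y 0 o = v s0]) f o <=
    P [set o | Y 0 o = v s0] * iter N step (fun z _ => g z) z s0)%E.
Proof.
move=> mf f0 g0 fg s0.
have iter0 n y s : (0 <= iter n step (fun z _ => g z) y s)%E.
  elim: n y s => [|n IHn] y s; first exact: g0.
  by apply: (branching_step_ge0 K0 c01) => *; exact: IHn.
pose chain s G k := crossing_chain (fun j => c (s j))
    (fun=> 0%N) (fun=> 0%N) (fun=> 0%N) G k 1 z.
have claim j : (j <= N)%N -> forall s,
    (\int[P]_(o in env_cylinder s (N - j)) f o <= P (env_cylinder s (N - j)) *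
     chain s (fun y => iter j step (fun z _ => g z) y (s (N - j)%N)) (N - j)%N)%E.
  elim: j => [|j IHj] jN s.
    rewrite subn0 /= muleC -integral_cst; last exact: measurable_env_cylinder.
    apply: ge0_le_integral => //.
    - exact: measurable_env_cylinder.
    - exact: measurable_funTS.
    - by move=> o; exact: fg.
  set k := (N - j.+1)%N; have kE : (N - j = k.+1)%N by rewrite /k; lia.
  rewrite split_cylinder//; rewrite kE in IHj.
  apply: (@le_trans _ _ (\esum_(s' in [set: S]) (P (env_cylinder s k) *
     ((K (s k) s')%:E * chain s (fun y => avg (success_law (c s') y 0)
       (fun t => iter j step (fun z _ => g z) t s')) k)))%E).
    apply: le_esum => s' _; apply: le_trans (IHj (ltnW jN) (next s k s')) _.
    rewrite prob_next /chain crossing_chain_rcons muleA.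
    rewrite le_eqVlt; apply/orP; left; apply/eqP; congr (_ * _)%E.
    rewrite add1n /next ltnn.
    transitivity (crossing_chain (fun j => c (if (j <= k)%N then s j else s'))
      (fun=> 0%N) (fun=> 0%N) (fun=> 0%N) (fun z0 => avg (success_law (c s') z0 0)
       (fun t => iter j step (fun z _ => g z) t s')) k 1 z).
      by congr crossing_chain; apply/funext => y; rewrite subn0.
    apply: eq_crossing_chain_stacks => i i1 ik.
    by have -> : (i <= k)%N by lia.
  have /fineK <- : P (env_cylinder s k) \is a fin_num.
    by apply: fin_num_measure; exact: measurable_env_cylinder.
  have q0 s' d' i y : 0 <= success_law (c s') d' i y by exact: success_law_ge0.
  have a0 s' y : (0 <= avg (success_law (c s') y 0)
       (fun t => iter j step (fun z _ => g z) t s'))%E by exact: avg_ge0.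
  rewrite esum_mull ?fine_ge0//; last first.
    by move=> s'; rewrite mule_ge0 ?lee_fin//; exact: crossing_chain_ge0.
  rewrite -/(avg (K (s k)) (fun s' => chain s (fun y => avg (success_law (c s') y 0)
       (fun t => iter j step (fun z _ => g z) t s')) k)).
  by rewrite /chain avg_crossing_chain.
have := claim N (leqnn _) (fun=> s0); rewrite subnn /=.
have -> // : env_cylinder (fun=> s0) 0 = [set o | Y 0 o = v s0].
apply/seteqP; split=> o /= h; first exact: h.
by move=> k; rewrite leqn0 => /eqP ->.
Qed.

End averaged_chain.

(** * Long-time behaviour of walks *)

Section walks.
Implicit Types (X : nat -> int) (k s : int).

Definition infinitely_often X k := forall T, exists2 t, (T <= t)%N & X t = k.

Lemma is_walk_step X : is_walk X -> forall n, X n.+1 = X n + 1 \/ X n.+1 = X n - 1.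
Proof. by move=> wX n; exact: (wX n.+1).2. Qed.

Lemma walk_le_time X n : is_walk X -> X n <= n%:Z.
Proof.
move=> wX; elim: n => [|n IHn]; first by rewrite (wX 0%N).1.
by have [|] := is_walk_step wX n => ->; lia.
Qed.

Lemma walk_hits X k T : is_walk X -> 0 < k -> k <= X T -> exists t, X t = k.
Proof.
move=> wX k0 kT; have ex : exists t, k <= X t by exists T.
case: (ex_minnP ex) => [[|t]]; first by rewrite (wX 0%N).1; lia.
move=> kt tmin; exists t.+1; have tk : X t < k.
  by rewrite ltNge; apply/negP => /tmin; rewrite ltnn.
by move: kt tk; have [|] := is_walk_step wX t => ->; lia.
Qed.

Lemma step_count_le_time X k s T : (forall t, (T <= t)%N -> X t.+1 != k + s) ->
  forall n, (step_count X k s n <= T)%N.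
Proof.
move=> XT n; suff : (step_count X k s n <= minn n T)%N.
  by move=> h; apply: leq_trans h (geq_minr _ _).
elim: n => [|n IHn]; first by rewrite /step_count big_ord0.
rewrite step_countS; have [Tn|nT] := leqP T n.
  by rewrite (negPf (XT n Tn)) andbF addn0; lia.
by case: (_ && _); rewrite ?addn0 ?addn1; lia.
Qed.

(** After a visit to 1, the first time at a site [<= 0] is reached by a step from 1 to 0. *)
Lemma step_count_unbounded X z : is_walk X -> infinitely_often X 0 ->
  infinitely_often X 1 -> exists t, (z <= step_count X 1 (-1) t)%N.
Proof.
move=> wX io0 io1; elim: z => [|z [t zt]]; first by exists 0%N.
have [t1 tt1 Xt1] := io1 t; have [t2 t12 Xt2] := io0 t1.
have ex : exists j, (t1 <= j)%N && (X j <= 0) by exists t2; rewrite t12 Xt2.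
case: (ex_minnP ex) => [[|j]] /andP[t1j Xj] jmin.
  by move: t1j Xj; rewrite leqn0 => /eqP t10; rewrite -t10 Xt1; lia.
have t1j' : (t1 <= j)%N.
  move: t1j; rewrite leq_eqVlt => /predU1P[e|//].
  by move: Xj; rewrite -e Xt1; lia.
have Xj1 : 1 <= X j.
  rewrite -gtz0_ge1 ltNge; apply/negP => Xj0.
  by have := jmin j; rewrite t1j' Xj0 ltnn => /(_ isT).
exists j.+1; rewrite step_countS.
have [e1 e2] : X j = 1 /\ X j.+1 = 0.
  by move: Xj Xj1; have [|] := is_walk_step wX j => ->; lia.
rewrite e1 e2 /= addn1 ltnS; apply: leq_trans zt _; apply: step_count_le.
exact: leq_trans tt1 t1j'.
Qed.

Lemma visit_count_unbounded X k : infinitely_often X k ->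
  forall v, exists t, (v <= visit_count X k t)%N.
Proof.
move=> io; elim=> [|v [t vt]]; first by exists 0%N.
have [t1 tt1 Xt1] := io t; exists t1.+1; rewrite visit_countS Xt1 eqxx addn1 ltnS.
apply: leq_trans vt _; move: tt1 => /subnK <-.
elim: (t1 - t)%N => [//|d IHd]; rewrite addSn visit_countS.
exact: leq_trans IHd (leq_addr _ _).
Qed.

Lemma infinitely_often0E X : returns_infinitely_often X <-> infinitely_often X 0.
Proof.
split=> [iX T|io fX].
  apply: contrapT => nT; apply: iX; apply: (sub_finite_set _ (finite_II T)).
  move=> n /= Xn; rewrite ltnNge; apply/negP => Tn; apply: nT.
  by exists n.
have [t tN Xt] := io (\max_(n <- finmap.enum_fset (fset_set [set n | X n = 0])) n).+1.
have tX : t \in (fset_set [set n | X n = 0] : seq nat).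
  by rewrite in_fset_set// inE.
by have := @leq_bigmax_seq _ _ xpredT (fun n => n) t tX isT; rewrite leqNgt tN.
Qed.

(** Collects what is almost sure for the quenched walk; the long-time behaviour is then derived path
    by path. *)
Definition regular X := is_walk X /\ forall k s, s = 1 \/ s = -1 ->
  infinitely_often X k -> infinitely_often X (k + s).

Lemma regular_infinitely_often X k l : regular X ->
  infinitely_often X k -> infinitely_often X l.
Proof.
move=> [_ reg] io.
have up n : infinitely_often X (k + n%:Z).
  elim: n => [|n IHn]; first by rewrite addr0.
  by rewrite (_ : k + n.+1%:Z = k + n%:Z + 1); [apply: reg => //; left|lia].
have dn n : infinitely_often X (k - n%:Z).
  elim: n => [|n IHn]; first by rewrite subr0.
  by rewrite (_ : k - n.+1%:Z = k - n%:Z + -1); [apply: reg => //; right|lia].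
have [kl|lk] := lerP k l.
  by rewrite (_ : l = k + `|l - k|%N%:Z)//; lia.
by rewrite (_ : l = k - `|k - l|%N%:Z)//; lia.
Qed.

Lemma regular_trichotomy X : regular X ->
  [\/ returns_infinitely_often X, tends_to_pinfty X | tends_to_ninfty X].
Proof.
move=> reg; have wX := reg.1; have stepX := is_walk_step wX.
have [io0|nio0] := pselect (infinitely_often X 0).
  by apply: Or31; apply/infinitely_often0E.
have fin k : exists T, forall t, (T <= t)%N -> X t != k.
  have : ~ infinitely_often X k.
    by move=> io; apply: nio0; exact: regular_infinitely_often io.
  move=> /existsNP[T nT]; exists T => t Tt; apply/eqP => Xt.
  by apply: nT; exists t.
have [T0 X0] := fin 0.
have [pos|neg] : (forall t, (T0 <= t)%N -> 0 < X t) \/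
    (forall t, (T0 <= t)%N -> X t < 0).
  have [p|n] := ltrP 0 (X T0); [left|right] => t /subnK <-;
    elim: (t - T0)%N => [|d IHd].
  - by rewrite add0n.
  - rewrite addSn; have := X0 (d + T0).+1 ltac:(lia); move: IHd.
    by have [|] := stepX (d + T0)%N => ->; lia.
  - by rewrite add0n; have := X0 T0 (leqnn _); move: n; lia.
  - rewrite addSn; have := X0 (d + T0).+1 ltac:(lia); move: IHd.
    by have [|] := stepX (d + T0)%N => ->; lia.
- apply: Or32 => z.
  have claim (n : nat) : exists T, forall t, (T <= t)%N -> n%:Z < X t.
    elim: n => [|n [T IHn]]; first by exists T0.
    have [T1 XT1] := fin n.+1%:Z; exists (maxn T T1) => t.
    rewrite geq_max => /andP[Tt T1t].
    by have := IHn t Tt; have := XT1 t T1t; lia.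
  have [T TP] := claim `|z|%N.
  by exists T => // t /= /TP; lia.
apply: Or33 => z.
have claim (n : nat) : exists T, forall t, (T <= t)%N -> X t < - n%:Z.
  elim: n => [|n [T IHn]]; first by exists T0; rewrite oppr0.
  have [T1 XT1] := fin (- n.+1%:Z); exists (maxn T T1) => t.
  rewrite geq_max => /andP[Tt T1t].
  by have := IHn t Tt; have := XT1 t T1t; lia.
have [T TP] := claim `|z|%N.
by exists T => // t /= /TP; lia.
Qed.

(** Finite-range versions of escape and, below, of return: [N.+2] is the first level beyond the
    [N.+1] sites of the crossing chain, so finitely many stacks govern both events. *)
Definition escapes (z N : nat) : set walk_path :=
  [set X | exists t, X t = N.+2%:Z /\ (step_count X 1 (-1) t < z)%N].

Definition comes_back (z N : nat) : set walk_path :=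
  [set X | exists t, (z <= step_count X 1 (-1) t)%N /\
     forall t', (t' <= t)%N -> X t' < N.+2%:Z].

Lemma measurable_escapes z N : measurable (escapes z N).
Proof.
apply: measurable_exists_time => x X n xX.
by rewrite (step_count_agree _ _ xX) xX.
Qed.

Lemma measurable_comes_back z N : measurable (comes_back z N).
Proof.
apply: measurable_exists_time => x X n xX.
rewrite (step_count_agree _ _ xX) => -[zn xN]; split=> // t' t'n.
by rewrite xX//; exact: xN.
Qed.

Lemma pinfty_escapes X : is_walk X -> tends_to_pinfty X ->
  exists z, forall N, escapes z N X.
Proof.
move=> wX Xinf; have [T _ T2] := Xinf 2.
exists T.+1 => N; have [T' _ TN] := Xinf N.+2%:Z.
have [t Xt] := walk_hits wX (isT : 0 < N.+2%:Z) (TN T' (leqnn T')).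
exists t; split=> //; rewrite ltnS; apply: step_count_le_time => t' Tt'.
by have := T2 t'.+1 (leqW Tt'); rewrite /=; lia.
Qed.

Lemma regular_comes_back X : regular X -> returns_infinitely_often X ->
  forall z, exists N, comes_back z N X.
Proof.
move=> reg /infinitely_often0E io0 z; have wX := reg.1.
have io1 := regular_infinitely_often 1 reg io0.
have [t zt] := step_count_unbounded z wX io0 io1.
exists t, t; split=> // t' t't; have := walk_le_time t' wX; lia.
Qed.

Lemma comes_back_homo z m n : (m <= n)%N -> comes_back z m `<=` comes_back z n.
Proof.
move=> mn X [t [zt Xt]]; exists t; split=> // t' t't; have := Xt t' t't; lia.
Qed.

End walks.

Section quenched_probabilities.
Context {R : realType}.
Variables (w : int -> nat -> R) (mu : probability walk_path R) (M : nat).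
Hypothesis w01 : forall k i, 0 <= w k i <= 1.
Hypothesis wM : forall k i, (M <= i)%N -> w k i = 2^-1.
Hypothesis muQ : quenched_law 0 (w : env R) mu.

Local Notation chain g N z := (crossing_chain (fun j => w j%:Z)
  (fun=> 0%N) (fun=> 0%N) (fun=> 0%N) g N 1 z).

Lemma measure_escapes z N :
  (mu (escapes z N) <= chain (fun y => (0 < y)%N%:R%:E) N.+1 z)%E.
Proof.
apply: crossing_event => //; first exact: measurable_escapes.
move=> X [t [Xt tz]] wX; exists t; last first.
  by move=> t' t't; apply: leq_ltn_trans tz; apply: step_count_le; exact: ltnW.
apply: (@crossing_chain_pos _ _ _ _ _ _ _ _ _ _ M) => //.
- by move=> j i; exact: wM.
- by move=> y y0; rewrite y0.
- have := @flow X t (1 + N)%N (wX t) isT.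
  rewrite Xt (_ : (1 + N)%N%:Z + 1 <= N.+2%:Z) ?addn1; last by lia.
  by move=> ->.
Qed.

(** At the time of the [z]-th left step from 1 the walk is at 0, so all right crossings are matched,
    and none was made from [N.+1] as [N.+2] has not been reached. *)
Lemma measure_comes_back z N : (0 < z)%N ->
  (mu (comes_back z N) <= chain (fun y => (y == 0)%N%:R%:E) N.+1 z)%E.
Proof.
move=> z0; apply: crossing_event => //; first exact: measurable_comes_back.
move=> X [t [zt Xt]] wX.
have ex : exists t, (z <= step_count X 1 (-1) t)%N by exists t.
case: (ex_minnP ex) => [[|t1]]; first by rewrite /step_count big_ord0; lia.
move=> zt1 t1min.
have before t' : (t' < t1.+1)%N -> (step_count X 1 (-1) t' < z)%N.
  by move=> t't1; rewrite ltnNge; apply/negP => /t1min; rewrite leqNgt t't1.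
exists t1.+1 => //.
have [zE Xt1] : z = step_count X 1 (-1) t1.+1 /\ X t1.+1 = 0.
  have := before t1 (ltnSn _); move: zt1; rewrite step_countS.
  by case: (boolP (_ && _)) => [/andP[_ /eqP ->]|_]; rewrite ?addn0 ?addn1; split; lia.
have t1t : (t1.+1 <= t)%N by exact: t1min.
rewrite [X in crossing_chain _ _ _ _ _ _ _ X]zE.
rewrite (crossing_chain_done (c := fun j => w j%:Z) _ _
  (D := fun j => step_count X j (-1) t1.+1))//.
- rewrite (_ : step_count X (1 + N)%N 1 t1.+1 = 0)%N// /step_count big1// => i _.
  have := Xt i.+1 (leq_trans (ltn_ord i) t1t).
  case: eqP => //= _; case: eqP => // ->; lia.
- move=> j j1 jN; rewrite (flow (wX _))// Xt1.
  rewrite (_ : (j%:Z + 1 <= 0) = false) ?addn0; last by lia.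
  by rewrite (_ : j%:Z + 1 = j.+1%:Z)//; lia.
Qed.

(** At an irregular pair of neighbours, the steps from the first site to the second are bounded in
    number by some [T]; the pairs of a site and a bound are countable. *)
Lemma negligible_irregular : mu.-negligible (~` [set X : walk_path | regular X]).
Proof.
pose D (p : int * nat) s : set walk_path :=
  [set X | (forall v, exists t, (v <= visit_count X p.1 t)%N) /\
    forall t, (step_count X p.1 s t <= p.2)%N].
pose F i := if (choice.unpickle i : option (int * nat)) is Some p
  then D p 1 `|` D p (-1) else set0.
apply: (@negligibleS _ _ _ _ (~` is_walk `|` \bigcup_i F i)).
  move=> X /= nreg; have [wX|] := pselect (is_walk X); last by left.
  right; apply: contrapT => nF; apply: nreg; split=> // k s s1 io T.
  apply: contrapT => nT; apply: nF.
  have XT t : (T <= t)%N -> X t.+1 != k + s.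
    by move=> Tt; apply/eqP => Xt; apply: nT; exists t.+1 => //; exact: leqW.
  exists (choice.pickle (k, T)) => //; rewrite /F choice.pickleK.
  have DX : D (k, T) s X.
    by split=> /=; [exact: visit_count_unbounded|exact: step_count_le_time].
  by case: s1 DX => ->; [left|right].
apply: negligibleU.
  apply/negligibleP; first by apply: measurableC; exact: measurable_is_walk.
  exact: (quenched_is_walk muQ).
apply: negligible_bigcup => i; rewrite /F; case: (choice.unpickle i) => [p|]; last first.
  exact: negligible_set0.
by apply: negligibleU; apply: (infinitely_many_steps w01 wM) => //; [left|right].
Qed.

End quenched_probabilities.

(** * One half of the environment *)

Lemma integral0_ae {R : realType} d (Om : measurableType d) (P : probability Om R)
    (S : choiceType) (A : S -> set Om) (f : Om -> \bar R) :
  countable [set: S] -> (forall s, measurable (A s)) -> trivIset setT A ->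
  P (\bigcup_s A s) = 1%E -> measurable_fun setT f -> (forall o, 0 <= f o)%E ->
  (forall s, (\int[P]_(o in A s) f o = 0)%E) ->
  {ae P, forall o, f o = 0%E}.
Proof.
move=> cS mA tA PA mf f0 If0.
have mU : measurable (\bigcup_s A s) by exact: countable_bigcup_measurable.
have PC : P (~` \bigcup_s A s) = 0%E.
  have : (P (~` \bigcup_s A s) = 1 - P (\bigcup_s A s))%E by exact: probability_setC.
  by rewrite PA subee.
have IT : (\int[P]_(o in setT) f o = 0)%E.
  rewrite (ge0_negligible_integral _ _ mf _ PC)//; last exact: measurableC.
  rewrite setTD setCK (integral_countable_bigcup P cS mA tA mf f0).
  by rewrite esum1.
have : (\int[P]_(o in setT) `|f o| = 0)%E.
  by rewrite -[RHS]IT; apply: eq_integral => o _; rewrite gee0_abs.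
move=> /(ae_eq_integral_abs P measurableT mf); apply: filterS => o; exact.
Qed.

Lemma measurable_tends_to_pinfty : measurable tends_to_pinfty.
Proof.
rewrite (_ : tends_to_pinfty = \bigcap_(n : nat) \bigcup_T \bigcap_t
    [set X : walk_path | (T <= t)%N -> n%:Z <= X t]).
  apply: bigcapT_measurable => n; apply: bigcupT_measurable => T.
  apply: bigcapT_measurable => t; apply: (@measurable_finitary t) => x X xX /=.
  by rewrite xX.
apply/seteqP; split=> X.
  by move=> h n _; have [T _ TP] := h n%:Z; exists T => // t _ Tt; exact: TP.
move=> h z; have [T _ TP] := h `|z|%N I; exists T => // t /= Tt.
by have := TP t I Tt; lia.
Qed.

Lemma measurable_tends_to_ninfty : measurable tends_to_ninfty.
Proof.
rewrite (_ : tends_to_ninfty = \bigcap_(n : nat) \bigcup_T \bigcap_t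
    [set X : walk_path | (T <= t)%N -> X t <= - n%:Z]).
  apply: bigcapT_measurable => n; apply: bigcupT_measurable => T.
  apply: bigcapT_measurable => t; apply: (@measurable_finitary t) => x X xX /=.
  by rewrite xX.
apply/seteqP; split=> X.
  by move=> h n _; have [T _ TP] := h (- n%:Z); exists T => // t _ Tt; exact: TP.
move=> h z; have [T _ TP] := h `|z|%N I; exists T => // t /= Tt.
by have := TP t I Tt; lia.
Qed.

Lemma measurable_returns_infinitely_often : measurable returns_infinitely_often.
Proof.
rewrite (_ : returns_infinitely_often = \bigcap_T \bigcup_t
    [set X : walk_path | (T <= t)%N /\ X t = 0]).
  apply: bigcapT_measurable => T; apply: bigcupT_measurable => t.
  by apply: (@measurable_finitary t) => x X xX /=; rewrite xX.
apply/seteqP; split=> X.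
  by move=> /infinitely_often0E h T _; have [t Tt Xt] := h T; exists t.
by move=> h; apply/infinitely_often0E => T; have [t _ [Tt Xt]] := h T I; exists t.
Qed.

Section half_line.
Context {R : realType} (M : nat) (S : choiceType).
Variables (v : S -> cookie_stack R) (K : S -> S -> R) (pi : S -> R).
Variables (c : S -> nat -> R) (P : probability (env R) R).
Variables (Y : nat -> env R -> cookie_stack R).
Variables (mu : env R -> probability walk_path R) (W : env R -> int -> nat -> R).
Variables (Good : set (env R)) (dlt : R).

Hypothesis v_inj : injective v.
Hypothesis cS : countable [set: S].
Hypothesis Kdist : transition_matrix K.
Hypothesis pi_dist : is_distribution pi.
Hypothesis ue : uniformly_ergodic K pi.
Hypothesis mY : forall k (s : S), measurable [set o | Y k o = v s].
Hypothesis markov : forall n (s : nat -> S),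
  (P [set o | forall k, (k <= n.+1)%N -> Y k o = v (s k)] =
   P [set o | forall k, (k <= n)%N -> Y k o = v (s k)] * (K (s n) (s n.+1))%:E)%E.
Hypothesis coverY : P (\bigcup_s [set o | Y 0 o = v s]) = 1%E.
Hypothesis c01 : forall s i, 0 < c s i < 1.
Hypothesis cM : forall s i, (M <= i)%N -> c s i = 2^-1.
Hypothesis mGood : measurable Good.
Hypothesis W01 : forall o, Good o -> forall k i, 0 <= W o k i <= 1.
Hypothesis WM : forall o, Good o -> forall k i, (M <= i)%N -> W o k i = 2^-1.
Hypothesis WY : forall o, Good o ->
  forall k s, Y k o = v s -> W o k%:Z = c s.
Hypothesis muQ : forall o, Good o -> quenched_law 0 (W o : env R) (mu o).
Hypothesis mmu : forall B, measurable B -> measurable_fun setT (fun o => mu o B).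
Hypothesis mean_drift :
  avg pi (fun s => (\sum_(i < M) 2 * c s i)%:E) = (dlt + M%:R)%:E.

Let K0 s s' : 0 <= K s s'. Proof. by have [] := Kdist s. Qed.
Let K1 s : (\esum_(s' in setT) (K s s')%:E = 1)%E.
Proof. by have [] := Kdist s. Qed.
Let c01w s i : 0 <= c s i <= 1.
Proof. by have /andP[/ltW -> /ltW ->] := c01 s i. Qed.

Local Notation T := (branching_step K c).

Lemma half_line_poisson : exists (h : S -> R) (H : R),
  [/\ 0 <= H, forall s, 0 <= h s, forall s, h s <= H &
    forall s, avg (K s) (fun s' => (\sum_(i < M) (2 * c s' i - 1) + M%:R + h s')%:E)
      = (h s + dlt + M%:R)%:E].
Proof.
have gb s : 0 <= \sum_(i < M) 2 * c s i <= \sum_(i < M) 2.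
  apply/andP; split; first by apply: sumr_ge0 => i _; have /andP[] := c01w s i; lra.
  by apply: ler_sum => i _; have /andP[] := c01w s i; lra.
have [h [H [H0 h0 hH hP]]] := poisson_corrector Kdist pi_dist ue gb mean_drift.
exists h, H; split=> // s; rewrite -addrA -hP; apply: eq_avg => s'.
by congr (_%:E); rewrite sumrB sumr_const card_ord subrK.
Qed.

(** The quenched probability, set to 0 outside [Good] so that the quenched bounds hold for every
    environment. *)
Let fB B o : \bar R := ((\1_Good o)%:E * mu o B)%E.

Let fB_ge0 B o : (0 <= fB B o)%E.
Proof. by rewrite mule_ge0// lee_fin. Qed.

Let mfB B : measurable B -> measurable_fun setT (fB B).
Proof.
move=> mB; apply: emeasurable_funM; last exact: mmu.
by apply/measurable_EFinP; exact: measurable_indic.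
Qed.

Let fBE B o : Good o -> fB B o = mu o B.
Proof. by move=> Go; rewrite /fB indicE mem_set// mul1e. Qed.

Let fB_bound B g N z s0 : measurable B -> (forall y, 0 <= g y)%E ->
  (forall o, Good o -> (mu o B <= crossing_chain (fun j => W o j%:Z)
    (fun=> 0%N) (fun=> 0%N) (fun=> 0%N) g N 1 z)%E) ->
  (\int[P]_(o in [set o | Y 0 o = v s0]) fB B o <=
    P [set o | Y 0 o = v s0] * iter N T (fun z _ => g z) z s0)%E.
Proof.
move=> mB g0 Bg.
apply: (integral_le_branching v_inj Kdist cS mY markov c01w) => //.
  exact: mfB.
move=> s o so; rewrite /fB indicE; case: (boolP (o \in Good)) => [|_]; last first.
  by rewrite mul0e; exact: crossing_chain_ge0.
rewrite inE mul1e => Go; apply: le_trans (Bg o Go) _.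
rewrite le_eqVlt; apply/orP; left; apply/eqP.
apply: eq_crossing_chain_stacks => j j1 jN.
by apply: WY => //; apply: so; lia.
Qed.

Let ae_of_integrals B : measurable B ->
  (forall s0, (\int[P]_(o in [set o | Y 0 o = v s0]) fB B o = 0)%E) ->
  {ae P, forall o, Good o -> mu o B = 0%E}.
Proof.
move=> mB I0.
have tY : trivIset setT (fun s => [set o | Y 0 o = v s]).
  by move=> s s' ? ? [x [/= e1 e2]]; apply: v_inj; exact: etrans (esym e1) e2.
have := integral0_ae cS (mY 0) tY coverY (mfB mB) (fB_ge0 B) I0.
by apply: filterS => o + Go; rewrite fBE.
Qed.

Lemma iter_alive_ge0 n z s : (0 <= iter n T (fun z _ => (0 < z)%N%:R%:E) z s)%E.
Proof.
elim: n z s => [|n IHn] z s; first by rewrite lee_fin.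
by apply: (branching_step_ge0 K0 c01w) => *; exact: IHn.
Qed.

Lemma iter_alive_extinct n z s :
  (iter n T (fun z _ => (0 < z)%N%:R%:E) z s + extinct_by K c n z s = 1)%E.
Proof.
elim: n z s => [|n IHn] z s.
  by rewrite /extinct_by/= /extinct -EFinD; case: z => [|z]; rewrite ?add0r ?addr0.
rewrite /extinct_by !iterS -(branching_stepD K0 c01w); last 2 first.
  exact: iter_alive_ge0.
  by move=> z' s'; exact: extinct_by_ge0.
rewrite -[RHS](branching_step_cst K0 K1 c01w cM z s ler01).
by apply: eq_avg => s'; apply: eq_avg => y; exact: IHn.
Qed.

(** A walk tending to infinity escapes every range with fewer than [z] left steps from 1, for some
    [z]; this is at most the survival of the branching process started from [z]. *)
Lemma half_line_recurrent : dlt <= 1 ->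
  {ae P, forall o, Good o -> mu o tends_to_pinfty = 0%E}.
Proof.
move=> dlt1.
have [h [H [H0 h0 hH hP]]] := half_line_poisson.
have [F [k [z0 [F0 k0 TF Finf]]]] :=
  lyapunov_recurrent K0 K1 c01w cM H0 h0 hH hP dlt1.
have [B [n0 [Bfin Bmix]]] := mixing_set Kdist pi_dist ue.
have c1 s i : c s i < 1 by have /andP[] := c01 s i.
have ext := extinction1 K0 K1 c01w cM c1 Bfin Bmix F0 k0 TF Finf.
have esc z : {ae P, forall o, Good o -> mu o (\bigcap_N escapes z N) = 0%E}.
  have mesc : measurable (\bigcap_N escapes z N).
    by apply: bigcapT_measurable => N; exact: measurable_escapes.
  apply: ae_of_integrals => // s0; apply/eqP; rewrite eq_le; apply/andP; split;
    last by apply: integral_ge0 => o _; exact: fB_ge0.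
  set p := P [set o | Y 0 o = v s0].
  have p1 : (p <= 1)%E by apply: probability_le1; exact: mY.
  apply/lee_addgt0Pr => e e0; rewrite add0e.
  have : ((1 - e)%:E < extinction K c z s0)%E by rewrite ext lte_fin; lra.
  move=> /ereal_sup_gt[_ [N _ <-]] eN.
  have eN1 : ((1 - e)%:E < extinct_by K c N.+1 z s0)%E.
    by apply: lt_le_trans eN _; apply: extinct_by_homo.
  apply: le_trans (fB_bound (N := N.+1) (z := z) (g := fun y => (0 < y)%N%:R%:E) _ mesc _ _) _.
  - by move=> y; rewrite lee_fin.
  - move=> o Go; apply: le_trans (measure_escapes (W01 Go) (WM Go) (muQ Go) z N).
    apply: le_measure; rewrite ?inE//; first exact: measurable_escapes.
    by move=> X; apply.
  rewrite -/p.
  have al0 := iter_alive_ge0 N.+1 z s0.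
  apply: (@le_trans _ _ (iter N.+1 T (fun z _ => (0 < z)%N%:R%:E) z s0)).
    rewrite -[leRHS]mul1e; exact: lee_wpmul2r.
  have := iter_alive_extinct N.+1 z s0.
  have : (extinct_by K c N.+1 z s0 <= 1)%E by exact: (extinct_by_le1 K0 K1 c01w cM).
  have : (0 <= extinct_by K c N.+1 z s0)%E by exact: (extinct_by_ge0 K0 c01w).
  move: al0 eN1; move: (iter _ _ _ _ _) (extinct_by _ _ _ _ _) => [a||] [b||] //=.
  rewrite !lee_fin lte_fin => a0 be b0 b1 [] ab; lra.
have {}esc : {ae P, forall o, forall z, Good o -> mu o (\bigcap_N escapes z N) = 0%E}.
  by apply/ae_foralln => z; exact: esc.
apply: filterS esc => o oesc Go.
apply: measure_negligible; first exact: measurable_tends_to_pinfty.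
apply: (@negligibleS _ _ _ _ (~` is_walk `|` \bigcup_z \bigcap_N escapes z N)).
  move=> X Xinf; have [wX|] := pselect (is_walk X); last by left.
  by right; have [z zX] := pinfty_escapes wX Xinf; exists z => // N _; exact: zX.
apply: negligibleU.
  apply/negligibleP; first by apply: measurableC; exact: measurable_is_walk.
  exact: (quenched_is_walk (muQ Go)).
apply: negligible_bigcup => z; apply/negligibleP; last exact: oesc.
by apply: bigcapT_measurable => N; exact: measurable_escapes.
Qed.

(** For each [z], the event of [z] returns from the right has averaged probability at most [G z s0],
    by monotone convergence in the range [N]; infinitely many returns imply it for all [z], and [G]
    vanishes at infinity. *)
Lemma half_line_transient : 1 < dlt ->
  {ae P, forall o, Good o -> mu o returns_infinitely_often = 0%E}.
Proof.
move=> dlt1.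
have [h [H [H0 h0 hH hP]]] := half_line_poisson.
have [G [G0 G1 TG Gsmall]] := lyapunov_transient K0 K1 c01w cM H0 h0 hH hP dlt1.
have extG n z s : (extinct_by K c n z s <= (G z s)%:E)%E.
  elim: n z s => [|n IHn] z s.
    rewrite /extinct_by/= /extinct lee_fin.
    by case: eqP => [->|_]; [rewrite G1|exact: G0].
  apply: le_trans (TG z s); rewrite /extinct_by iterS.
  by apply: (le_branching_step K0 c01w) => *; exact: IHn.
pose C z N := comes_back z N.
have mC z N : measurable (C z N) by exact: measurable_comes_back.
have mB z : measurable (\bigcup_N C z N) by exact: bigcupT_measurable.
have IB z s0 : (0 < z)%N ->
    (\int[P]_(o in [set o | Y 0 o = v s0]) fB (\bigcup_N C z N) o <= (G z s0)%:E)%E.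
  move=> z0.
  have IC N : (\int[P]_(o in [set o | Y 0 o = v s0]) fB (C z N) o <= (G z s0)%:E)%E.
    apply: le_trans (fB_bound (N := N.+1) (z := z)
      (g := fun y => (y == 0)%N%:R%:E) _ (mC z N) _ _) _.
    - by move=> y; rewrite lee_fin.
    - by move=> o Go; exact: (measure_comes_back (W01 Go) (muQ Go)).
    apply: le_trans (extG N.+1 z s0).
    have e0 : (0 <= extinct_by K c N.+1 z s0)%E by exact: (extinct_by_ge0 K0 c01w).
    rewrite -[leRHS]mul1e; apply: lee_wpmul2r; first exact: e0.
    by apply: probability_le1; exact: mY.
  have fcvg o : fB (C z N) o @[N --> \oo] --> fB (\bigcup_N C z N) o.
    apply: cvgeZl => //; apply: nondecreasing_cvg_mu => // m n mn.
    by apply/subsetPset; exact: comes_back_homo.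
  have Icvg : (\int[P]_(o in [set o | Y 0 o = v s0]) fB (C z N) o @[N --> \oo] -->
      \int[P]_(o in [set o | Y 0 o = v s0]) fB (\bigcup_N C z N) o)%E.
    have -> : (\int[P]_(o in [set o | Y 0 o = v s0]) fB (\bigcup_N C z N) o =
        \int[P]_(o in [set o | Y 0 o = v s0]) limn (fun N => fB (C z N) o))%E.
      by apply: eq_integral => o _; apply/esym/cvg_lim => //; exact: fcvg.
    apply: cvg_monotone_convergence => //.
    - by move=> N; apply: measurable_funTS; exact: mfB.
    - move=> o _ m n mn; apply: lee_wpmul2l; first by rewrite lee_fin.
      by apply: le_measure; rewrite ?inE//; exact: comes_back_homo.
  rewrite -(cvg_lim _ Icvg)//; apply: lime_le; first by apply/cvg_ex; eexists; exact: Icvg.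
  exact: nearW.
pose R0 : set walk_path := \bigcap_z \bigcup_N C z N.
have mR0 : measurable R0 by exact: bigcapT_measurable.
have aeR0 : {ae P, forall o, Good o -> mu o R0 = 0%E}.
  apply: ae_of_integrals => // s0; apply/eqP; rewrite eq_le; apply/andP; split;
    last by apply: integral_ge0 => o _; exact: fB_ge0.
  apply/lee_addgt0Pr => e e0; rewrite add0e.
  have [N NP] := Gsmall e e0.
  apply: (@le_trans _ _ (G N.+1 s0)%:E); last by rewrite lee_fin; exact: NP.
  apply: le_trans (IB N.+1 s0 isT); apply: ge0_le_integral => //.
  - by apply: measurable_funTS; exact: mfB.
  - by apply: measurable_funTS; exact: mfB.
  - move=> o _; apply: lee_wpmul2l; first by rewrite lee_fin.
    by apply: le_measure; rewrite ?inE// => X; apply.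
apply: filterS aeR0 => o oR0 Go.
apply: measure_negligible; first exact: measurable_returns_infinitely_often.
apply: (@negligibleS _ _ _ _ (~` [set X : walk_path | regular X] `|` R0)).
  move=> X Xinf; have [rX|] := pselect (regular X); last by left.
  by right=> z _; have [N zN] := regular_comes_back rX Xinf z; exists N.
apply: negligibleU; first exact: (negligible_irregular (W01 Go) (WM Go) (muQ Go)).
by apply/negligibleP => //; exact: oR0.
Qed.

End half_line.

(** * Reflection and reversal *)

Section support.
Context {R : realType} d (Om : measurableType d) (P : probability Om R).
Context (T : Type) (S : choiceType) (v : S -> T).
Variables (K : S -> S -> R) (Y : nat -> Om -> T).
Hypothesis v_inj : injective v.
Hypothesis Kdist : transition_matrix K.
Hypothesis cS : countable [set: S].
Hypothesis mY : forall k (s : S), measurable [set o | Y k o = v s].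
Hypothesis markov : forall n (s : nat -> S),
  (P [set o | forall k, (k <= n.+1)%N -> Y k o = v (s k)] =
   P [set o | forall k, (k <= n)%N -> Y k o = v (s k)] * (K (s n) (s n.+1))%:E)%E.
Hypothesis coverY : P (\bigcup_s [set o | Y 0 o = v s]) = 1%E.

(** An instance of [integral_le_branching] with [g = 0] and fictitious fair cookies: the indicator
    of the complement vanishes on every cylinder of length [k], so its integral is bounded by 0. *)
Lemma markov_chain_support k : P (~` \bigcup_s [set o | Y k o = v s]) = 0%E.
Proof.
have mU : measurable (~` \bigcup_s [set o | Y k o = v s]).
  by apply: measurableC; exact: countable_bigcup_measurable.
have half01 (s : S) (i : nat) : 0 <= (2^-1 : R) <= 1 by lra.
have K0 s s' : 0 <= K s s' by have [] := Kdist s.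
have K1 s : (\esum_(s' in setT) (K s s')%:E = 1)%E by have [] := Kdist s.
have stay0 n z s :
    iter n (branching_step K (fun=> fun=> 2^-1)) (fun _ _ => 0%E) z s = 0%E.
  elim: n z s => [//|n IHn] z s; rewrite iterS.
  rewrite -[RHS](branching_step_cst (M := 0) K0 K1 half01
    (fun=> fun=> fun=> erefl) z s (lexx 0)).
  by apply: eq_avg => s'; apply: eq_avg => y; exact: IHn.
have tY : trivIset setT (fun s => [set o | Y 0 o = v s]).
  by move=> i j _ _ [x [/= e1 e2]]; apply: v_inj; exact: etrans (esym e1) e2.
pose f o : \bar R := (\1_(~` \bigcup_s [set o | Y k o = v s]) o)%:E.
have mf : measurable_fun setT f by apply/measurable_EFinP; exact: measurable_indic.
have f0 o : (0 <= f o)%E by rewrite lee_fin.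
have If s0 : (\int[P]_(o in [set o | Y 0 o = v s0]) f o = 0)%E.
  apply/eqP; rewrite eq_le; apply/andP; split; last exact: integral_ge0.
  have := integral_le_branching (z := 0) (g := fun=> 0%E) (N := k)
    v_inj Kdist cS mY markov half01 mf f0 (fun=> lexx _).
  move=> /(_ _ s0); rewrite stay0 mule0; apply.
  move=> s o so.
  apply: (@le_trans _ _ 0%E); last by apply: crossing_chain_ge0 => // j i; exact: half01.
  rewrite /f indicE memNset//= => no; apply: no.
  by exists (s k) => //; exact: so.
have /negligibleP -> // : P.-negligible (~` \bigcup_s [set o | Y k o = v s]).
have := integral0_ae cS (mY 0) tY coverY mf f0 If.
apply: negligibleS => o no /=; rewrite /f indicE mem_set//= => -[/eqP].
by rewrite oner_eq0.
Qed.

End support.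

Section measure_of_mass_one.
Context {R : realType} d (T : measurableType d).
Variables (m : {measure set T -> \bar R}) (m1 : m setT = 1%E).

(** Repackages the value of a probability kernel as a [probability], the structure used by the
    quenched lemmas. *)
Definition mass_one of m setT = 1%E : set T -> \bar R := m.
HB.instance Definition _ := Measure.on (mass_one m1).
HB.instance Definition _ := Measure_isProbability.Build _ _ _ (mass_one m1) m1.

End measure_of_mass_one.

Definition mirror (X : walk_path) : walk_path := fun n => - X n.

Lemma measurable_mirror : measurable_fun setT mirror.
Proof.
apply: (@measurability _ _ walk_path walk_path setT mirror path_cylinders) => //.
move=> _ [_ [n [z ->]] <-]; rewrite setTI.
rewrite (_ : _ @^-1` _ = [set X : walk_path | X n = - z]); first exact: measurable_coord.
by apply/seteqP; split=> X /= e; [rewrite -e opprK|rewrite /mirror e opprK].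
Qed.

Lemma mirror_tends_to_pinfty : mirror @^-1` tends_to_pinfty = tends_to_ninfty.
Proof.
by apply/seteqP; split=> X h z; have := h (- z); apply: filterS => n;
  rewrite /mirror; lia.
Qed.

Lemma mirror_returns : mirror @^-1` returns_infinitely_often = returns_infinitely_often.
Proof.
have e X : [set n | mirror X n = 0] = [set n | X n = 0].
  by apply/seteqP; split=> n /=; rewrite /mirror; lia.
by rewrite /returns_infinitely_often; apply/seteqP; split=> X /=; rewrite e.
Qed.

Lemma visits_mirror x n : visits (mirror x) n = visits x n.
Proof. by apply: eq_card => m; rewrite !inE /mirror eqr_opp. Qed.

Lemma quenched_law_mirror {R : realType} (w : env R) (mu nu : set walk_path -> \bar R) :
  (forall A, nu A = mu (mirror @^-1` A)) ->
  quenched_law 0 w mu -> quenched_law 0 (fun k i => 1 - w (- k) i : R) nu.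
Proof.
move=> nuE [mu0 muS]; split.
  rewrite nuE -[RHS]mu0; congr (mu _).
  by apply/seteqP; split=> X /=; rewrite /mirror; lia.
move=> n x past p.
have := muS n (mirror x); rewrite visits_mirror.
set past' := [set X : walk_path | _]; set p' := w _ _ => -[up dn].
have pp' : p = 1 - p' by [].
have pastE : mirror @^-1` past = past'.
  apply/seteqP; split=> X h m mn; have := h m mn; rewrite /mirror; lia.
have stepE s : mirror @^-1` (past `&` [set X | X n.+1 = x n + s]) =
    past' `&` [set X | X n.+1 = mirror x n - s].
  rewrite preimage_setI pastE; congr (_ `&` _).
  by apply/seteqP; split=> X /=; rewrite /mirror; lia.
by rewrite !nuE pastE !stepE opprK pp' subKr; split.
Qed.

Section reversal.
Context {R : realType} (S : choiceType).
Variables (K : S -> S -> R) (pi : S -> R).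
Hypothesis Kdist : transition_matrix K.
Hypothesis pi_stat : stationary K pi.
Hypothesis Kirr : irreducible_matrix K.

Let pi0 s : 0 <= pi s. Proof. by have [[]] := pi_stat. Qed.
Let K0 s s' : 0 <= K s s'. Proof. by have [] := Kdist s. Qed.

(** Positivity spreads along transitions, hence everywhere by irreducibility; it legitimates the
    division by [pi] in [reversed_matrix]. *)
Lemma stationary_gt0 s : 0 < pi s.
Proof.
have [x px] : exists x, 0 < pi x.
  apply: contrapT => /forallNP np; have [[_]] := pi_stat.
  rewrite esum1; first by move/eqP; rewrite eq_sym onee_eq0.
  move=> x _; congr (_%:E); apply/eqP; rewrite eq_le pi0 andbT leNgt.
  by apply/negP; exact: np.
have step y z : 0 < pi y -> 0 < K y z -> 0 < pi z.
  move=> py Kyz; rewrite -lte_fin; have [_ <-] := pi_stat.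
  apply: (@lt_le_trans _ _ (pi y * K y z)%:E); first by rewrite lte_fin mulr_gt0.
  by apply: (@term_le_esum _ _ (fun x => (pi x * K x z)%:E)) => u;
    rewrite lee_fin mulr_ge0.
suff reach n y : 0 < pi y -> 0 < kpow K n y s -> 0 < pi s.
  by have [n nP] := Kirr x s; exact: reach px nP.
elim: n y => [|n IHn] y py /=; first by case: eqP => [<-//|_]; rewrite ltxx.
move=> Kn; have [z [Kz Knz]] : exists z, 0 < K y z /\ 0 < kpow K n z s.
  apply: contrapT => /forallNP nz; move: Kn; rewrite esum1 ?ltxx// => z _.
  congr (_%:E); apply/eqP; rewrite mulf_eq0.
  have kn0 : 0 <= kpow K n z s by have [] := kpow_distribution Kdist n z.
  have [//|/= Kz] := eqVneq (K y z) 0; apply/negPn/negP => knz; apply: (nz z).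
  by rewrite !lt_def Kz knz K0 kn0.
by apply: IHn Knz; exact: step Kz.
Qed.

Lemma reversed_transition_matrix : transition_matrix (reversed_matrix K pi).
Proof.
move=> r; split=> [r'|]; first by rewrite /reversed_matrix !mulr_ge0 ?invr_ge0.
transitivity (\esum_(r' in setT) ((pi r)^-1%:E * (pi r' * K r' r)%:E))%E.
  by apply: eq_esum => r' _; rewrite -EFinM; congr (_%:E); rewrite /reversed_matrix; ring.
rewrite esum_mull ?invr_ge0//; last by move=> r'; rewrite lee_fin mulr_ge0.
have [_ ->] := pi_stat.
by rewrite -EFinM mulVf// gt_eqF// stationary_gt0.
Qed.

End reversal.

Section absolutely_summable.
Context {R : realType} (S : choiceType).
Variables (p f : S -> R) (b : R).
Hypothesis p_dist : is_distribution p.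
Hypothesis fb : forall s, - b <= f s <= b.

Lemma real_sumN (g : S -> R) : real_sum (fun s => - g s) = - real_sum g.
Proof.
rewrite /real_sum opprB; congr (fine _ - fine _); apply: eq_esum => s _.
  by rewrite -funeposN.
by rewrite -funenegN.
Qed.

(** Links [real_sum], in which [drift] is defined, with averages of nonnegative functions: the sum
    of negative parts is moved to the other side before sums are added. *)
Lemma avg_real_sum :
  avg p (fun s => (f s + b)%:E) = (real_sum (fun s => p s * f s) + b)%:E.
Proof.
have [p0 p1] := p_dist.
have [s0 _] : exists s : S, True.
  apply/not_existsP => ns; move: p1.
  rewrite esum1; first by move/eqP; rewrite eq_sym onee_eq0.
  by move=> s; have := ns s; case.
have b0 : 0 <= b by have := fb s0; lra.
pose g s := p s * f s; rewrite /real_sum -/g.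
have part (h : S -> \bar R) : (forall s, 0 <= h s <= (p s * b)%:E)%E ->
    exists r : R, (\esum_(s in setT) h s = r%:E)%E.
  move=> hb; have h0 : (0 <= \esum_(s in setT) h s)%E.
    by apply: esum_ge0 => s _; have /andP[] := hb s.
  exists (fine (\esum_(s in setT) h s)); rewrite fineK// ge0_fin_numE//.
  apply: (@le_lt_trans _ _ b%:E); last exact: ltry.
  rewrite -(avgc p0 b0 p1); apply: le_esum => s _.
  by have /andP[_] := hb s; rewrite EFinM.
have pb s : 0 <= p s * b by rewrite mulr_ge0.
have gpE s : ((EFin \o g)^\+ s)%E = (Num.max (g s) 0)%:E by rewrite funeposE/= -EFin_max.
have gnE s : ((EFin \o g)^\- s)%E = (Num.max (- g s) 0)%:E by rewrite funenegE/= -EFin_max.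
have gb s : `|g s| <= p s * b.
  by rewrite normrM ger0_norm// ler_wpM2l// ler_norml; exact: fb.
have [gp gpS] : exists r : R, (\esum_(s in setT) ((EFin \o g)^\+ s) = r%:E)%E.
  apply: part => s; rewrite gpE !lee_fin le_max lexx orbT ge_max pb andbT.
  exact: le_trans (ler_norm _) (gb s).
have [gn gnS] : exists r : R, (\esum_(s in setT) ((EFin \o g)^\- s) = r%:E)%E.
  apply: part => s; rewrite gnE !lee_fin le_max lexx orbT ge_max pb andbT.
  by apply: le_trans (ler_norm _) _; rewrite normrN.
rewrite gpS gnS /=.
have fb0 s : (0 <= (f s + b)%:E)%E by rewrite lee_fin; have := fb s; lra.
have : (avg p (fun s => (f s + b)%:E) + gn%:E = gp%:E + b%:E)%E.
  rewrite -gnS -gpS -(avgc p0 b0 p1) /avg -!esumD.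
  - apply: eq_esum => s _; rewrite gpE gnE -!EFinM -!EFinD; congr (_%:E).
    have -> : p s * (f s + b) = g s + p s * b by rewrite mulrDr.
    suff -> : Num.max (g s) 0 = g s + Num.max (- g s) 0 by ring.
    by have [g0|g0] := leP 0 (g s); [rewrite max_r|rewrite max_l]; lra.
  - by move=> s _; rewrite gpE lee_fin le_max lexx orbT.
  - by move=> s _; apply: mule_ge0 => //; rewrite lee_fin.
  - by move=> s _; apply: mule_ge0 => //; rewrite lee_fin.
  - by move=> s _; rewrite gnE lee_fin le_max lexx orbT.
have : (0 <= avg p (fun s => (f s + b)%:E))%E by exact: avg_ge0.
case: (avg _ _) => [a||]//= _ [] e; congr (_%:E); lra.
Qed.

End absolutely_summable.

(** * Walks in the two-sided environment *)

HB.instance Definition _ := isMeasurableFun.Build _ _ _ _ mirror measurable_mirror.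

Lemma probability_one_of_null {R : realType} (mu : probability walk_path R)
    (A B C : set walk_path) :
  measurable A -> measurable B -> measurable C ->
  (forall X, regular X -> [\/ A X, B X | C X]) ->
  mu.-negligible (~` [set X : walk_path | regular X]) ->
  mu B = 0%E -> mu C = 0%E -> mu A = 1%E.
Proof.
move=> mA mB mC ABC nreg B0 C0.
have /negligibleP : mu.-negligible (~` A).
  apply: (@negligibleS _ _ _ _ (~` [set X : walk_path | regular X] `|` (B `|` C))).
    move=> X nA; have [rX|] := pselect (regular X); last by left.
    by right; have [|BX|CX] := ABC X rX; [|left|right].
  by apply: negligibleU => //; apply: negligibleU; apply/negligibleP.
move=> /(_ (measurableC mA)) A0.
have e : (mu (~` A) = 1 - mu A)%E by exact: probability_setC.
have : mu A \is a fin_num by exact: fin_num_measure.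
move: e; rewrite A0; case: (mu A) => [a||]//= [] e _; congr (_%:E); lra.
Qed.

Section markovian_environment.
Context {R : realType} (M : nat) (S : set (cookie_stack R)).
Variables (K : S -> S -> R) (pi phi : S -> R) (P : probability (env R) R).
Hypothesis hA : assumptionA M K pi phi P.

Definition stacks_in_support : set (env R) :=
  [set w | forall k : int, exists s : S, w k = val s].

Lemma countable_support : countable [set: S].
Proof. by rewrite (eq_countable (card_setT _)); exact: A_countable hA. Qed.

Lemma measurable_stack k (s : S) : measurable [set w : env R | w k = val s].
Proof.
rewrite (_ : [set w | _] = \bigcap_i [set w : env R | [set val s i] (w k i)]).
  apply: bigcapT_measurable => i; apply: sub_sigma_algebra.
  by exists k, i, [set val s i]; split.
apply/seteqP; split=> w /=; first by move=> wk i _; rewrite /= wk.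
by move=> h; apply/funext => i; exact: h i I.
Qed.

Let supported (k : int) := \bigcup_(s : S) [set w : env R | w k = val s].

Let measurable_supported k : measurable (supported k).
Proof.
apply: countable_bigcup_measurable => [|s]; first exact: countable_support.
exact: measurable_stack.
Qed.

Let stacks_in_supportE :
  stacks_in_support = \bigcap_n (supported n%:Z `&` supported (- n%:Z)).
Proof.
apply/seteqP; split=> w h k.
  move=> _; have [s ws] := h k%:Z; have [s' ws'] := h (- k%:Z).
  by split; [exists s|exists s'].
have [[s _ ws] [s' _ ws']] := h `|k|%N I.
have [k0|k0] := leP 0 k; [exists s|exists s'].
  by rewrite -[RHS]ws; congr (w _); lia.
by rewrite -[RHS]ws'; congr (w _); lia.
Qed.

Lemma measurable_stacks_in_support : measurable stacks_in_support.
Proof.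
by rewrite stacks_in_supportE; apply: bigcapT_measurable => n; exact: measurableI.
Qed.

Lemma initial_stack_in_support :
  P (\bigcup_(s : S) [set w | w 0 = val s]) = 1%E.
Proof.
have mU := measurable_supported 0.
have eP A : measurable A -> P A = (\int[P]_(w in A) (cst 1 w))%E.
  by move=> mA; rewrite integral_cst// mul1e.
rewrite eP// integral_countable_bigcup//.
- have [_ phi1] := A_initial_distribution hA; rewrite -[RHS]phi1.
  apply: eq_esum => s _; rewrite -(A_initial hA s).
  by apply/esym/eP; exact: measurable_stack.
- exact: countable_support.
- by move=> s; exact: measurable_stack.
- move=> s s' _ _ [w [/= e1 e2]]; apply: val_inj; exact: etrans (esym e1) e2.
Qed.

Let pi_dist : is_distribution pi. Proof. exact: (A_stationary hA).1. Qed.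

Lemma reversed_dist : transition_matrix (reversed_matrix K pi).
Proof.
exact: (reversed_transition_matrix (A_matrix hA) (A_stationary hA) (A_irreducible hA)).
Qed.

Lemma not_stacks_in_support : P (~` stacks_in_support) = 0%E.
Proof.
have cov0 : P (\bigcup_(s : S) [set w | (w : env R) 0%N%:Z = val s]) = 1%E.
  exact: initial_stack_in_support.
have cov0N : P (\bigcup_(s : S) [set w | (w : env R) (- 0%N%:Z) = val s]) = 1%E.
  exact: initial_stack_in_support.
have fw n := markov_chain_support val_inj (A_matrix hA) countable_support
  (fun k s => measurable_stack k%:Z s) (A_forward hA) cov0 n.
have bw n := markov_chain_support val_inj reversed_dist countable_support
  (fun k s => measurable_stack (- k%:Z) s) (A_backward hA) cov0N n.
apply: measure_negligible; first by apply: measurableC; exact: measurable_stacks_in_support.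
rewrite stacks_in_supportE setC_bigcap; apply: negligible_bigcup => n.
rewrite setCI; apply: negligibleU; apply/negligibleP; try exact: measurableC.
  exact: fw.
exact: bw.
Qed.

Lemma support_cookie (s : S) i : 0 < val s i < 1.
Proof.
have [s01 sM] : @Sstar R M (val s) by apply: (A_Sstar hA); exact: set_valP.
have [iM|Mi] := ltnP i M; first exact: s01.
by rewrite sM//; lra.
Qed.

Lemma support_placebo (s : S) i : (M <= i)%N -> val s i = 2^-1.
Proof.
have [_ sM] : @Sstar R M (val s) by apply: (A_Sstar hA); exact: set_valP.
exact: sM.
Qed.

Let f (s : S) : R := \sum_(i < M) (2 * val s i - 1).

Let fM s : - M%:R <= f s <= M%:R.
Proof.
have e : \sum_(i < M) (1 : R) = M%:R by rewrite sumr_const card_ord.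
rewrite -e -sumrN; apply/andP; split; apply: ler_sum => i _;
  by have := support_cookie s i; lra.
Qed.

Lemma mean_drift_right :
  avg pi (fun s : S => (\sum_(i < M) 2 * val s i)%:E) = (drift M pi + M%:R)%:E.
Proof.
rewrite -(avg_real_sum pi_dist fM); apply: eq_avg => s; congr (_%:E).
by rewrite /f sumrB sumr_const card_ord subrK.
Qed.

Lemma mean_drift_left :
  avg pi (fun s : S => (\sum_(i < M) 2 * (1 - val s i))%:E) = (- drift M pi + M%:R)%:E.
Proof.
have fMN s : - M%:R <= - f s <= M%:R by have := fM s; lra.
transitivity (avg pi (fun s => (- f s + M%:R)%:E)).
  apply: eq_avg => s; congr (_%:E).
  have e : \sum_(i < M) (1 : R) = M%:R by rewrite sumr_const card_ord.
  by rewrite -e -sumrN -big_split/=; apply: eq_bigr => i _; ring.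
rewrite (avg_real_sum pi_dist fMN); congr ((_ + _)%:E).
by rewrite /drift -real_sumN; congr real_sum; apply/funext => s; rewrite mulrN.
Qed.

Variable Q : R.-pker (env R) ~> walk_path.
Hypothesis hQ : quenched_kernel 0 Q.

Definition walk_law (w : env R) : probability walk_path R := mass_one (prob_kernel (s := Q) w).

Lemma stacks_in_support_01 w : stacks_in_support w -> forall k i, 0 <= w k i <= 1.
Proof.
by move=> Gw k i; have [s ->] := Gw k; have := support_cookie s i; lra.
Qed.

Lemma walk_law_quenched w : stacks_in_support w -> quenched_law 0 w (walk_law w).
Proof. by move=> Gw; apply: hQ => k i; exact: stacks_in_support_01. Qed.

Lemma measurable_walk_law B : measurable B ->
  measurable_fun setT (fun w => walk_law w B).
Proof. exact: (measurable_kernel Q). Qed.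

Definition mirror_law (w : env R) : probability walk_path R :=
  distribution (walk_law w) mirror.

Definition mirror_env (w : env R) (k : int) (i : nat) : R := 1 - w (- k) i.

Lemma mirror_law_quenched w : stacks_in_support w ->
  quenched_law 0 (mirror_env w) (mirror_law w).
Proof. by move=> /walk_law_quenched; exact: quenched_law_mirror. Qed.

Lemma measurable_mirror_law B : measurable B ->
  measurable_fun setT (fun w => mirror_law w B).
Proof.
move=> mB; apply: measurable_walk_law; rewrite -[X in measurable X]setTI.
exact: measurable_mirror.
Qed.

Lemma walk_law_pinfty0 : drift M pi <= 1 ->
  {ae P, forall w, stacks_in_support w -> walk_law w tends_to_pinfty = 0%E}.
Proof.
apply: (half_line_recurrent (mu := walk_law) (dlt := drift M pi)
  (Y := fun k (w : env R) => w k%:Z)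
  (W := fun w => w) (c := fun s : S => val s)
  val_inj countable_support
  (A_matrix hA) pi_dist (A_uniformly_ergodic hA)
  (fun k s => measurable_stack k%:Z s) (A_forward hA) initial_stack_in_support
  support_cookie support_placebo measurable_stacks_in_support).
- exact: stacks_in_support_01.
- by move=> w Gw k i Mi; have [s ->] := Gw k; exact: support_placebo.
- by [].
- exact: walk_law_quenched.
- exact: measurable_walk_law.
- exact: mean_drift_right.
Qed.

Lemma walk_law_returns0 : 1 < drift M pi ->
  {ae P, forall w, stacks_in_support w -> walk_law w returns_infinitely_often = 0%E}.
Proof.
apply: (half_line_transient (mu := walk_law) (dlt := drift M pi)
  (Y := fun k (w : env R) => w k%:Z)
  (W := fun w => w) (c := fun s : S => val s)
  val_inj countable_support
  (A_matrix hA) pi_dist (A_uniformly_ergodic hA)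
  (fun k s => measurable_stack k%:Z s) (A_forward hA) initial_stack_in_support
  support_cookie support_placebo measurable_stacks_in_support).
- exact: stacks_in_support_01.
- by move=> w Gw k i Mi; have [s ->] := Gw k; exact: support_placebo.
- by [].
- exact: walk_law_quenched.
- exact: measurable_walk_law.
- exact: mean_drift_right.
Qed.

Let mirror_cookie (s : S) i : 0 < 1 - val s i < 1.
Proof. by have := support_cookie s i; lra. Qed.

Let mirror_placebo (s : S) i : (M <= i)%N -> 1 - val s i = 2^-1.
Proof. by move=> Mi; rewrite support_placebo//; lra. Qed.

Let mirror_env_01 w : stacks_in_support w ->
  forall k i, 0 <= mirror_env w k i <= 1.
Proof.
move=> Gw k i; rewrite /mirror_env.
by have := stacks_in_support_01 Gw (- k) i; lra.
Qed.

Let mirror_env_placebo w : stacks_in_support w ->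
  forall k i, (M <= i)%N -> mirror_env w k i = 2^-1.
Proof.
move=> Gw k i Mi; rewrite /mirror_env; have [s ->] := Gw (- k).
exact: mirror_placebo.
Qed.

Let mirror_env_stack w : stacks_in_support w ->
  forall k (s : S), w (- k%:Z) = val s -> mirror_env w k%:Z = fun i => 1 - val s i.
Proof. by move=> Gw k s ws; apply/funext => i; rewrite /mirror_env ws. Qed.

Lemma walk_law_ninfty0 : - 1 <= drift M pi ->
  {ae P, forall w, stacks_in_support w -> walk_law w tends_to_ninfty = 0%E}.
Proof.
move=> d1; rewrite -mirror_tends_to_pinfty.
apply: (half_line_recurrent (mu := mirror_law) (dlt := - drift M pi)
  (Y := fun k (w : env R) => w (- k%:Z)) (W := mirror_env)
  val_inj countable_support reversed_dist pi_dist
  (A_reversed_uniformly_ergodic hA) (fun k s => measurable_stack (- k%:Z) s)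
  (A_backward hA) initial_stack_in_support mirror_cookie mirror_placebo
  measurable_stacks_in_support mirror_env_01 mirror_env_placebo mirror_env_stack
  mirror_law_quenched measurable_mirror_law mean_drift_left); lra.
Qed.

Lemma walk_law_returns0_left : drift M pi < - 1 ->
  {ae P, forall w, stacks_in_support w -> walk_law w returns_infinitely_often = 0%E}.
Proof.
move=> d1; rewrite -mirror_returns.
apply: (half_line_transient (mu := mirror_law) (dlt := - drift M pi)
  (Y := fun k (w : env R) => w (- k%:Z)) (W := mirror_env)
  val_inj countable_support reversed_dist pi_dist
  (A_reversed_uniformly_ergodic hA) (fun k s => measurable_stack (- k%:Z) s)
  (A_backward hA) initial_stack_in_support mirror_cookie mirror_placebo
  measurable_stacks_in_support mirror_env_01 mirror_env_placebo mirror_env_stack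
  mirror_law_quenched measurable_mirror_law mean_drift_left); lra.
Qed.

Lemma averaged_law_one (A B C : set walk_path) :
  measurable A -> measurable B -> measurable C ->
  (forall X, regular X -> [\/ A X, B X | C X]) ->
  {ae P, forall w, stacks_in_support w -> walk_law w B = 0%E} ->
  {ae P, forall w, stacks_in_support w -> walk_law w C = 0%E} ->
  averaged_law P Q A = 1%E.
Proof.
move=> mA mB mC ABC aeB aeC.
have aeG : {ae P, forall w, stacks_in_support w}.
  apply/negligibleP; last exact: not_stacks_in_support.
  by apply: measurableC; exact: measurable_stacks_in_support.
transitivity (\int[P]_w (cst 1 w))%E; last first.
  by rewrite integral_cst// mul1e; exact: probability_setT.
apply: ae_eq_integral => //; first exact: measurable_kernel.
move: aeG aeB aeC; apply: filterS3 => w Gw Bw Cw _.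
have w01 := stacks_in_support_01 Gw.
have wM k i : (M <= i)%N -> w k i = 2^-1.
  by have [s ->] := Gw k; exact: support_placebo.
have nreg := negligible_irregular w01 wM (walk_law_quenched Gw).
exact: (probability_one_of_null mA mB mC ABC nreg (Bw Gw) (Cw Gw)).
Qed.

End markovian_environment.

Theorem theorem1p11 (R : realType) (M : nat) (M_gt0 : (0 < M)%N)
    (S : set (cookie_stack R)) (K : S -> S -> R) (pi phi : S -> R)
    (P : probability (env R) R) (hA : assumptionA M K pi phi P)
    (Q : R.-pker (env R) ~> walk_path) (hQ : quenched_kernel 0 Q) :
  [/\ (-1 <= drift M pi <= 1 ->
         averaged_law P Q returns_infinitely_often = 1%E),
      (1 < drift M pi -> averaged_law P Q tends_to_pinfty = 1%E) &
      (drift M pi < -1 -> averaged_law P Q tends_to_ninfty = 1%E)].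
Proof.
have mr := measurable_returns_infinitely_often.
have mp := measurable_tends_to_pinfty; have mn := measurable_tends_to_ninfty.
split=> [/andP[d1 d2]|d1|d1].
- apply: (averaged_law_one hA hQ mr mp mn regular_trichotomy).
    exact: (walk_law_pinfty0 hA hQ).
  exact: (walk_law_ninfty0 hA hQ).
- apply: (averaged_law_one hA hQ mp mr mn).
  + by move=> X /regular_trichotomy[]; [apply: Or32|apply: Or31|apply: Or33].
  + exact: (walk_law_returns0 hA hQ).
  (* The reflected half-line has mean drift [- delta < - 1], so its branching process dies out and
     escape to the left is excluded. *)
  + by apply: (walk_law_ninfty0 hA hQ); lra.
- apply: (averaged_law_one hA hQ mn mr mp).
  + by move=> X /regular_trichotomy[h|h|h]; [apply: Or32|apply: Or33|apply: Or31].
  + exact: (walk_law_returns0_left hA hQ).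
  + by apply: (walk_law_pinfty0 hA hQ); lra.
Qed.
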